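(* Let $A\subset\mathbb{R}^n$ be a set of finite perimeter and let $Q\subset\mathbb{R}^n$ be a nonempty compact set. Then (i) $\displaystyle\liminf_{r\to0_+}\frac1r\lambda_n((A\oplus rQ)\setminus A)\ge P_Q(A)$; (ii) if the isotropic outer Minkowski content $\mathcal{SM}_{B^n}(A)$ exists and equals $P(A)$, then $A$ admits the outer $Q$-Minkowski content and $\mathcal{SM}_Q(A)=P_Q(A)$.
   Context: $\lambda_n$ is Lebesgue measure, $B^n$ the Euclidean unit ball, $S^{n-1}$ the unit sphere, $A\oplus Q=\{x+y:x\in A,y\in Q\}$. For a compact $Q$, the outer $Q$-Minkowski content of $A$ is $\mathcal{SM}_Q(A)=\lim_{r\to0_+}\frac1r\lambda_n((A\oplus rQ)\setminus A)$, and $A$ admits it if this limit exists and is finite; the isotropic one is $\mathcal{SM}_{B^n}(A)$. For a set $A$ of finite perimeter, $A^t$ denotes the points of Lebesgue density $t$, $\partial^*A=\mathbb{R}^n\setminus(A^0\cup A^1)$ is the essential boundary, $P(A)=\mathcal H^{n-1}(\partial^*A)$ the perimeter, and $\nu_A$ the measure-theoretic outer unit normal (i.e. $D\mathbf 1_A=-\nu_A\,\mathcal H^{n-1}\llcorner\partial^*A$), defined $\mathcal H^{n-1}$-a.e. on $\partial^*A$. The generalized surface area measure is $S^*_{n-1}(A,\cdot)=\mathcal H^{n-1}(\{a\in\partial^*A:\nu_A(a)\in\cdot\})$ on $S^{n-1}$. For $M\subset\mathbb{R}^n$, $h(M,v)=\sup_{x\in M}\langle x,v\rangle$. The anisotropic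 perimeter is $P_Q(A)=\int_{S^{n-1}}h(Q\cup\{0\},v)\,S^*_{n-1}(A,dv)$. *)

(* Defs.v *)
From HB Require Import structures.
From mathcomp Require Import all_boot all_order all_algebra.
From mathcomp Require Import all_classical all_reals all_analysis.
Set Implicit Arguments. Unset Strict Implicit. Unset Printing Implicit Defensive.
Import Order.TTheory GRing.Theory Num.Theory.
Import numFieldNormedType.Exports.
Local Open Scope classical_set_scope.
Local Open Scope ring_scope.

Section Defs.
Variable R : realType.

Definition dotv n (x y : 'rV[R]_n) : R := \sum_i x 0 i * y 0 i.
Definition eucl n (x : 'rV[R]_n) : R := Num.sqrt (dotv x x).

Definition eball n (x : 'rV[R]_n) (r : R) : set 'rV[R]_n :=
  [set y | eucl (y - x) <= r].
Definition unit_ball n : set 'rV[R]_n := eball 0 1.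

Definition box k (a b : 'rV[R]_k) : set 'rV[R]_k :=
  [set x | forall i, a 0 i <= x 0 i <= b 0 i].
Definition obox k (c : option ('rV[R]_k * 'rV[R]_k)) : set 'rV[R]_k :=
  if c is Some ab then box ab.1 ab.2 else set0.
Definition ovol k (c : option ('rV[R]_k * 'rV[R]_k)) : R :=
  if c is Some ab then \prod_i Num.max (ab.2 0 i - ab.1 0 i) 0 else 0.
Definition leb_outer k (E : set 'rV[R]_k) : \bar R :=
  ereal_inf [set s | exists c : nat -> option ('rV[R]_k * 'rV[R]_k),
     E `<=` \bigcup_j obox (c j) /\
     s = (\sum_(0 <= j <oo) (ovol (c j))%:E)%E].

Definition cara_meas T (mu : set T -> \bar R) (A : set T) : Prop :=
  forall E, mu E = (mu (E `&` A) + mu (E `\` A))%E.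

Definition omega (s : nat) : R := fine (leb_outer (@unit_ball s)).
Definition diam n (C : set 'rV[R]_n) : \bar R :=
  if `[< C = set0 >] then 0%E
  else ereal_sup [set (eucl (x - y))%:E | x in C & y in C].
Definition haus_term n (s : nat) (C : set 'rV[R]_n) : R :=
  if `[< C = set0 >] then 0 else omega s * (fine (diam C) / 2) ^+ s.
Definition haus_delta n (s : nat) (d : R) (E : set 'rV[R]_n) : \bar R :=
  ereal_inf [set t | exists C : nat -> set 'rV[R]_n,
     E `<=` \bigcup_j C j /\ (forall j, (diam (C j) <= d%:E)%E) /\
     t = (\sum_(0 <= j <oo) (haus_term s (C j))%:E)%E].
Definition hausdorff n (s : nat) (E : set 'rV[R]_n) : \bar R :=
  ereal_sup [set haus_delta s d E | d in `]0, +oo[%classic].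

(* ---- integral of a nonnegative function w.r.t. an outer measure
   (layer-cake formula), and of a real function via positive/negative parts ---- *)
Definition lc_int T (mu : set T -> \bar R) (S : set T) (f : T -> \bar R) : \bar R :=
  (\int[@lebesgue_measure R]_(t in [set t : R | (0 < t)%R])
      mu (S `&` [set x | (t%:E < f x)%E]))%E.
Definition s_int T (mu : set T -> \bar R) (S : set T) (f : T -> R) : \bar R :=
  (lc_int mu S (fun x => (Num.max (f x) 0)%:E)
   - lc_int mu S (fun x => (Num.max (- f x) 0)%:E))%E.

Definition density_pts n (A : set 'rV[R]_n) (t : R) : set 'rV[R]_n :=
  [set x | (fun r => fine (leb_outer (A `&` eball x r)) / fine (leb_outer (eball x r)))
             @ 0^'+ --> t].
Definition ess_bd n (A : set 'rV[R]_n) : set 'rV[R]_n :=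
  ~` (density_pts A 0 `|` density_pts A 1).

Definition evec n (i : 'I_n) : 'rV[R]_n := delta_mx 0 i.
Definition comp n (phi : 'rV[R]_n -> 'rV[R]_n) (i : 'I_n) : 'rV[R]_n -> R :=
  fun y => phi y 0 i.
Definition Cc1 n (phi : 'rV[R]_n -> 'rV[R]_n) : Prop :=
  (forall i x, derivable (comp phi i) x (evec i)) /\
  (forall i, continuous (fun x => 'D_(evec i) (comp phi i) x)) /\
  (exists M : R, forall x, M < eucl x -> phi x = 0).
Definition divg n (phi : 'rV[R]_n -> 'rV[R]_n) (x : 'rV[R]_n) : R :=
  \sum_i 'D_(evec i) (comp phi i) x.

Definition finite_perimeter n (A : set 'rV[R]_n) : Prop :=
  cara_meas (@leb_outer n) A /\
  (ereal_sup [set s_int (@leb_outer n) A (divg phi) | phi in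
     [set phi | Cc1 phi /\ forall x, (eucl (phi x) <= 1)%R]] < +oo)%E.

Definition perimeter n (A : set 'rV[R]_n) : \bar R := hausdorff n.-1 (ess_bd A).

(* nu is a measure-theoretic outer unit normal of A:
   D 1_A = - nu H^{n-1} restricted to d*A, i.e. the Gauss--Green formula
   int_A div phi dx = int_{d*A} <phi, nu> dH^{n-1} for all phi in C^1_c,
   with nu H^{n-1}-measurable and of unit length on d*A *)
Definition outer_normal n (A : set 'rV[R]_n) (nu : 'rV[R]_n -> 'rV[R]_n) : Prop :=
  (forall a, ess_bd A a -> eucl (nu a) = 1) /\
  (forall (i : 'I_n) (t : R), cara_meas (@hausdorff n n.-1)
      (ess_bd A `&` [set a | t < nu a 0 i])) /\
  (forall phi, Cc1 phi ->
     s_int (@leb_outer n) A (divg phi)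
     = s_int (@hausdorff n n.-1) (ess_bd A) (fun a => dotv (phi a) (nu a))).

Definition supp_fun n (M : set 'rV[R]_n) (v : 'rV[R]_n) : \bar R :=
  ereal_sup [set (dotv x v)%:E | x in M].

(* anisotropic perimeter P_Q(A) = int_{S^{n-1}} h(Q u {0}, v) S*_{n-1}(A, dv)
   = int_{d*A} h(Q u {0}, nu_A(a)) dH^{n-1}(a) *)
Definition aniso_perimeter n (Q A : set 'rV[R]_n) (nu : 'rV[R]_n -> 'rV[R]_n) : \bar R :=
  lc_int (@hausdorff n n.-1) (ess_bd A) (fun a => supp_fun (Q `|` [set 0]) (nu a)).

Definition msum n (A Q : set 'rV[R]_n) : set 'rV[R]_n := [set x + y | x in A & y in Q].
Definition dil n (r : R) (Q : set 'rV[R]_n) : set 'rV[R]_n := [set r *: y | y in Q].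
Definition mink_quot n (Q A : set 'rV[R]_n) (r : R) : \bar R :=
  (leb_outer (msum A (dil r Q) `\` A) * (r^-1)%:E)%E.

Definition liminf0 (g : R -> \bar R) : \bar R :=
  ereal_sup [set ereal_inf [set g r | r in `]0, d[%classic] | d in `]0, +oo[%classic].

Definition outer_mink_content n (Q A : set 'rV[R]_n) (l : R) : Prop :=
  mink_quot Q A r @[r --> 0^'+] --> l%:E.

End Defs.

(* Main.v *)
Require Import Defs.
From HB Require Import structures.
From mathcomp Require Import all_boot all_order all_algebra.
From mathcomp Require Import all_classical all_reals all_analysis.
From mathcomp Require Import measurable_realfun ring lra.
Set Implicit Arguments. Unset Strict Implicit. Unset Printing Implicit Defensive.
Import Order.TTheory GRing.Theory Num.Theory.
Import numFieldNormedType.Exports.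
Local Open Scope classical_set_scope.
Local Open Scope ring_scope.

(** The boundary enters only through the Gauss-Green formula: writing
[H] for the Hausdorff measure on [S], the essential boundary of [A], it gives for
every [C^1] cut-off [w]
  [(\int_{A + r q} w - \int_A w) / r --> \int_S w <q, nu> dH].
For (i), [A + r Q] contains the translates [A + r q], so for every [q] in [Q] the
normalised integral of [w] over [(A + r Q) \ A] is asymptotically at least
[\int_S w <q, nu>]. Splitting [w] with cut-offs close to indicators of sets on
which different [q] are optimal, one may replace [<q, nu>] by the maximum over a
finite net of [Q] and [0], and finally by the support function.
For (ii), apply the same bound to balls: since the isotropic content equals
[H(S)], no mass can be lost, and the shell of width [r] satisfies the matching
upper bound for every [w]. If [Q] is contained in the ball of centre [z] and
radius [rho], then [A + r Q] is contained in the [rho r]-neighbourhood of [A]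
translated by [r z], which costs at most [\int_S w (rho + <z, nu>)]. Intersecting
finitely many such neighbourhoods, for balls that approximate the half-spaces
supporting [Q] and [0], and localising again, bounds the content from above by
the integral of the support function. *)

(** The obstacle is that [nu] is only measurable, whereas Gauss-Green tests against [C^1] fields:
    the point [q] that is optimal at [a] cannot be chosen continuously in [a]. This forces the
    detour through finite maxima, where each [q] governs a measurable set whose indicator is an
    [L^1] limit of cut-offs. That density rests on three facts about the outer measure: half-spaces
    are Caratheodory measurable, so Borel sets are; every set has a Borel hull of the same measure;
    and [S] has finite mass in every cube. The last one is itself extracted from Gauss-Green and
    [|nu| = 1], without any structure theory of the boundary. Apart from these facts the Hausdorff
    measure may be any outer measure [mu]. The selection of maxima is proved for an abstract
    additive functional of [w], because (ii) applies it with the opposite sign: a maximum of lower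
    bounds for minus an integral is a minimum of upper bounds for it, which is exactly what an
    intersection of neighbourhoods provides. *)

(** * Outer measures defined by countable covers *)

Section cover_outer.
Context {R : realType} {T : Type} {I : Type}.
Variables (P : I -> Prop) (s : I -> set T) (c : I -> R) (i0 : I).
Hypotheses (c0 : forall i, 0 <= c i) (Pi0 : P i0) (si0 : s i0 = set0)
  (ci0 : c i0 = 0).

(** Common form of [leb_outer] (indices are optional boxes, [P] is trivial) and of [haus_delta]
    (indices are the covering sets, [P] bounds their diameter), so that subadditivity is proved once
    for both. *)
Definition cover_inf (E : set T) : \bar R :=
  ereal_inf [set t | exists C : nat -> I, E `<=` \bigcup_j s (C j) /\
    (forall j, P (C j)) /\ t = (\sum_(0 <= j <oo) (c (C j))%:E)%E].

Lemma cover_inf_ge0 E : (0 <= cover_inf E)%E.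
Proof.
apply: le_ereal_inf_tmp => _ [C [_ [_ ->]]].
by apply: nneseries_ge0 => *; rewrite lee_fin.
Qed.

Lemma cover_inf0 : cover_inf set0 = 0%E.
Proof.
apply/eqP; rewrite eq_le cover_inf_ge0 andbT.
apply: ereal_inf_lbound; exists (fun=> i0); split => //; split => //.
by rewrite eseries0// => *; rewrite ci0.
Qed.

Lemma le_cover_inf E F : E `<=` F -> (cover_inf E <= cover_inf F)%E.
Proof.
move=> EF; apply: ereal_inf_le_tmp => _ [C [FC [PC ->]]].
by exists C; split => //; apply: subset_trans FC.
Qed.

Lemma nneseries_pair (a : nat -> nat -> \bar R) (f : nat -> nat * nat) :
  bijective f -> (forall i j, 0 <= a i j)%E ->
  (\sum_(0 <= k <oo) a (f k).1 (f k).2 =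
   \sum_(0 <= i <oo) \sum_(0 <= j <oo) a i j)%E.
Proof.
move=> bf a0.
rewrite nneseries_esumT//.
rewrite nneseries_esumT; last by move=> i; apply: nneseries_ge0 => j _ _; exact: a0.
have -> : (fun i => \sum_(0 <= j <oo) a i j)%E =
    (fun i => \esum_(j in [set: nat]) a i j)%E.
  by apply/funext => i; rewrite nneseries_esumT.
rewrite esum_esum//.
rewrite (_ : _ `*`` _ = setT); last by apply/seteqP; split.
rewrite (reindex_esum setT setT f)//=.
by split=> // [k l _ _|p _]; [exact: (bij_inj bf)|case: bf => g gK fK; exists (g p)].
Qed.

(** Choose for [A n] a cover that is optimal up to [e / 2^(n+1)] and enumerate all these covers as a
    single sequence by a bijection between [nat] and [nat * nat]. *)
Lemma cover_inf_subadditive : sigma_subadditive cover_inf.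
Proof.
move=> A; have [[i ioo]|] := pselect (exists i, cover_inf (A i) = +oo%E).
  rewrite (eseries_pinfty _ _ ioo) ?leey// => n _.
  by rewrite -ltNye (lt_le_trans _ (cover_inf_ge0 _)).
rewrite -forallNE => Aoo.
apply/lee_addgt0Pr => e e0.
rewrite (le_trans _ (epsilon_trick _ _ (ltW e0)))//; last first.
  by move=> n; exact: cover_inf_ge0.
have /choice[G PG] n : exists C : nat -> I, [/\ A n `<=` \bigcup_j s (C j),
    forall j, P (C j) & (\sum_(0 <= j <oo) (c (C j))%:E <=
      cover_inf (A n) + (e / (2 ^ n.+1)%:R)%:E)%E].
  have en : (0 < e / (2 ^ n.+1)%:R)%R by rewrite divr_gt0// ltr0n expn_gt0.
  have fn : cover_inf (A n) \is a fin_num.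
    by rewrite ge0_fin_numE ?cover_inf_ge0// ltey; exact/eqP/Aoo.
  have [_ [C [AC [PC ->]]] le] := lb_ereal_inf_adherent en fn.
  by exists C; split => //; exact: ltW.
have /card_esym/ppcard_eqP[f] := card_nat2.
have bf : bijective f.
  exists (f^-1%FUN) => x; first by rewrite funK ?inE.
  by rewrite invK ?inE.
apply: (@le_trans _ _ (\sum_(0 <= k <oo) (c (G (f k).1 (f k).2))%:E)%E).
  apply: ereal_inf_lbound; exists (fun k => G (f k).1 (f k).2); split; last first.
    by split => // j; case: (PG (f j).1).
  move=> x [n _ Anx]; have [/(_ _ Anx)[j _ sx] _ _] := PG n.
  by case: bf => g gK fK; exists (g (n, j)) => //; rewrite fK.
have G0 i j : (0 <= (c (G i j))%:E)%E by rewrite lee_fin.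
rewrite (nneseries_pair bf G0).
apply: lee_nneseries => [i _ _|i _]; first by apply: nneseries_ge0 => *; rewrite lee_fin.
by case: (PG i).
Qed.
End cover_outer.

Section outer_instances.
Variable R : realType.

Lemma dotvv_ge0 n (x : 'rV[R]_n) : 0 <= dotv x x.
Proof. by apply: sumr_ge0 => i _; rewrite -expr2 sqr_ge0. Qed.

Lemma eucl_ge0 n (x : 'rV[R]_n) : 0 <= eucl x.
Proof. exact: sqrtr_ge0. Qed.

Lemma ovol_ge0 k (c : option ('rV[R]_k * 'rV[R]_k)) : 0 <= ovol c.
Proof. by case: c => //= ab; apply: prodr_ge0 => i _; rewrite le_max lexx orbT. Qed.

Lemma leb_outerE k : @leb_outer R k = cover_inf (fun=> True) (@obox R k) (@ovol R k).
Proof.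
apply/funext => E; congr ereal_inf; apply/seteqP; split=> t [C].
  by move=> [EC ->]; exists C.
by move=> [EC [_ ->]]; exists C.
Qed.

Lemma leb_outer0 k : @leb_outer R k set0 = 0%E.
Proof. by rewrite leb_outerE (@cover_inf0 _ _ _ _ _ _ None)//; exact: ovol_ge0. Qed.
Lemma leb_outer_ge0 k E : (0 <= @leb_outer R k E)%E.
Proof. by rewrite leb_outerE cover_inf_ge0//; exact: ovol_ge0. Qed.
Lemma le_leb_outer k : {homo @leb_outer R k : E F / E `<=` F >-> (E <= F)%E}.
Proof. by rewrite leb_outerE => E F; exact: le_cover_inf. Qed.
Lemma leb_outer_subadditive k : sigma_subadditive (@leb_outer R k).
Proof. by rewrite leb_outerE; apply: cover_inf_subadditive; exact: ovol_ge0. Qed.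

HB.instance Definition _ k := isOuterMeasure.Build R _ (@leb_outer R k)
  (@leb_outer0 k) (@leb_outer_ge0 k) (@le_leb_outer k) (@leb_outer_subadditive k).

Lemma omega_ge0 s : 0 <= omega R s.
Proof. by rewrite /omega fine_ge0// leb_outer_ge0. Qed.

Lemma diam_set0 n : diam (@set0 'rV[R]_n) = 0%E.
Proof. by rewrite /diam; case: asboolP. Qed.

Lemma diam_ge0 n (C : set 'rV[R]_n) : (0 <= diam C)%E.
Proof.
rewrite /diam; case: asboolP => // /eqP/set0P[x Cx].
apply: (@le_trans _ _ (eucl (x - x))%:E); first by rewrite lee_fin eucl_ge0.
by apply: ereal_sup_ubound; exists x => //; exists x.
Qed.

Lemma haus_term_ge0 n s (C : set 'rV[R]_n) : 0 <= haus_term s C.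
Proof.
rewrite /haus_term; case: asboolP => // _.
by rewrite mulr_ge0 ?omega_ge0// exprn_ge0// divr_ge0// fine_ge0// diam_ge0.
Qed.

Lemma haus_term0 n s : haus_term s (@set0 'rV[R]_n) = 0.
Proof. by rewrite /haus_term; case: asboolP. Qed.

Lemma haus_deltaE n s d : @haus_delta R n s d =
  cover_inf (fun C => (diam C <= d%:E)%E) id (@haus_term R n s).
Proof. by []. Qed.

Lemma haus_delta_ge0 n s d E : (0 <= @haus_delta R n s d E)%E.
Proof. by rewrite haus_deltaE cover_inf_ge0//; exact: haus_term_ge0. Qed.

Lemma haus_delta_le n s d (E : set 'rV[R]_n) : 0 < d ->
  (haus_delta s d E <= hausdorff s E)%E.
Proof. by move=> d0; apply: ereal_sup_ubound; exists d => //=; rewrite in_itv/= d0. Qed.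

Lemma hausdorff_le n s (E : set 'rV[R]_n) t :
  (forall d, 0 < d -> (haus_delta s d E <= t)%E) -> (hausdorff s E <= t)%E.
Proof.
by move=> h; apply: ge_ereal_sup => _ [d /= + <-]; rewrite in_itv/= andbT => /h.
Qed.

Lemma hausdorff0 n s : @hausdorff R n s set0 = 0%E.
Proof.
apply/eqP; rewrite eq_le; apply/andP; split.
  apply: hausdorff_le => d d0; rewrite haus_deltaE (@cover_inf0 _ _ _ _ _ _ set0)//.
  - exact: haus_term_ge0.
  - by rewrite diam_set0 lee_fin ltW.
  - exact: haus_term0.
exact: le_trans (haus_delta_ge0 s 1 _) (haus_delta_le _ _ (@ltr01 R)).
Qed.

Lemma hausdorff_ge0 n s E : (0 <= @hausdorff R n s E)%E.
Proof. exact: le_trans (haus_delta_ge0 s 1 _) (haus_delta_le _ _ (@ltr01 R)). Qed.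

Lemma le_hausdorff n s : {homo @hausdorff R n s : E F / E `<=` F >-> (E <= F)%E}.
Proof.
move=> E F EF; apply: hausdorff_le => d d0.
by apply: le_trans (haus_delta_le s F d0); rewrite !haus_deltaE; exact: le_cover_inf.
Qed.

Lemma hausdorff_subadditive n s : sigma_subadditive (@hausdorff R n s).
Proof.
move=> F; apply: hausdorff_le => d d0.
have /le_trans := @cover_inf_subadditive _ _ _ (fun C => (diam C <= d%:E)%E) id _
  (@haus_term_ge0 n s) F.
apply.
apply: lee_nneseries => [i _ _|i _]; first exact: haus_delta_ge0.
exact: haus_delta_le.
Qed.

HB.instance Definition _ n s := isOuterMeasure.Build R _ (@hausdorff R n s)
  (@hausdorff0 n s) (@hausdorff_ge0 n s) (@le_hausdorff n s)
  (@hausdorff_subadditive n s).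
End outer_instances.

(** * Half-spaces are measurable *)

Section leb_halfspace.
Variable R : realType.

Lemma clip_width (a b t : R) :
  Num.max (Num.min b t - a) 0 + Num.max (b - Num.max a t) 0 <= Num.max (b - a) 0.
Proof.
rewrite /Num.max /Num.min.
by case: (ltP b t) => ?; case: (ltP a t) => ?; repeat case: ltP => ?; lra.
Qed.

(** The two pieces are closed boxes that may share a face in the plane [x 0 i = t]. Only the factor
    [i] of the volume changes, and [clip_width] bounds the sum of its two values. *)
Lemma obox_split k (c : option ('rV[R]_k * 'rV[R]_k)) (i : 'I_k) (t : R) :
  exists c1 c2, [/\ obox c `&` [set x | x 0 i <= t] `<=` obox c1,
    obox c `&` ~` [set x | x 0 i <= t] `<=` obox c2 & ovol c1 + ovol c2 <= ovol c].
Proof.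
case: c => [[a b]|]; last by exists None, None; split => [x []|x []|] //=; rewrite addr0.
pose b' := \row_j (if j == i then Num.min (b 0 i) t else b 0 j).
pose a' := \row_j (if j == i then Num.max (a 0 i) t else a 0 j).
exists (Some (a, b')), (Some (a', b)); split => /=.
- move=> x [/= ab xt] j; rewrite mxE; case: eqVneq => [->|_]; last exact: ab.
  by have /andP[-> xb] := ab i; rewrite le_min xb xt.
- move=> x [/= ab /negP]; rewrite -ltNge => xt j.
  rewrite mxE; case: eqVneq => [->|_]; last exact: ab.
  by have /andP[xa ->] := ab i; rewrite ge_max xa ltW.
- rewrite (bigD1 i)//= [X in _ + X](bigD1 i)//= [leRHS](bigD1 i)//= !mxE eqxx.
  under eq_bigr => j ji do rewrite mxE (negbTE ji).
  under [X in _ + _ * X <= _]eq_bigr => j ji do rewrite mxE (negbTE ji).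
  rewrite -mulrDl ler_wpM2r ?clip_width//.
  by apply: prodr_ge0 => j _; rewrite le_max lexx orbT.
Qed.

Lemma leb_outer_halfspace k (i : 'I_k) (t : R) :
  (@leb_outer R k).-caratheodory [set x | x 0 i <= t].
Proof.
apply: le_caratheodory_measurable => X.
apply: le_ereal_inf_tmp => _ [C [XC ->]].
have /choice[f Hf] j := obox_split (C j) i t.
have /choice[g Hg] j := Hf j.
have v0 c : (0 <= (@ovol R k c)%:E)%E by rewrite lee_fin ovol_ge0.
apply: (@le_trans _ _ (\sum_(0 <= j <oo) (ovol (f j))%:E +
    \sum_(0 <= j <oo) (ovol (g j))%:E)%E).
  apply: leeD; apply: ereal_inf_lbound.
    exists f; split => // x [/XC[j _ Cx] xt]; exists j => //.
    by have [h _ _] := Hg j; exact: h.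
  exists g; split => // x [/XC[j _ Cx] xt]; exists j => //.
  by have [_ h _] := Hg j; exact: h.
rewrite -nneseriesD//; apply: lee_nneseries => [j _ _|j _]; first exact: adde_ge0.
by rewrite -EFinD lee_fin; have [] := Hg j.
Qed.

Lemma leb_outer_translate_le k (E : set 'rV[R]_k) (v : 'rV[R]_k) :
  (leb_outer ((fun x => x + v)%R @^-1` E) <= leb_outer E)%E.
Proof.
apply: le_ereal_inf_tmp => _ [C [XC ->]].
apply: ereal_inf_lbound.
exists (fun j => if C j is Some ab then Some (ab.1 - v, ab.2 - v) else None); split.
  move=> x /= /XC[j _ H]; exists j => //; move: H; case: (C j) => //= ab xab l.
  by have := xab l; rewrite !mxE; lra.
congr (limn _); apply/funext => m; apply: eq_bigr => j _; congr EFin.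
case: (C j) => //= ab; apply: eq_bigr => l _.
by rewrite !mxE; congr Num.max; lra.
Qed.

Lemma leb_outer_translate k (E : set 'rV[R]_k) (v : 'rV[R]_k) :
  leb_outer ((fun x => x + v)%R @^-1` E) = leb_outer E.
Proof.
apply/eqP; rewrite eq_le leb_outer_translate_le/=.
have := leb_outer_translate_le ((fun x => x + v)%R @^-1` E) (- v).
rewrite (_ : _ @^-1` (_ @^-1` E) = E)//.
by apply/seteqP; split => x /=; rewrite subrK.
Qed.

Lemma leb_outer_box_lty k (a b : 'rV[R]_k) : (leb_outer (box a b) < +oo)%E.
Proof.
apply: (@le_lt_trans _ _ (ovol (Some (a, b)))%:E); last by rewrite ltry.
apply: ereal_inf_lbound.
exists (fun j : nat => if j is 0%N return option ('rV[R]_k * 'rV[R]_k) then Some (a, b) else None); split.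
  by move=> x xab; exists 0%N.
rewrite nneseries_recl//; last by move=> j; rewrite lee_fin ovol_ge0.
rewrite eseries_cond/= eseries0 ?adde0// => -[|j]//=.
Qed.
End leb_halfspace.

Lemma sum_parity {R : realType} (f : nat -> \bar R) m :
  (\sum_(k < 2 * m) f k = \sum_(k < m) f (2 * k + 0)%N + \sum_(k < m) f (2 * k + 1)%N)%E.
Proof.
elim: m => [|m ih]; first by rewrite !big_ord0 adde0.
rewrite [RHS](_ : _ = (\sum_(k < m) f (2 * k + 0)%N + f (2 * m)%N) +
   (\sum_(k < m) f (2 * k + 1)%N + f (2 * m).+1))%E; last first.
  by rewrite !big_ord_recr/= addn0 addn1.
by rewrite addeACA -ih addeA mulnS !big_ord_recr.
Qed.

Section metric_outer.
Context {R : realType} {T : Type} (mu : {outer_measure set T -> \bar R}) (p : T -> R).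
Hypothesis mu_sep : forall (E F : set T) (e : R), 0 < e ->
  (forall x y, E x -> F y -> e <= `|p x - p y|) ->
  (mu E + mu F <= mu (E `|` F))%E.

(* Caratheodory's argument: the layers [D k] of equal parity are at positive
   distance from each other, so their measures are summable and the part of [X]
   lying close to the half-space is negligible. *)
Lemma metric_caratheodory (a : R) : mu.-caratheodory [set x | p x <= a].
Proof.
apply: le_caratheodory_measurable => X.
have [->|Xoo] := eqVneq (mu X) +oo%E; first by rewrite leey.
pose t k : R := a + k.+1%:R^-1.
have tS k : t k.+1 < t k by rewrite ltrD2l ltf_pV2 ?posrE ?ltr0n// ltr_nat.
have tle k l : (k <= l)%N -> t l <= t k.
  by move=> kl; rewrite lerD2l lef_pV2 ?posrE ?ltr0n// ler_nat ltnS.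
have at_ k : a < t k by rewrite ltrDl invr_gt0 ltr0n.
have tex z : a < z -> exists l, t l < z by exact: ltr_add_invr.
clearbody t.
pose Q k := X `&` [set x | t k < p x].
pose D k := Q k.+1 `\` Q k.
have muX_ge A : A `<=` X -> (mu A <= mu X)%E by move=> AX; exact: le_outer_measure.
have layers b m : (\sum_(k < m) mu (D (2 * k + b).+1) <= mu (Q (2 * m + b)%N))%E.
  elim: m => [|m ih]; first by rewrite big_ord0 outer_measure_ge0.
  rewrite big_ord_recr/=; apply: (le_trans (leeD ih (lexx _))).
  have -> : (2 * m.+1 + b = (2 * m + b).+2)%N by rewrite mulnS.
  move: (2 * m + b)%N => q.
  (* The skipped layer [D q] separates [Q q] from [D q.+1]. *)
  apply: le_trans.
    apply: (mu_sep (e := t q - t q.+1)); first by rewrite subr_gt0.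
    move=> x y [_ /= tx] [[Xy /= _]] Qy.
    have {}Qy : p y <= t q.+1 by rewrite leNgt; apply/negP => h; apply: Qy.
    have tyx : p y <= p x by rewrite (le_trans Qy)// (le_trans (ltW (tS q)))// ltW.
    by rewrite ger0_norm ?subr_ge0// lerB// ltW.
  apply: le_outer_measure => x [[Xx /= tx]|[[Xx /= tx] _]]; split => //=.
    by apply: le_lt_trans tx; apply: tle; rewrite -addn2 leq_addr.
have Doo : (\sum_(0 <= k <oo) mu (D k.+1) <= mu X + mu X)%E.
  apply: lime_le; first by apply: is_cvg_nneseries => *; exact: outer_measure_ge0.
  apply: nearW => m.
  apply: (@le_trans _ _ (\sum_(0 <= k < 2 * m) mu (D k.+1))%E).
    rewrite [leRHS](@big_cat_nat _ _ _ m)//=; last by rewrite leq_pmull.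
    by rewrite leeDl// sume_ge0// => *; exact: outer_measure_ge0.
  apply: (@le_trans _ _ (\sum_(k < m) mu (D (2 * k + 0).+1) +
      \sum_(k < m) mu (D (2 * k + 1).+1))%E).
    by rewrite big_mkord (sum_parity (fun k => mu (D k.+1))).
  by apply: leeD; apply: le_trans (layers _ _) _; apply: muX_ge => x [].
have Q_tail m : (mu (X `&` ~` [set x | (p x <= a)%R]) <=
    mu (Q m.+1) + \sum_(m <= k <oo) mu (D k.+1))%E.
  apply: (@le_trans _ _ (mu (Q m.+1 `|` \bigcup_(k in ~` `I_m) D k.+1))).
    apply: le_outer_measure => x [Xx /= /negP]; rewrite -ltNge => ax.
    have [tm|mt] := ltP (t m.+1) (p x); first by left.
    right.
    (* The least [l] with [t l < p x] tells which layer contains [x]. The values [0] and [1] are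
       excluded by [p x <= t m.+1], and [l = l'.+2] puts [x] in [D l'.+1]. *)
    case: (ex_minnP (tex _ ax)) => -[|l'] tl' lmin.
      have := tle 0%N m.+1 isT; move: mt tl'; lra.
    case: l' tl' lmin => [|l'] tl' lmin.
      have := tle 1%N m.+1 isT; move: mt tl'; lra.
    exists l'.
      rewrite /= ltnNge; apply/negP/negPn; rewrite leqNgt; apply/negP => lm.
      have := tle l'.+2 m.+1 lm; move: mt tl'; lra.
    split; first by split.
    by move=> [_ /= h]; have := lmin _ h; rewrite ltnn.
  apply: (le_trans (outer_measureU2 mu _ _)); apply: leeD => //.
  exact: (outer_measure_sigma_subadditive_tail mu m (fun k => D k.+1)).
have splitX m : (mu (X `&` [set x | (p x <= a)%R]) + mu (Q m) <= mu X)%E.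
  apply: (@le_trans _ _ (mu ((X `&` [set x | p x <= a]) `|` Q m))).
    apply: (mu_sep (e := t m - a)); first by rewrite subr_gt0.
    move=> x y [_ /= xa] [_ /= ty].
    have yx : p x <= p y by rewrite (le_trans xa)// (le_trans (ltW (at_ m)))// ltW.
    by rewrite distrC ger0_norm ?subr_ge0// lerB// ltW.
  by apply: muX_ge => x [[]|[]].
have Dlty : (\sum_(0 <= k <oo) mu (D k.+1) < +oo)%E.
  by apply: (le_lt_trans Doo); rewrite lte_add_pinfty// ltey.
have tail0 := nneseries_tail_cvg Dlty (fun k _ => outer_measure_ge0 mu (D k.+1)).
have muXfin : mu X \is a fin_num by rewrite ge0_fin_numE ?outer_measure_ge0// ltey.
apply/lee_addgt0Pr => e e0.
have [m mte] : exists m, (\sum_(m <= k <oo) mu (D k.+1) <= e%:E)%E.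
  have /fine_cvgP[fin /cvgrPdist_le/(_ e e0)] := tail0.
  move=> /(filterI fin)[m _ /(_ m (leqnn m))[/= fm]].
  by rewrite sub0r normrN => h; exists m; rewrite -(fineK fm) lee_fin; exact: le_trans (ler_norm _) h.
apply: (le_trans (leeD (lexx _) (Q_tail m))).
by rewrite addeA leeD.
Qed.
End metric_outer.

Section hausdorff_halfspace.
Variable R : realType.

Lemma ler_coord_eucl n (x : 'rV[R]_n) i : `|x 0 i| <= eucl x.
Proof.
rewrite /eucl -sqrtr_sqr ler_wsqrtr// /dotv (bigD1 i)//= expr2 lerDl.
by apply: sumr_ge0 => j _; rewrite -expr2 sqr_ge0.
Qed.

Lemma eucl_le_diam n (C : set 'rV[R]_n) x y :
  C x -> C y -> ((eucl (x - y))%:E <= diam C)%E.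
Proof.
move=> Cx Cy; rewrite /diam; case: asboolP => [C0|_]; first by move: Cx; rewrite C0.
by apply: ereal_sup_ubound; exists x => //; exists y.
Qed.

(** A set of diameter below [e] cannot meet both [E] and [F], so a sufficiently fine cover of the
    union splits into a cover of each. The scales [d1] and [d2] are independent so that the two
    suprema can be taken separately. *)
Lemma haus_delta_sep n s (E F : set 'rV[R]_n) (d1 d2 e : R) :
  0 < d1 -> 0 < d2 -> 0 < e ->
  (forall x y, E x -> F y -> e <= eucl (x - y)) ->
  (haus_delta s d1 E + haus_delta s d2 F <= hausdorff s (E `|` F))%E.
Proof.
move=> d10 d20 e0 EF.
pose d := Num.min (Num.min d1 d2) (e / 2).
have d0 : 0 < d by rewrite !lt_min d10 d20/= divr_gt0.
have dd1 : d <= d1 by rewrite !ge_min lexx.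
have dd2 : d <= d2 by rewrite !ge_min lexx orbT.
have de : d < e by rewrite gt_min; apply/orP; right; lra.
apply: le_trans (haus_delta_le _ _ d0).
apply: le_ereal_inf_tmp => _ [C [EFC [dC ->]]].
pose sel (G : set 'rV[R]_n) j := if `[< C j `&` G !=set0 >] then C j else set0.
have t0 G j : (0 <= (haus_term s (sel G j))%:E)%E by rewrite lee_fin haus_term_ge0.
have selc G j e' : d <= e' -> (diam (sel G j) <= e'%:E)%E.
  move=> de'; rewrite /sel; case: asboolP => _.
    by apply: le_trans (dC j) _; rewrite lee_fin.
  by rewrite diam_set0 lee_fin (le_trans (ltW d0)).
have cov G : G `<=` E `|` F -> G `<=` \bigcup_j sel G j.
  move=> GEF x Gx; have [j _ Cx] := EFC _ (GEF _ Gx); exists j => //.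
  by rewrite /sel; case: asboolP => // h; apply: h; exists x.
apply: (@le_trans _ _ (\sum_(0 <= j <oo) (haus_term s (sel E j))%:E +
    \sum_(0 <= j <oo) (haus_term s (sel F j))%:E)%E).
  apply: leeD; apply: ereal_inf_lbound.
    exists (sel E); split; first by apply: cov => x; left.
    by split => // j; exact: selc.
  exists (sel F); split; first by apply: cov => x; right.
  by split => // j; exact: selc.
rewrite -nneseriesD//; apply: lee_nneseries => [j _ _|j _]; first exact: adde_ge0.
rewrite -EFinD lee_fin /sel.
case: asboolP => [[x [Cx Ex]]|_]; case: asboolP => [[y [Cy Fy]]|_].
- have := le_trans (eucl_le_diam Cx Cy) (dC j).
  by rewrite lee_fin => h; have := EF _ _ Ex Fy; lra.
- by rewrite haus_term0 addr0.
- by rewrite haus_term0 add0r.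
- by rewrite haus_term0 addr0 haus_term_ge0.
Qed.

(** The suprema over the two scales are taken one after the other, moving the other term across by
    subtraction; hence the prior reduction to finite values. *)
Lemma hausdorff_sep n s (E F : set 'rV[R]_n) (e : R) : 0 < e ->
  (forall x y, E x -> F y -> e <= eucl (x - y)) ->
  (hausdorff s E + hausdorff s F <= hausdorff s (E `|` F))%E.
Proof.
move=> e0 EF.
have [->|tfin] := eqVneq (hausdorff s (E `|` F)) +oo%E; first by rewrite leey.
have EFfin : hausdorff s (E `|` F) \is a fin_num.
  by rewrite ge0_fin_numE ?hausdorff_ge0// ltey.
have fin G : G `<=` E `|` F -> hausdorff s G \is a fin_num.
  move=> GEF; rewrite ge0_fin_numE ?hausdorff_ge0//.
  by rewrite (@le_lt_trans _ _ (hausdorff s (E `|` F))) ?ltey//; exact: le_hausdorff.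
have fE : hausdorff s E \is a fin_num by apply: fin => x; left.
have fF : hausdorff s F \is a fin_num by apply: fin => x; right.
rewrite addeC -leeBrDr//; apply: hausdorff_le => d2 d20.
have fd : haus_delta s d2 F \is a fin_num.
  rewrite ge0_fin_numE ?haus_delta_ge0//.
  by rewrite (@le_lt_trans _ _ (hausdorff s F)) -?ge0_fin_numE ?hausdorff_ge0//; exact: haus_delta_le.
rewrite leeBrDr// addeC -leeBrDr//; apply: hausdorff_le => d1 d10.
by rewrite leeBrDr//; exact: haus_delta_sep EF.
Qed.

Lemma hausdorff_halfspace n s (i : 'I_n) (t : R) :
  (@hausdorff R n s).-caratheodory [set x | x 0 i <= t].
Proof.
apply: (@metric_caratheodory _ _ (@hausdorff R n s) (fun x : 'rV[R]_n => x 0 i)).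
move=> E F e e0 EF; apply: (hausdorff_sep _ e0) => x y Ex Fy.
apply: le_trans (EF _ _ Ex Fy) _.
by apply: le_trans (ler_coord_eucl _ i); rewrite !mxE.
Qed.
End hausdorff_halfspace.

(** * Measurability of Borel sets and of continuous functions *)

Section real_rays.
Context {d} {T : measurableType d} {R : realType}.

Lemma measurable_fun_rays (D : set T) (f : T -> R) :
  (forall t, measurable (D `&` [set x | t < f x])) -> measurable_fun D f.
Proof.
move=> h; apply: (measurability _ (measurable_realfun.RGenOInfty.measurableE R)) => //.
move=> _ [_ [t ->] <-]; rewrite (_ : _ @^-1` _ = [set x | t < f x]); first exact: h.
by apply/seteqP; split => x /=; rewrite in_itv/= andbT.
Qed.

Lemma measurable_ray (D : set T) (f : T -> R) t :
  measurable D -> measurable_fun D f -> measurable (D `&` [set x | t < f x]).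
Proof.
move=> mD /(_ mD `]t, +oo[%classic (measurable_itv _)).
rewrite (_ : _ @^-1` _ = [set x | t < f x])//.
by apply/seteqP; split => x /=; rewrite in_itv/= andbT.
Qed.
End real_rays.

Definition open_box {R : realType} {n} (a b : 'rV[R]_n) : set 'rV[R]_n :=
  [set x | forall i, a 0 i < x 0 i < b 0 i].

Lemma ball_rV {R : realType} n (x y : 'rV[R]_n) (e : R) : 0 < e ->
  (forall i, `|x 0 i - y 0 i| < e) -> ball x e y.
Proof. by move=> e0 h; split => // i j; rewrite ord1; exact: h. Qed.

(** The boxes are those with rational corners that lie inside [O], enumerated by [unpickle]. Indices
    that decode to no such box yield [set0]. *)
Lemma open_countable_boxes {R : realType} n (O : set 'rV[R]_n) : open O ->
  exists F : nat -> set 'rV[R]_n, O = \bigcup_k F k /\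
    forall k, F k = set0 \/ exists a b, F k = open_box a b.
Proof.
move=> oO.
pose rbox (p : 'rV[rat]_n * 'rV[rat]_n) : set 'rV[R]_n :=
  open_box (map_mx ratr p.1) (map_mx ratr p.2).
exists (fun k => if unpickle k is Some p then
   if `[< rbox p `<=` O >] then rbox p else set0 else set0); split; last first.
  move=> k; case: unpickle => [p|]; last by left.
  by case: asboolP => _; [right; do 2 eexists|left].
apply/seteqP; split => [x Ox|x [k _]]; last first.
  by case: unpickle => //= p; case: asboolP => [h /h|_ []].
have /nbhs_ballP[e /= e0 xeO] := open_nbhs_nbhs (conj oO Ox).
have /choice[p Hp] (i : 'I_n) : exists q : rat, ratr q \in `](x 0 i - e), (x 0 i)[.
  by apply: rat_in_itvoo; lra.
have /choice[q Hq] (i : 'I_n) : exists q : rat, ratr q \in `](x 0 i), (x 0 i + e)[.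
  by apply: rat_in_itvoo; lra.
exists (pickle (\row_i p i, \row_i q i)) => //; rewrite pickleK.
case: asboolP => [_|h].
  by move=> i; rewrite !mxE; have := Hp i; have := Hq i; rewrite !in_itv/=; lra.
case: h => y /= ypq; apply: xeO; apply: ball_rV => // i.
have := ypq i; rewrite !mxE; have := Hp i; have := Hq i; rewrite !in_itv/=.
by rewrite ltr_norml; lra.
Qed.

Section borel_outer.
Context {R : realType} {n : nat} (mu : {outer_measure set 'rV[R]_n -> \bar R}).
Hypothesis halfspace : forall (i : 'I_n) t, mu.-caratheodory [set x | x 0 i <= t].
Let U := caratheodory_type mu.

Lemma coord_measurable (i : 'I_n) : measurable_fun [set: U] (fun x : U => x 0 i).
Proof.
apply: measurable_fun_rays => t; rewrite setTI.
have <- : ~` [set x : U | x 0 i <= t] = [set x : U | t < x 0 i].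
  by apply/seteqP; split => x /=; rewrite ltNge => /negP.
by apply: measurableC; exact: halfspace.
Qed.

Lemma open_box_measurable (a b : 'rV[R]_n) : measurable (open_box a b : set U).
Proof.
rewrite (_ : open_box a b = \bigcap_(i in [set: 'I_n])
    (((fun x : U => x 0 i) @^-1` `]a 0 i, b 0 i[))); last first.
  apply/seteqP; split => [x xab i _ /=|x xab i]; first by rewrite in_itv/= xab.
  by have := xab i I; rewrite /= in_itv.
apply: fin_bigcap_measurable; first exact: finite_finset.
move=> i _; rewrite -[X in measurable X]setTI; apply: coord_measurable => //.
Qed.

Lemma open_cara_measurable (O : set 'rV[R]_n) : open O -> measurable (O : set U).
Proof.
move=> /open_countable_boxes[F [-> HF]].
apply: (@bigcupT_measurable _ U) => k.
by case: (HF k) => [->|[a [b ->]]]; [exact: measurable0|exact: open_box_measurable].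
Qed.

Lemma closed_cara_measurable (C : set 'rV[R]_n) : closed C -> measurable (C : set U).
Proof.
move=> cC; rewrite -(setCK C); apply: (@measurableC _ U).
by apply: open_cara_measurable; exact: closed_openC.
Qed.

Lemma continuous_cara_measurable (f : 'rV[R]_n -> R) (D : set U) : measurable D ->
  continuous f -> measurable_fun D (f : U -> R).
Proof.
move=> mD cf; apply: measurable_funTS; apply: measurable_fun_rays => t; rewrite setTI.
apply: open_cara_measurable.
rewrite (_ : [set _ | _] = f @^-1` [set y | t < y])//.
by apply: open_comp => [x _|]; [exact: cf|exact: open_gt].
Qed.
End borel_outer.

(** * The layer-cake formula *)

Section layer_cake.
Context {d} {T : measurableType d} {R : realType}.
Local Notation leb := (@lebesgue_measure R).
Local Open Scope ereal_scope.

(** Superlevel sets of a monotone function are intervals. *)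
Lemma nonincreasing_emeasurable (phi : measurableTypeR R -> \bar R)
    (D : set (measurableTypeR R)) : measurable D ->
  {homo (phi : R -> \bar R) : s t / (s <= t)%R >-> t <= s} -> measurable_fun D phi.
Proof.
move=> mD phi_dec; apply: measurable_funTS.
apply: (measurability _ (measurable_realfun.ErealGenOInfty.measurableE R)) => //.
move=> _ [_ [x ->] <-]; rewrite setTI; apply: is_interval_measurable.
move=> s t /= + + u /andP[su ut]; rewrite !in_itv/= !andbT => _.
by move/lt_le_trans; apply; exact: phi_dec.
Qed.

(** Both sides are iterated integrals of the indicator of [B], the region strictly between [0] and
    the graph of [g]: integrating in [t] first gives [g x], integrating in [x] first gives the
    measure of a superlevel set. *)
Lemma finite_layer_cake (nu : {finite_measure set T -> \bar R}) (g : T -> R) :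
  measurable_fun setT g -> (forall x, (0 <= g x)%R) ->
  \int[nu]_x (g x)%:E = \int[leb]_(t in [set t : R | (0 < t)%R]) nu [set x | (t < g x)%R].
Proof.
move=> mg g0.
pose B : set (T * R) := [set p | (0 < p.2)%R /\ (p.2 < g p.1)%R].
have mB : measurable (B : set (T * measurableTypeR R)).
  have m2 : measurable_fun setT (fun p : T * measurableTypeR R => p.2 : R).
    exact: measurable_snd.
  have mg1 : measurable_fun setT (fun p : T * measurableTypeR R => g p.1).
    by apply: measurableT_comp => //; exact: measurable_fst.
  rewrite (_ : B = [set p | (0 < p.2)%R] `&` [set p | (p.2 < g p.1)%R])//.
  apply: measurableI.
    by rewrite -[X in measurable X]setTI; exact: (measurable_ray _ measurableT m2).
  have := measurable_ray 0%R measurableT (measurable_funB mg1 m2).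
  rewrite setTI (_ : [set _ | _] = [set p | (p.2 < g p.1)%R])//.
  by apply/seteqP; split => p /=; rewrite subr_gt0.
transitivity (\int[nu]_x \int[leb]_t (\1_B (x, t))%:E).
  apply: eq_integral => x _.
  rewrite (_ : (fun t => _) = (fun t => (\1_(`]0%R, g x[%classic) t)%:E)); last first.
    apply/funext => t; rewrite !indicE; congr ((_ : bool)%:R%:E).
    apply/idP/idP; rewrite !inE /B/= in_itv/= ; first by move=> [-> ->].
    by move=> /andP[].
  rewrite integral_indic// setIT [RHS](lebesgue_measure_itv `]0%R, g x[)/= lte_fin sube0.
  by case: ltP => // gx0; congr EFin; apply/eqP; rewrite eq_le gx0 g0.
rewrite (@fubini_tonelli _ _ _ (measurableTypeR R) _ nu leb (fun p => (\1_B p)%:E)).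
- rewrite [RHS]integral_mkcond; apply: eq_integral => t _ /=.
  rewrite patchE; case: ifPn => t0.
    rewrite -[X in nu X]setTI setIC -integral_indic//=; last first.
      by rewrite -[X in measurable X]setTI; exact: measurable_ray.
    apply: eq_integral => x _; rewrite !indicE; congr ((_ : bool)%:R%:E).
    rewrite inE/= in t0.
    by apply/idP/idP; rewrite !inE /B/=; [move=> []|].
  apply: integral0_eq => x _; rewrite indicE memNset// => -[/= t0' _].
  by rewrite notin_setE/= in t0.
- by apply/measurable_EFinP; exact: measurable_indic.
- by move=> p; rewrite lee_fin indicE.
Qed.

(* Fubini-Tonelli needs a finite measure, so [mu] is restricted to the sets
   [{f > 1 / (m + 1)}]; if one of them has infinite measure, both sides are [+oo]. *)
Lemma layer_cake (mu : {measure set T -> \bar R}) (D : set T) (f : T -> R) :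
  measurable D -> measurable_fun D f -> (forall x, D x -> (0 <= f x)%R) ->
  \int[mu]_(x in D) (f x)%:E =
  \int[leb]_(t in [set t : R | (0 < t)%R]) mu (D `&` [set x | (t%:E < (f x)%:E)]).
Proof.
move=> mD mf f0.
under [RHS]eq_integral do under eq_set do rewrite lte_fin.
have mray t : measurable (D `&` [set x | (t < f x)%R]) by exact: measurable_ray.
have mpos : measurable [set t : R | (0 < t)%R].
  by rewrite (_ : [set _ | _] = `]0%R, +oo[%classic)//; apply/seteqP; split => x /=;
    rewrite in_itv/= andbT.
pose phi t := mu (D `&` [set x | (t < f x)%R]).
have phi_dec : {homo phi : s t / (s <= t)%R >-> t <= s}.
  move=> s t st; apply: le_measure; rewrite ?inE//.
  by move=> x [Dx /= tf]; split => //=; exact: le_lt_trans tf.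
pose E m := D `&` [set x | (m.+1%:R^-1 < f x)%R].
have mE m : measurable (E m) by exact: mray.
have ED m : E m `<=` D by move=> x [].
have [[m moo]|fin] := pselect (exists m, mu (E m) = +oo).
  transitivity (+oo : \bar R).
    apply/eqP; rewrite -leye_eq.
    apply: (@le_trans _ _ (\int[mu]_(x in E m) (f x)%:E)); last first.
      by apply: ge0_subset_integral => //; exact/measurable_EFinP.
    apply: (@le_trans _ _ (\int[mu]_(x in E m) (cst (m.+1%:R^-1)%:E x))).
      by rewrite integral_cst// moo gt0_muley// lte_fin invr_gt0 ltr0n.
    apply: ge0_le_integral => //.
    - by move=> x _; rewrite lee_fin invr_ge0 ler0n.
    - by apply/measurable_EFinP; exact: (measurable_funS mD (@ED m) mf).
    - by move=> x [_ /= /ltW]; rewrite lee_fin.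
  apply/esym/eqP; rewrite -leye_eq.
  pose c : R := (m.+1%:R^-1)%R.
  have c0 : (0 < c)%R by rewrite invr_gt0 ltr0n.
  apply: (@le_trans _ _ (\int[leb]_(t in `]0%R, c[%classic) phi t)); last first.
    apply: ge0_subset_integral => //; last by move=> t /=; rewrite in_itv/= => /andP[].
    exact: nonincreasing_emeasurable.
  apply: (@le_trans _ _ (\int[leb]_(t in `]0%R, c[%classic) cst +oo t)).
    rewrite integral_cst//= lebesgue_measure_itv/= lte_fin c0 sube0.
    by rewrite gt0_mulye// lte_fin.
  apply: ge0_le_integral => //.
    by move=> *; exact: leey.
    by apply: nonincreasing_emeasurable.
  move=> t /=; rewrite in_itv/= => /andP[_ tc].
  by rewrite -moo; apply: le_measure; rewrite ?inE// => x [Dx /= h]; split => //=; exact: lt_trans h.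
have Efin m : mu (E m) < +oo by rewrite ltey; apply/eqP => h; apply: fin; exists m.
have ndE : nondecreasing_seq E.
  move=> k l kl; apply/subsetPset => x [Dx /= kx]; split => //=.
  by apply: le_lt_trans kx; rewrite lef_pV2 ?posrE ?ltr0n// ler_nat ltnS.
have UE : \bigcup_m E m = D `&` [set x | (0 < f x)%R].
  apply/seteqP; split => [x [m _ [Dx /= h]]|x [Dx /= /ltr_add_invr[m]]].
    by split => //=; apply: lt_trans h; rewrite invr_gt0 ltr0n.
  by rewrite add0r => h; exists m.
have stage m : \int[mu]_(x in E m) (f x)%:E =
    \int[leb]_(t in [set t : R | (0 < t)%R]) mu (E m `&` [set x | (t < f x)%R]).
  have <- : \int[mfrestr (mE m) (Efin m)]_(x in E m) (f x)%:E = \int[mu]_(x in E m) (f x)%:E.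
    by apply: eq_measure_integral => A mA AE; exact: (congr1 mu (setIidl AE)).
  rewrite integral_mkcond.
  transitivity (\int[mfrestr (mE m) (Efin m)]_x ((f \_ (E m)) x)%:E).
    by apply: eq_integral => x _; rewrite !patchE; case: ifP.
  rewrite finite_layer_cake; last 2 first.
  - by apply/(measurable_restrictT f (mE m)); exact: (measurable_funS mD (@ED m) mf).
  - by move=> x; rewrite patchE; case: ifPn => //; rewrite inE => -[/f0].
  apply: eq_integral => t; rewrite inE/= => t0.
  transitivity (mu ([set x | (t < (f \_ (E m)) x)%R] `&` E m)) => //.
  congr (mu _); apply/seteqP; split => x [].
    by rewrite /= patchE => + Ex; rewrite mem_set.
  by move=> Ex /= tf; split => //=; rewrite patchE mem_set.
(* The sets [E m] exhaust the part of [D] where [f > 0]; points where [f] vanishes contribute to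
   neither side. *)
have L1 : \int[mu]_(x in E m) (f x)%:E @[m --> \oo] --> \int[mu]_(x in D) (f x)%:E.
  have -> : \int[mu]_(x in D) (f x)%:E = \int[mu]_(x in \bigcup_m E m) (f x)%:E.
    rewrite UE [LHS]integral_mkcond [RHS]integral_mkcond; apply: eq_integral => x _.
    rewrite !patchE; case: (asboolP (D x)) => Dx; last first.
      by rewrite !memNset// => -[].
    rewrite mem_set//; case: (ltP 0%R (f x)) => fx; first by rewrite mem_set.
    rewrite memNset; last by move=> [_ /=]; rewrite ltNge fx.
    by congr EFin; apply/eqP; rewrite eq_le fx f0.
  apply: ge0_nondecreasing_set_cvg_integral => //.
  - move=> m; apply/measurable_EFinP; exact: (measurable_funS mD (@ED m) mf).
  - by move=> m x [/f0]; rewrite lee_fin.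
have L2 : \int[leb]_(t in [set t : R | (0 < t)%R]) mu (E m `&` [set x | (t < f x)%R])
   @[m --> \oo] --> \int[leb]_(t in [set t : R | (0 < t)%R]) phi t.
  have mEt m t : measurable (E m `&` [set x | (t < f x)%R]).
    by rewrite (_ : _ `&` _ = E m `&` (D `&` [set x | (t < f x)%R]));
      [exact: measurableI|rewrite setIA; congr (_ `&` _); apply/esym/setIidl].
  have lim (t : R) : (0 < t)%R -> mu (E m `&` [set x | (t < f x)%R]) @[m --> \oo] --> phi t.
    move=> t0.
    have -> : phi t = mu (\bigcup_m (E m `&` [set x | (t < f x)%R])).
      rewrite /phi -setI_bigcupl UE; congr (mu _); apply/seteqP; split => x [].
        by move=> Dx /= tf; split => //; split => //=; exact: lt_trans tf.
      by move=> [Dx _].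
    apply: nondecreasing_cvg_mu => //; first exact: bigcup_measurable.
    by move=> k l kl; apply/subsetPset; apply: setSI; exact/subsetPset/ndE.
  have -> : \int[leb]_(t in [set t : R | (0 < t)%R]) phi t =
      \int[leb]_(t in [set t : R | (0 < t)%R])
        limn (fun m => mu (E m `&` [set x | (t < f x)%R])).
    by apply: eq_integral => t; rewrite inE/= => t0; apply/esym/cvg_lim => //; exact: lim.
  apply: (@cvg_monotone_convergence _ _ _ leb _ mpos
    (fun m t => mu (E m `&` [set x | (t < f x)%R]))).
  - move=> m; apply: nonincreasing_emeasurable => // s t st.
    apply: le_measure; rewrite ?inE// => x [Ex /= h]; split => //=.
    exact: le_lt_trans h.
  - by move=> m t _.
  - move=> t _ k l kl; apply: le_measure; rewrite ?inE//; apply: setSI.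
    exact/subsetPset/ndE.
have <- := cvg_lim (@ereal_hausdorff R) L1.
by apply: cvg_lim => //; under eq_fun do rewrite stage; exact: L2.
Qed.
End layer_cake.

(** * Layer-cake integrals as integrals for Caratheodory measures *)

(** The cast to the type carrying the Caratheodory sigma-algebra lets the outer measure be used as a
    measure in integrals. *)
Definition cmeasure {R : realType} {T : pointedType}
    (mu : {outer_measure set T -> \bar R}) :
    {measure set (caratheodory_type mu) -> \bar R} :=
  (mu : set (caratheodory_type mu) -> \bar R).

Section s_int.
Context {R : realType} {T : pointedType} (mu : {outer_measure set T -> \bar R}).
Let U := caratheodory_type mu.

Lemma lc_intE (S : set U) (f : U -> R) : measurable S -> measurable_fun S f ->
  (forall x, S x -> 0 <= f x) ->
  @lc_int R T mu S (fun x => (f x)%:E) = (\int[cmeasure mu]_(x in S) (f x)%:E)%E.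
Proof. by move=> mS mf f0; rewrite (layer_cake (cmeasure mu) mS mf f0). Qed.

Lemma s_intE (S : set U) (f : U -> R) : measurable S -> measurable_fun S f ->
  @s_int R T mu S f = (\int[cmeasure mu]_(x in S) (f x)%:E)%E.
Proof.
move=> mS mf; rewrite /s_int !lc_intE//.
- rewrite [RHS]integralE; congr (_ - _)%E; apply: eq_integral => x _.
    by rewrite funeposE -EFin_max.
  by rewrite funenegE -EFinN -EFin_max.
- by apply: measurable_maxr => //; exact: measurable_funN.
- by move=> x _; rewrite le_max lexx orbT.
- exact: measurable_maxr.
- by move=> x _; rewrite le_max lexx orbT.
Qed.
End s_int.

(** * Continuously differentiable cut-off functions *)

Section continuity.
Context {R : realType} {W : topologicalType}.
Implicit Types f g : W -> R.

Lemma cont_mul f g : continuous f -> continuous g -> continuous (fun x => f x * g x).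
Proof. by move=> cf cg x; apply: cvgM; [exact: cf|exact: cg]. Qed.

Lemma cont_add f g : continuous f -> continuous g -> continuous (fun x => f x + g x).
Proof. by move=> cf cg x; apply: cvgD; [exact: cf|exact: cg]. Qed.

Lemma cont_inv f : (forall x, f x != 0) -> continuous f -> continuous (fun x => (f x)^-1).
Proof. by move=> f0 cf x; apply: cvgV => //; exact: cf. Qed.

Lemma cont_comp f (h : R -> R) : continuous h -> continuous f -> continuous (fun x => h (f x)).
Proof. by move=> ch cf x; exact: (@continuous_comp _ _ _ f h x (cf x) (ch (f x))). Qed.

Lemma cont_cst (a : R) : continuous (fun _ : W => a).
Proof. by move=> x; exact: cvg_cst. Qed.
End continuity.

Section C1_functions.
Context {R : realType} {n : nat}.
Local Notation V := ('rV[R]_n).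
Implicit Types psi chi : V -> R.

(** Stronger than the partial derivatives asked for in [Cc1]: differentiability makes the derivative
    linear in the direction, which turns ['D_q psi] into a divergence in [divg_scale]. *)
Definition C1 psi :=
  (forall x, differentiable psi x) /\ (forall v, continuous ('D_v psi)).

Lemma C1_continuous psi : C1 psi -> continuous psi.
Proof. by move=> [d _] x; exact: differentiable_continuous. Qed.

Lemma C1_cst (a : R) : C1 (cst a).
Proof.
split=> [x|v]; first exact: differentiable_cst.
rewrite (_ : 'D_v _ = cst 0); last by apply/funext => x; rewrite derive_cst.
by move=> x; exact: cst_continuous.
Qed.

Lemma C1_coord i : C1 (fun x : V => x 0 i).
Proof.
have dc x : differentiable (fun x : V => x 0 i) x by exact: differentiable_coord.
split=> // v.
rewrite (_ : 'D_v _ = cst (v 0 i)); first by move=> x; exact: cst_continuous.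
apply/funext => x; rewrite /derive; apply: cvg_lim => //.
apply: (@cvg_trans _ ((fun=> v 0 i) @ 0^')); last exact: cvg_cst.
apply: near_eq_cvg; near=> h; rewrite /= !mxE addrK -[RHS]/(h^-1 * (h * v 0 i)).
by rewrite mulKf//; near: h; exact: nbhs_dnbhs_neq.
Unshelve. all: by end_near. Qed.

Lemma C1D psi chi : C1 psi -> C1 chi -> C1 (fun x => psi x + chi x).
Proof.
move=> [dp cp] [dc cc]; split=> [x|v]; first exact: differentiableD.
rewrite (_ : 'D_v _ = fun x => 'D_v psi x + 'D_v chi x).
  by move=> x; exact: (continuousD (cp v x) (cc v x)).
by apply/funext => x; rewrite deriveD//; exact: diff_derivable.
Qed.

Lemma C1M psi chi : C1 psi -> C1 chi -> C1 (fun x => psi x * chi x).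
Proof.
move=> /[dup] C1p [dp cp] /[dup] C1c [dc cc]; split=> [x|v]; first exact: differentiableM.
rewrite (_ : 'D_v _ = fun x => psi x * 'D_v chi x + chi x * 'D_v psi x).
  exact: (cont_add (cont_mul (C1_continuous C1p) (cc v))
    (cont_mul (C1_continuous C1c) (cp v))).
by apply/funext => x; rewrite deriveM//; exact: diff_derivable.
Qed.

Lemma C1V psi : (forall x, psi x != 0) -> C1 psi -> C1 (fun x => (psi x)^-1).
Proof.
move=> p0 /[dup] C1p [dp cp]; split=> [x|v]; first exact: differentiableV.
rewrite (_ : 'D_v _ = fun x => -1 * ((psi x)^-1 * ((psi x)^-1 * 'D_v psi x))).
  have cV := cont_inv p0 (C1_continuous C1p).
  exact: (cont_mul (@cont_cst _ _ _) (cont_mul cV (cont_mul cV (cp v)))).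
apply/funext => x; rewrite deriveV//; last exact: diff_derivable.
by rewrite -[LHS]/(_ * _) mulN1r mulNr -exprVn expr2 mulrA.
Qed.

Lemma C1_comp psi (h dh : R -> R) : (forall t : R, is_derive t (1 : R) h (dh t)) ->
  continuous dh -> C1 psi -> C1 (fun x => h (psi x)).
Proof.
move=> hd cdh /[dup] C1p [dp cp].
have dfh t : differentiable h t by apply/derivable1_diffP; case: (hd t).
have dfc x : differentiable (h \o psi) x by exact: differentiable_comp.
split=> // v.
rewrite (_ : 'D_v _ = fun x => 'D_v psi x * dh (psi x)).
  exact: (cont_mul (cp v) (cont_comp cdh (C1_continuous C1p))).
apply/funext => x; rewrite (deriveE _ (dfc x)) diff_comp//= [X in _ = X * _]deriveE//.
rewrite deriv1E; last exact/diff_derivable.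
by rewrite /= derive1E; have [_ ->] := hd (psi x).
Qed.

Lemma C1N psi : C1 psi -> C1 (fun x => - psi x).
Proof.
move=> C; rewrite (_ : (fun x => _) = (fun x => -1 * psi x)).
  exact: (C1M (C1_cst _) C).
by apply/funext => x; rewrite mulN1r.
Qed.

Lemma C1B psi chi : C1 psi -> C1 chi -> C1 (fun x => psi x - chi x).
Proof. by move=> Cp Cc; apply: C1D => //; exact: C1N. Qed.

Lemma C1_prod I (s : seq I) (F : I -> V -> R) :
  (forall i, C1 (F i)) -> C1 (fun x => \prod_(i <- s) F i x).
Proof.
move=> CF; elim: s => [|i s ih].
  by under eq_fun do rewrite big_nil; exact: C1_cst.
by under eq_fun do rewrite big_cons; exact: C1M.
Qed.
End C1_functions.

Section bump.
Context {R : realType}.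

(** The square makes the positive part continuously differentiable at [0]. *)
Definition sqpos (t : R) : R := Num.max t 0 ^+ 2.

Lemma max0_continuous : continuous (fun t : R => Num.max t 0).
Proof.
move=> t; apply: (@continuous_max _ _ (fun t => t) (cst 0)) => //.
exact: cst_continuous.
Qed.

Lemma sqpos_derive (t : R) : is_derive t (1 : R) sqpos (2 * Num.max t 0).
Proof.
have [t0|t0|->] := ltgtP t 0.
- rewrite mulr0.
  apply: (@near_eq_is_derive _ _ _ (cst 0)).
  apply: (@filterS _ _ _ [set s | s < 0]).
    by move=> s /= s0; rewrite /sqpos max_r ?expr0n// ltW.
  by apply: open_nbhs_nbhs; split => //; exact: open_lt.
- apply: (@near_eq_is_derive R R R (fun s : R => s ^+ 2)).
    apply: (@filterS _ _ _ [set s | 0 < s]).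
      by move=> s /= s0; rewrite /sqpos max_l ?ltW.
    by apply: open_nbhs_nbhs; split => //; exact: open_gt.
  apply/is_derive1_caratheodory; exists (fun z => z + t); split.
  + by move=> z; ring.
  + by apply: cont_add => //; [move=> z; exact: cvg_id|exact: cont_cst].
  + by ring.
(* At the origin the slope [sqpos z / z] is [Num.max z 0], which is continuous and vanishes
   there. *)
- rewrite mulr0; apply/is_derive1_caratheodory.
  exists (fun z => Num.max z 0); split; [|exact: max0_continuous|exact: maxxx].
  move=> z; rewrite /sqpos maxxx expr0n/= !subr0 expr2.
  by rewrite /Num.max; case: ltP => // _; rewrite !(mul0r, mulr0).
Qed.

Lemma sqpos_ge0 t : 0 <= sqpos t. Proof. exact: sqr_ge0. Qed.
Lemma sqpos_gt0 t : 0 < t -> 0 < sqpos t.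
Proof. by move=> t0; rewrite /sqpos max_l ?ltW// exprn_gt0. Qed.
Lemma sqpos_eq0 t : t <= 0 -> sqpos t = 0.
Proof. by move=> t0; rewrite /sqpos max_r// expr0n. Qed.

(** This is [s / (1 + s)], which maps nonnegative numbers into the interval from [0] to [1]; as [k]
    grows, [sat (k s)] tends to [1] when [s > 0] and stays [0] when [s = 0]. *)
Definition sat (s : R) : R := 1 - (1 + s)^-1.

Lemma sat0 : sat 0 = 0. Proof. by rewrite /sat addr0 invr1 subrr. Qed.
Lemma sat_itv s : 0 <= s -> 0 <= sat s <= 1.
Proof.
move=> s0; rewrite /sat subr_ge0 lerBlDr lerDl invr_ge0 addr_ge0// andbT.
by rewrite invf_le1 ?lerDl// ltr_wpDr.
Qed.
Lemma sat_gt0 s : 0 < s -> 0 < sat s.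
Proof. by move=> s0; rewrite /sat subr_gt0 invf_lt1 ?ltrDl// addr_gt0. Qed.

Lemma sat_cvg (c : R) : 0 < c -> sat (k%:R * c) @[k --> \oo] --> (1 : R).
Proof.
move=> c0; apply/cvgrPdist_le => e e0; near=> k.
have k0 : 0 <= k%:R * c by rewrite mulr_ge0// ltW.
rewrite /sat opprB addrC subrK ger0_norm ?invr_ge0 ?addr_ge0//.
rewrite invf_ple ?posrE ?ltr_wpDr//.
have : e^-1 / c <= k%:R by near: k; exact: nbhs_infty_ger.
by rewrite ler_pdivrMr// => h; rewrite (le_trans h)// lerDr.
Unshelve. all: by end_near. Qed.

Context {n : nat}.
Local Notation V := ('rV[R]_n).

(** A [C^1] function that vanishes off the open box and tends pointwise to its indicator as [k]
    grows. *)
Definition box_bump (a b : V) (k : nat) (x : V) : R :=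
  \prod_(i <- enum 'I_n)
    (sat (k%:R * sqpos (x 0 i - a 0 i)) * sat (k%:R * sqpos (b 0 i - x 0 i))).

Lemma C1_sat (psi : V -> R) k : C1 psi -> C1 (fun x => sat (k%:R * sqpos (psi x))).
Proof.
move=> Cp; apply: C1B; first exact: C1_cst.
have Cs : C1 (fun x => sqpos (psi x)).
  apply: (C1_comp sqpos_derive _ Cp).
  exact: (cont_mul (@cont_cst _ _ _) max0_continuous).
apply: C1V; last by apply: C1D; [exact: C1_cst|apply: C1M => //; exact: C1_cst].
by move=> x; rewrite gt_eqF// ltr_wpDr// mulr_ge0// sqpos_ge0.
Qed.

Lemma C1_bump a b k : C1 (box_bump a b k).
Proof.
apply: C1_prod => i; apply: C1M; apply: C1_sat; apply: C1B;
  by [exact: C1_coord|exact: C1_cst].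
Qed.

Let sat_sq k t : 0 <= sat (k%:R * sqpos t) <= 1.
Proof. by apply: sat_itv; rewrite mulr_ge0// sqpos_ge0. Qed.

Lemma box_bump_itv a b k x : 0 <= box_bump a b k x <= 1.
Proof.
rewrite /box_bump; elim: (enum _) => [|i s ih]; first by rewrite big_nil ler01 lexx.
have /andP[p0 p1] := sat_sq k (x 0 i - a 0 i).
have /andP[q0 q1] := sat_sq k (b 0 i - x 0 i).
by move: ih => /andP[i0 i1]; rewrite big_cons !mulr_ge0// !mulr_ile1// mulr_ge0.
Qed.

Lemma box_bump_out a b k x : ~ open_box a b x -> box_bump a b k x = 0.
Proof.
move=> /existsNP[i]; rewrite /box_bump (bigD1_seq i) ?enum_uniq ?mem_enum//=.
move=> /negP; rewrite negb_and -!leNgt => /orP[h|h].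
  by rewrite sqpos_eq0 ?subr_le0// mulr0 sat0 !mul0r.
by rewrite [X in _ * sat (_ * X)]sqpos_eq0 ?subr_le0// mulr0 sat0 mulr0 mul0r.
Qed.

Lemma box_bump_gt0 a b k x : open_box a b x -> 0 < box_bump a b k.+1 x.
Proof.
move=> xab; rewrite /box_bump; elim: (enum _) => [|i s ih]; first by rewrite big_nil.
have /andP[ax xb] := xab i.
by rewrite big_cons !mulr_gt0// sat_gt0// mulr_gt0 ?ltr0n// sqpos_gt0// subr_gt0.
Qed.

Lemma box_bump_cvg a b x : open_box a b x -> box_bump a b k x @[k --> \oo] --> (1 : R).
Proof.
move=> xab; rewrite /box_bump; move: (enum _) => s.
pose F i k := sat (k%:R * sqpos (x 0 i - a 0 i)) * sat (k%:R * sqpos (b 0 i - x 0 i)).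
rewrite -[X in X @ _ --> _]/(fun k => \prod_(i <- s) F i k).
elim: s => [|i s ih].
  rewrite (_ : (fun k => _) = fun=> 1); first exact: cvg_cst.
  by apply/funext => k; rewrite big_nil.
have /andP[ax xb] := xab i.
rewrite (_ : (fun k => _) = fun k => F i k * \prod_(j <- s) F j k); last first.
  by apply/funext => k; rewrite big_cons.
have Fi : F i k @[k --> \oo] --> (1 * 1 : R).
  by apply: cvgM; apply: sat_cvg; rewrite sqpos_gt0// subr_gt0.
by have h := cvgM Fi ih; rewrite !mulr1 in h; exact: h.
Qed.
End bump.

Section cutoff.
Context {R : realType} {n : nat}.
Local Notation V := ('rV[R]_n).
Implicit Types psi chi : V -> R.

Definition cube (N : R) : set V := [set x | forall i, - N < x 0 i < N].

Lemma cubeE (N : R) : cube N = open_box (const_mx (- N)) (const_mx N).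
Proof. by apply/seteqP; split => x h i; have := h i; rewrite !mxE. Qed.

Lemma cube_sub (N M : R) : N <= M -> cube N `<=` cube M.
Proof. by move=> NM x h i; have := h i; lra. Qed.

Lemma cubeP (x : V) : exists N : nat, cube N%:R x.
Proof.
exists (Num.truncn (\sum_i `|x 0 i|)).+1 => i; rewrite -ltr_norml.
apply: (@le_lt_trans _ _ (\sum_i `|x 0 i|)); last first.
  exact: truncnS_gt.
by rewrite (bigD1 i)//= lerDl sumr_ge0.
Qed.

Lemma cube_eucl (N : R) (x : V) : cube N x -> eucl x <= Num.sqrt (n%:R * N ^+ 2).
Proof.
move=> xN; rewrite /eucl ler_wsqrtr// /dotv.
apply: (@le_trans _ _ (\sum_(i < n) N ^+ 2)); last by rewrite sumr_const card_ord mulr_natl.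
by apply: ler_sum => i _; have := xN i; rewrite expr2; nra.
Qed.

(** Values between [0] and [1] keep the class stable under the splitting [w chi + w (1 - chi)].
    Vanishing off a cube keeps the integrals finite even if [A] has infinite measure. *)
Definition cutoff (N : R) (psi : V -> R) :=
  [/\ C1 psi, forall x, 0 <= psi x <= 1 & forall x, ~ cube N x -> psi x = 0].

Lemma cutoff_bump (N : R) k : cutoff N (box_bump (const_mx (- N)) (const_mx N) k).
Proof.
split; [exact: C1_bump|exact: box_bump_itv|].
by move=> x; rewrite cubeE; exact: box_bump_out.
Qed.

Lemma cutoff0 (N : R) : cutoff N (cst 0).
Proof. by split => //; [exact: C1_cst|move=> x; rewrite lexx ler01]. Qed.

Lemma cutoff_le (N M : R) psi : N <= M -> cutoff N psi -> cutoff M psi.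
Proof.
by move=> NM [C i v]; split => // x xM; apply: v => /(cube_sub NM).
Qed.

Lemma cutoffM (N : R) psi chi : cutoff N psi -> C1 chi -> (forall x, 0 <= chi x <= 1) ->
  cutoff N (fun x => psi x * chi x).
Proof.
move=> [C i v] Cc ic; split; first exact: C1M.
  move=> x; have /andP[p0 p1] := i x; have /andP[c0 c1] := ic x.
  by rewrite mulr_ge0// mulr_ile1.
by move=> x /v ->; rewrite mul0r.
Qed.

Lemma cutoff_onem (N : R) psi : cutoff N psi ->
  C1 (fun x => 1 - psi x) /\ (forall x, 0 <= 1 - psi x <= 1).
Proof.
move=> [C i v]; split; first by apply: C1B => //; exact: C1_cst.
by move=> x; have := i x; lra.
Qed.

Lemma along_derive psi (x v : V) (t : R) : C1 psi ->
  is_derive t (1 : R) (fun s : R => psi (x + s *: v)) ('D_v psi (x + t *: v)).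
Proof.
move=> [dp _].
have E : (fun h : R => h^-1 *: (((fun s : R => psi (x + s *: v)) \o shift t) (h *: 1) -
    psi (x + t *: v))) =
  (fun h : R => h^-1 *: ((psi \o shift (x + t *: v)) (h *: v) - psi (x + t *: v))).
  apply/funext => h /=; congr (_ *: (psi _ - _)).
  by rewrite -[h *: 1]/(h * 1) mulr1 scalerDl addrCA.
apply: DeriveDef.
  rewrite /derivable E; exact: diff_derivable.
by rewrite /derive E.
Qed.

(** The complement of the closed cube is open, and [psi] is identically [0] on it. *)
Lemma cutoff_derive_out (N : R) psi (v x : V) : 0 < N -> C1 psi ->
  (forall x, ~ cube N x -> psi x = 0) ->
  ~ (forall i, `|x 0 i| <= N) -> 'D_v psi x = 0.
Proof.
move=> N0 C out /existsNP[i /negP]; rewrite -ltNge => Nx.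
rewrite -[RHS](@derive_cst _ _ _ (0 : R) x v); apply/near_eq_derive.
apply: (@filterS V (nbhs x) _ [set y : V | N < `|y 0 i|]).
  move=> y /= Ny; apply: out => /(_ i); rewrite -ltr_norml => /(lt_trans Ny).
  by rewrite ltxx.
apply: open_nbhs_nbhs; split => //.
rewrite (_ : [set _ | _] = (fun y : V => `|y 0 i|) @^-1` [set z | N < z])//.
apply: open_comp => [y _|]; last exact: open_gt.
apply: (@continuous_comp _ _ _ (fun y : V => y 0 i) Num.norm).
  exact: coord_continuous.
exact: norm_continuous.
Qed.

Lemma derive_bounded (N : R) psi (v : V) : 0 < N -> C1 psi ->
  (forall x, ~ cube N x -> psi x = 0) ->
  exists2 L, 0 <= L & forall x, `|'D_v psi x| <= L.
Proof.
move=> N0 C out.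
pose K : set V := [set x | forall i, `|x 0 i| <= N].
have cK : compact K.
  rewrite (_ : K = [set x : V | forall i, `[- N, N]%classic (x ord0 i)]).
    by apply: (@rV_compact R n (fun=> `[- N, N]%classic)) => i; exact: segment_compact.
  by apply/seteqP; split => x h i; have := h i; rewrite /= in_itv/= ler_norml.
have K0 : K !=set0 by exists 0 => i; rewrite mxE normr0 ltW.
have cD : {within K, continuous (fun x : V => `|'D_v psi x|)}.
  apply: continuous_subspaceT.
  by case: C => _ /(_ v) cp; exact: (cont_comp (@norm_continuous _ _) cp).
have [c Kc cmax] := EVT_max_rV K0 cK cD.
exists `|'D_v psi c| => // x.
have [Kx|nKx] := pselect (K x); first by apply: cmax; rewrite inE.
by rewrite (cutoff_derive_out _ N0 C out nKx) normr0.
Qed.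

Lemma C1_lipschitz psi (v : V) (L : R) (x : V) (r : R) : C1 psi ->
  (forall x : V, `|'D_v psi x| <= L) -> 0 < r ->
  `|psi (x + r *: v) - psi x| <= r * L.
Proof.
move=> C DL r0.
have [|c _] := MVT r0 (fun t _ => along_derive x v t C).
  apply: continuous_subspaceT => t.
  have /derivable1_diffP/differentiable_continuous : derivable (fun s : R => psi (x + s *: v)) t 1.
    by case: (along_derive x v t C).
  exact.
by rewrite scale0r addr0 subr0 => ->; rewrite normrM mulrC (gtr0_norm r0) ler_wpM2l// ltW.
Qed.
End cutoff.

(** * Approximation of measurable sets by cut-off functions *)

Section hausdorff_hull.
Context {R : realType} {n : nat}.
Local Notation V := ('rV[R]_n).

Lemma cont_sum (W : topologicalType) I (s : seq I) (F : I -> W -> R) :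
  (forall i, continuous (F i)) -> continuous (fun x => \sum_(i <- s) F i x).
Proof.
move=> cF; elim: s => [|i s ih].
  by under eq_fun do rewrite big_nil; exact: cont_cst.
by under eq_fun do rewrite big_cons; exact: cont_add.
Qed.

Lemma dist_continuous (y : V) : continuous (fun x : V => eucl (x - y)).
Proof.
apply: (cont_comp (@sqrt_continuous _)); apply: cont_sum => i.
have c : continuous (fun x : V => (x - y) 0 i).
  rewrite (_ : (fun x => _) = fun x : V => x 0 i + - y 0 i).
    by apply: cont_add; [exact: coord_continuous|exact: cont_cst].
  by apply/funext => x; rewrite !mxE.
exact: cont_mul.
Qed.

Lemma euclN (x : V) : eucl (- x) = eucl x.
Proof.
by rewrite /eucl /dotv; congr Num.sqrt; apply: eq_bigr => i _; rewrite !mxE mulrNN.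
Qed.

Lemma dist_closed (y : V) r : closed [set x | eucl (x - y) <= r].
Proof. exact: (preimage_closed (fun x _ => @dist_continuous y x) (@closed_le _ r)). Qed.

(** The condition [eucl (x - y) <= r] is closed in each variable, so it passes to the closure one
    variable at a time. *)
Lemma diam_closure (C : set V) : diam (closure C) = diam C.
Proof.
have [->|C0] := eqVneq C set0; first by rewrite closure0.
have CC := @subset_closure _ C.
apply/eqP; rewrite eq_le; apply/andP; split; last first.
  rewrite {1}/diam; case: asboolP => [|_]; first exact: (fun=> diam_ge0 _).
  by apply: ge_ereal_sup => _ [x Cx [y Cy <-]]; apply: eucl_le_diam; exact: CC.
have [->|dC] := eqVneq (diam C) +oo%E; first exact: leey.
have fd : diam C \is a fin_num by rewrite ge0_fin_numE ?diam_ge0// ltey.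
pose r := fine (diam C).
have Cr x y : C x -> C y -> eucl (x - y) <= r.
  by move=> Cx Cy; rewrite -lee_fin fineK//; exact: eucl_le_diam.
have Cr1 x y : closure C x -> C y -> eucl (x - y) <= r.
  move=> clx Cy; have := @closure_subset _ C [set x | eucl (x - y) <= r].
  move=> /(_ (fun z Cz => Cr _ _ Cz Cy) x clx).
  by have /closure_id <- := @dist_closed y r; exact.
have Cr2 x y : closure C x -> closure C y -> eucl (x - y) <= r.
  move=> clx cly; have := @closure_subset _ C [set y | eucl (y - x) <= r].
  move=> /(_ _ y cly); have /closure_id <- := @dist_closed x r.
  rewrite -opprB euclN; apply => z Cz /=.
  by rewrite -opprB euclN; exact: Cr1.
rewrite {1}/diam; case: asboolP => [_|_]; first exact: diam_ge0.
by apply: ge_ereal_sup => _ [x Cx [y Cy <-]]; rewrite -(fineK fd) lee_fin; exact: Cr2.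
Qed.

Lemma haus_term_closure s (C : set V) : haus_term s (closure C) = haus_term s C.
Proof.
have [->|C0] := eqVneq C set0; first by rewrite closure0.
rewrite /haus_term diam_closure; case: asboolP => [/closure_eq0 h|_].
  by rewrite h eqxx in C0.
by case: asboolP => // h; rewrite h eqxx in C0.
Qed.

Lemma haus_delta_anti s d d' (E : set V) : d <= d' ->
  (haus_delta s d' E <= haus_delta s d E)%E.
Proof.
move=> dd'; apply: ereal_inf_le_tmp => _ [C [EC [dC ->]]].
by exists C; split => //; split => // j; apply: le_trans (dC j) _; rewrite lee_fin.
Qed.

(* Each covering set may be replaced by its closure, which has the same
   diameter. *)
Lemma hausdorff_hull s (E : set V) : exists F : nat -> nat -> set V,
  [/\ forall k j, closed (F k j), E `<=` \bigcap_k \bigcup_j F k j &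
      (hausdorff s (\bigcap_k \bigcup_j F k j) <= hausdorff s E)%E].
Proof.
have [Eoo|Efin] := eqVneq (hausdorff s E) +oo%E.
  by exists (fun _ _ => setT); split => // [x _ k _|]; [exists 0%N|rewrite Eoo leey].
have fE : hausdorff s E \is a fin_num by rewrite ge0_fin_numE ?hausdorff_ge0// ltey.
have k0 k : 0 < k.+1%:R^-1 :> R by rewrite invr_gt0.
(* Cover [k] has scale [1 / (k + 1)] and is optimal up to [1 / (k + 1)]. The intersection over [k]
   is covered by the closures from every stage, hence obeys the bound at every scale. *)
have /choice[C HC] k : exists C : nat -> set V, [/\ E `<=` \bigcup_j C j,
    forall j, (diam (C j) <= (k.+1%:R^-1)%:E)%E &
    (\sum_(0 <= j <oo) (haus_term s (C j))%:E <= hausdorff s E + (k.+1%:R^-1)%:E)%E].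
  have le := haus_delta_le s E (k0 k).
  have fin : haus_delta s (k.+1%:R^-1) E \is a fin_num.
    rewrite ge0_fin_numE ?haus_delta_ge0//.
    by rewrite (@le_lt_trans _ _ (hausdorff s E))// ltey.
  have [_ [C [EC [dC ->]]] lt] := lb_ereal_inf_adherent (k0 k) fin.
  by exists C; split => //; rewrite (le_trans (ltW lt))// leeD2r.
exists (fun k j => closure (C k j)); split.
- by move=> k j; exact: closed_closure.
- move=> x Ex k _; have [/(_ x Ex)[j _ Cx] _ _] := HC k.
  by exists j => //; exact: subset_closure.
apply: hausdorff_le => d d0; apply/lee_addgt0Pr => e e0.
have [k kde] : exists k : nat, k.+1%:R^-1 <= Num.min d e.
  have : 0 < Num.min d e by rewrite lt_min d0 e0.
  by move=> /ltr_add_invr[k]; rewrite add0r => /ltW; exists k.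
move: kde; rewrite le_min => /andP[kd ke].
apply: le_trans (haus_delta_anti _ _ kd) _.
have [EC dC sC] := HC k.
apply: (@le_trans _ _ (hausdorff s E + (k.+1%:R^-1)%:E)%E); last first.
  by rewrite leeD2l// lee_fin.
apply: le_trans sC; apply: ereal_inf_lbound.
exists (fun j => closure (C k j)); split.
  by move=> x /(_ k I).
split; first by move=> j; rewrite diam_closure.
by apply: eq_eseriesr => j _; rewrite haus_term_closure.
Qed.
End hausdorff_hull.

Section approximation.
Context {R : realType} {n : nat} (mu : {outer_measure set 'rV[R]_n -> \bar R}).
Local Notation V := ('rV[R]_n).
Let U := caratheodory_type mu.
Hypothesis halfspace : forall (i : 'I_n) t, mu.-caratheodory [set x : V | x 0 i <= t].
Hypothesis hull : forall E : set V, exists F : nat -> nat -> set V,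
  [/\ forall k j, closed (F k j), E `<=` \bigcap_k \bigcup_j F k j &
      (mu (\bigcap_k \bigcup_j F k j) <= mu E)%E].
Variables (N : R) (D : set U).
Hypotheses (mD : measurable D) (Dfin : (mu D < +oo)%E) (DN : D `<=` cube N).

Definition L1dist (f g : V -> R) : \bar R :=
  (\int[cmeasure mu]_(x in D) (`|f x - g x|)%:E)%E.

Let mdist (f g : U -> R) : measurable_fun D f -> measurable_fun D g ->
  measurable_fun D (fun x => (`|f x - g x|)%:E).
Proof.
move=> mf mg; apply/measurable_EFinP; apply: measurableT_comp => //.
exact: measurable_funB.
Qed.

Lemma L1dist_le (f g f1 g1 f2 g2 : U -> R) :
  measurable_fun D f -> measurable_fun D g -> measurable_fun D f1 ->
  measurable_fun D g1 -> measurable_fun D f2 -> measurable_fun D g2 ->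
  (forall x, D x -> `|f x - g x| <= `|f1 x - g1 x| + `|f2 x - g2 x|) ->
  (L1dist f g <= L1dist f1 g1 + L1dist f2 g2)%E.
Proof.
move=> mf mg mf1 mg1 mf2 mg2 le; rewrite /L1dist -ge0_integralD//; last 2 first.
- exact: mdist.
- exact: mdist.
apply: ge0_le_integral => //.
- exact: mdist.
- by apply: emeasurable_funD; exact: mdist.
Qed.

(** Dominated convergence with majorant [1], which is integrable because [mu D] is finite. *)
Lemma L1dist_cvg (f : nat -> U -> R) (g : U -> R) (e : R) : 0 < e ->
  (forall k, measurable_fun D (f k)) -> measurable_fun D g ->
  (forall k x, 0 <= f k x <= 1) -> (forall x, 0 <= g x <= 1) ->
  (forall x, D x -> f k x @[k --> \oo] --> g x) ->
  exists k, (L1dist (f k) g <= e%:E)%E.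
Proof.
move=> e0 mf mg f01 g01 fg.
have : L1dist (f k) g @[k --> \oo] --> (\int[cmeasure mu]_(x in D) (cst 0%E x))%E.
  apply: (@dominated_cvg _ _ _ (cmeasure mu) D mD _ _ (EFin \o cst (1 : R))) => //.
  - by move=> k; exact: mdist.
  - move=> x Dx /=; apply: cvg_EFin; first exact: nearW.
    rewrite -[0](@normr0 _ R^o) -(subrr (g x)).
    apply: cvg_norm; apply: cvgB; [exact: fg|exact: cvg_cst].
  - apply/integrableP; split; first exact/measurable_EFinP.
    by under eq_integral do rewrite /= normr1; rewrite integral_cst// mul1e.
  - move=> k x Dx /=; rewrite lee_fin normr_id ler_norml.
    by have := f01 k x; have := g01 x; lra.
rewrite integral0 => /fine_cvgP[fin /cvgrPdist_le/(_ e e0)].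
move=> /(filterI fin)[m _ /(_ m (leqnn m))[/= fm]].
by rewrite sub0r normrN => h; exists m; rewrite -(fineK fm) lee_fin (le_trans (ler_norm _)).
Qed.

(* Approximation passes from boxes to Borel sets by stability under complements and
   countable unions, and from there to every Caratheodory measurable set by [hull]. *)
Definition approximable (E : set U) := measurable E /\ forall e : R, 0 < e ->
  exists psi, cutoff N psi /\ (L1dist psi \1_E <= e%:E)%E.

Let mC1 (psi : V -> R) : C1 psi -> measurable_fun D (psi : U -> R).
Proof.
by move=> C; apply: continuous_cara_measurable => //; exact: C1_continuous.
Qed.

Let mI (E : set U) : measurable E -> measurable_fun D (\1_E : U -> R).
Proof. by move=> mE; apply: measurable_indic. Qed.

Let indic01 (E : set U) x : 0 <= (\1_E x : R) <= 1.
Proof. by rewrite indicE ler0n lern1 leq_b1. Qed.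

Lemma approximable_box (a b : V) : approximable (open_box a b).
Proof.
split; first exact: open_box_measurable.
move=> e e0.
(* The first factor makes [f k] vanish off the cube, and tends to [1] on [D]. *)
pose f (k : nat) (x : V) : R := box_bump (const_mx (- N)) (const_mx N) k x * box_bump a b k x.
have cf k : cutoff N (f k).
  by apply: cutoffM; [exact: cutoff_bump|exact: C1_bump|exact: box_bump_itv].
have [k hk] : exists k, (L1dist (f k) \1_(open_box a b) <= e%:E)%E.
  apply: L1dist_cvg => //.
  - by move=> k; apply: mC1; case: (cf k).
  - by apply: mI; exact: open_box_measurable.
  - by move=> k x; case: (cf k).
  - move=> x /DN; rewrite cubeE => xN; rewrite indicE.
    have [xab|xab] := pselect (open_box a b x).
      by rewrite mem_set//= -[X in _ --> X]mulr1; apply: cvgM; exact: box_bump_cvg.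
    rewrite memNset//= (_ : f^~ x = cst 0); first exact: cvg_cst.
    by apply/funext => k; rewrite /f (box_bump_out _ xab) mulr0.
by exists (f k).
Qed.

Lemma approximable_limit (F : nat -> set U) (E : set U) :
  (forall k, approximable (F k)) -> measurable E ->
  (forall x, D x -> (\1_(F k) x : R) @[k --> \oo] --> (\1_E x : R)) ->
  approximable E.
Proof.
move=> aF mE FE; split => // e e0.
have e2 : 0 < e / 2 by rewrite divr_gt0.
have mF k : measurable (F k) by case: (aF k).
have [k hk] : exists k, (L1dist \1_(F k) \1_E <= (e / 2)%:E)%E.
  by apply: L1dist_cvg => // *; exact: mI.
have [_ /(_ _ e2)[psi [cpsi hpsi]]] := aF k.
exists psi; split => //.
rewrite [e]splitr EFinD (le_trans _ (leeD hpsi hk))//.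
have mp : measurable_fun D (psi : U -> R) by case: cpsi => C _ _; exact: mC1.
apply: L1dist_le => //; try exact: mI.
by move=> x Dx; rewrite (le_trans _ (ler_normD _ _))// addrA subrK.
Qed.

(** The function [1 - psi] does not vanish off the cube, so it is multiplied by a cut-off close to
    [1] on [D]. *)
Lemma approximable_setC (E : set U) : approximable E -> approximable (~` E).
Proof.
move=> [mE aE]; split; first exact: measurableC.
move=> e e0; have e2 : 0 < e / 2 by rewrite divr_gt0.
have [psi [cpsi hpsi]] := aE _ e2.
have [mN aN] := approximable_box (const_mx (- N)) (const_mx N).
have [chi [cchi hchi]] := aN _ e2.
have [C1p p01] := cutoff_onem cpsi.
have [Cp ip _] := cpsi; have [Cc ic _] := cchi.
exists (fun x => chi x * (1 - psi x)); split; first exact: cutoffM.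
rewrite [e]splitr EFinD (le_trans _ (leeD hchi hpsi))//.
apply: L1dist_le; do ?[by apply: mI => //; exact: measurableC|exact: mC1].
  by apply: mC1; exact: C1M.
move=> x Dx; rewrite (_ : \1_(~` E) x = 1 - \1_E x :> R); last first.
  by rewrite !indicE in_setC; case: (x \in E); rewrite /= ?subrr ?subr0.
rewrite (_ : \1_(open_box _ _) x = 1); last first.
  by rewrite indicE mem_set// -cubeE; exact: DN.
have := ip x; have := ic x; have := indic01 E x.
move: (psi x) (chi x) (\1_E x : R) => p c t; rewrite ler_norml.
have := ler_norm (c - 1); have := ler_norm (- (c - 1)); rewrite normrN.
have := ler_norm (p - t); have := ler_norm (- (p - t)); rewrite normrN.
by move: `|c - 1| `|p - t| => a b; nra.
Qed.

(** The expression [psi + chi (1 - psi)] is the indicator of a union when applied to indicators. It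
    keeps values between [0] and [1] and is there 1-Lipschitz in each argument, so the errors add
    up. *)
Lemma approximable_setU (E F : set U) :
  approximable E -> approximable F -> approximable (E `|` F).
Proof.
move=> [mE aE] [mF aF]; split; first exact: measurableU.
move=> e e0; have e2 : 0 < e / 2 by rewrite divr_gt0.
have [psi [cpsi hpsi]] := aE _ e2; have [chi [cchi hchi]] := aF _ e2.
have [Cp ip vp] := cpsi; have [Cc ic vc] := cchi.
exists (fun x => psi x + chi x * (1 - psi x)).
have Cpc : C1 (fun x => psi x + chi x * (1 - psi x)).
  by apply: C1D => //; apply: C1M => //; apply: C1B => //; exact: C1_cst.
split.
  split => // [x|x xN]; last by rewrite vp// vc// mul0r addr0.
  by have := ip x; have := ic x; nra.
rewrite [e]splitr EFinD (le_trans _ (leeD hpsi hchi))//.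
apply: L1dist_le; do ?[by apply: mI => //; exact: measurableU|exact: mC1].
move=> x Dx; rewrite (_ : \1_(E `|` F) x = \1_E x + \1_F x * (1 - \1_E x) :> R); last first.
  rewrite !indicE in_setU; case: (x \in E) => /=; first by rewrite subrr mulr0 addr0.
  by rewrite add0r subr0 mulr1.
have := ip x; have := ic x; have := indic01 E x; have := indic01 F x.
move: (psi x) (chi x) (\1_E x : R) (\1_F x : R) => p c t u; rewrite ler_norml.
have := ler_norm (p - t); have := ler_norm (- (p - t)); rewrite normrN.
have := ler_norm (c - u); have := ler_norm (- (c - u)); rewrite normrN.
by move: `|p - t| `|c - u| => a b; nra.
Qed.

Lemma approximable0 : approximable set0.
Proof.
split=> // e e0; exists (cst 0); split; first exact: cutoff0.
rewrite /L1dist integral0_eq ?lee_fin ?ltW// => x _.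
by rewrite indic0 subrr normr0.
Qed.

Lemma approximable_bigcup (F : nat -> set U) :
  (forall k, approximable (F k)) -> approximable (\bigcup_k F k).
Proof.
move=> aF.
apply: (@approximable_limit (fun m => \big[setU/set0]_(k < m) F k)).
- move=> m; elim/big_ind : _ => //; [exact: approximable0|exact: approximable_setU].
- by apply: bigcupT_measurable => k; case: (aF k).
- move=> x Dx; have [[k _ Fx]|nF] := pselect ((\bigcup_k F k) x).
    rewrite [X in _ --> X]indicE mem_set//=; last by exists k.
    apply: cvg_near_cst; exists k.+1 => // m /= km.
    rewrite indicE mem_set// -bigcup_mkord; exists k => //.
  rewrite [X in _ --> X]indicE memNset//= .
  apply: cvg_near_cst; apply: nearW => m.
  rewrite indicE memNset// -bigcup_mkord => -[k _ Fx]; apply: nF; by exists k.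
Qed.

Lemma approximable_open (O : set V) : open O -> approximable O.
Proof.
move=> /open_countable_boxes[F [-> HF]]; apply: approximable_bigcup => k.
by case: (HF k) => [->|[a [b ->]]]; [exact: approximable0|exact: approximable_box].
Qed.

Lemma measurable_approximable (E : set U) : measurable E -> approximable E.
Proof.
(* The hull [G] is built from closed sets by countable unions and intersections, hence approximable.
   Since the trace of [E] on [D] has finite measure, [G] differs from [E] on [D] by a null set. *)
move=> mE; have [F [cF EF muF]] := hull (E `&` D).
set G := \bigcap_k _ in EF muF.
have [mG aG] : approximable G.
  rewrite -[G]setCK; apply: approximable_setC; rewrite setC_bigcap.
  apply: approximable_bigcup => k; apply: approximable_setC.
  apply: approximable_bigcup => j; rewrite -[F k j]setCK; apply: approximable_setC.
  by apply: approximable_open; exact: closed_openC.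
split => // e e0; have [psi [cpsi hpsi]] := aG e e0.
exists psi; split => //; apply: le_trans hpsi.
have mp : measurable_fun D (psi : U -> R) by case: cpsi => C _ _; exact: mC1.
suff h : (L1dist \1_G \1_E <= 0)%E.
  rewrite -[leRHS]adde0 (le_trans _ (leeD (lexx _) h))//.
  apply: L1dist_le => //; try exact: mI.
  by move=> x Dx; rewrite (le_trans _ (ler_normD _ _))// addrA subrK.
have mED : measurable (E `&` D) by exact: measurableI.
have EDfin : (cmeasure mu (E `&` D) < +oo)%E.
  by apply: le_lt_trans Dfin; apply: le_outer_measure => x [].
have Gfin : (cmeasure mu G < +oo)%E by exact: le_lt_trans EDfin.
apply: (@le_trans _ _ (\int[cmeasure mu]_(x in D) (\1_(G `\` (E `&` D)) x)%:E)%E).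
  apply: ge0_le_integral => //.
  - by apply: mdist; exact: mI.
  - by apply/measurable_EFinP; apply: mI; exact: measurableD.
  - move=> x Dx; rewrite lee_fin !indicE.
    have [Ex|Ex] := pselect (E x).
      by rewrite (mem_set Ex) (@mem_set _ G x (EF x (conj Ex Dx))) subrr normr0 ler0n.
    rewrite (memNset Ex) subr0 ger0_norm ?ler0n// ler_nat.
    have [Gx|Gx] := pselect (G x); last by rewrite memNset.
    by rewrite (@mem_set _ (G `\` _))// ?leq_b1//; split => // -[].
rewrite integral_indic//; last exact: measurableD.
apply: (@le_trans _ _ (cmeasure mu (G `\` (E `&` D)))); first by exact: le_outer_measure.
rewrite measureD// (_ : G `&` (E `&` D) = E `&` D); last exact/setIidr.
by rewrite leeBlDr ?add0e// ge0_fin_numE.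
Qed.

Lemma cutoff_approx (E : set U) (e : R) : measurable E -> 0 < e ->
  exists psi, cutoff N psi /\ (L1dist psi \1_E <= e%:E)%E.
Proof. by move=> /measurable_approximable[_]; apply. Qed.
End approximation.

(** * Difference quotients and the Gauss-Green formula *)

Section integration.
Context {d} {T : measurableType d} {R : realType} (mu : {measure set T -> \bar R}).

(** A difference of two nonnegative extended reals is finite only if both are. This later extracts
    integrability over [S] from the mere equality in Gauss-Green. *)
Lemma fin_num_integrable (D : set T) (f : T -> \bar R) : measurable D ->
  measurable_fun D f -> (\int[mu]_(x in D) f x)%E \is a fin_num -> mu.-integrable D f.
Proof.
move=> mD mf; rewrite integralE => h; apply/integrableP; split => //.
under eq_integral do rewrite -/(abse _) -[abse (f _)]/((abse \o f) _) fune_abse.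
rewrite ge0_integralD//; last 2 first.
- exact: measurable_funepos.
- exact: measurable_funeneg.
move: h; have : (0 <= \int[mu]_(x in D) f^\+ x)%E by exact: integral_ge0.
have : (0 <= \int[mu]_(x in D) f^\- x)%E by exact: integral_ge0.
case: (\int[mu]_(x in D) f^\+ x)%E => [p| |]; case: (\int[mu]_(x in D) f^\- x)%E => [q| |] //=.
by rewrite -EFinD ltry.
Qed.

Lemma integrable_bounded_support (X K : set T) (f : T -> R) (C : R) :
  measurable X -> measurable K -> (mu (K `&` X) < +oo)%E -> measurable_fun X f ->
  0 <= C -> (forall x, X x -> `|f x| <= C) -> (forall x, X x -> ~ K x -> f x = 0) ->
  mu.-integrable X (EFin \o f).
Proof.
move=> mX mK Kfin mf C0 fC fK; apply/integrableP; split; first exact/measurable_EFinP.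
apply: (@le_lt_trans _ _ (\int[mu]_(x in X) (C%:E * (\1_K x)%:E))%E).
  apply: ge0_le_integral => //.
  - by apply: measurableT_comp => //; exact/measurable_EFinP.
  - by apply: emeasurable_funM => //; apply/measurable_EFinP; exact: measurable_indic.
  - move=> x Xx /=; rewrite -EFinM lee_fin indicE.
    have [Kx|nKx] := pselect (K x); first by rewrite mem_set// mulr1 fC.
    by rewrite fK// normr0 memNset// mulr0.
rewrite ge0_integralZl_EFin//; last by apply/measurable_EFinP; exact: measurable_indic.
by rewrite integral_indic//; apply: lte_mul_pinfty => //; rewrite lee_fin.
Qed.

Lemma Rintegral_dominated_cvg (D : set T) (f : nat -> T -> R) (g h : T -> R) :
  measurable D -> (forall k, measurable_fun D (f k)) ->
  (forall x, D x -> f k x @[k --> \oo] --> g x) ->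
  mu.-integrable D (EFin \o h) -> (forall k x, D x -> `|f k x| <= h x) ->
  \int[mu]_(x in D) f k x @[k --> \oo] --> \int[mu]_(x in D) g x.
Proof.
move=> mD mf fg ih fh.
have : (\int[mu]_(x in D) (f k x)%:E)%E @[k --> \oo] --> (\int[mu]_(x in D) (g x)%:E)%E.
  apply: (@dominated_cvg _ _ _ mu D mD _ _ (EFin \o h)) => //.
  - by move=> k; exact/measurable_EFinP.
  - by move=> x Dx; apply: cvg_EFin; [exact: nearW|exact: fg].
have ig : mu.-integrable D (EFin \o g).
  have mg : measurable_fun D g by exact: (measurable_fun_cvg mf fg).
  apply: (le_integrable mD _ _ ih); first exact/measurable_EFinP.
  move=> x Dx /=; rewrite lee_fin; apply: le_trans (ler_norm _).
  have c : `|f k x| @[k --> \oo] --> `|g x| by apply: cvg_norm; exact: fg.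
  rewrite -(cvg_lim _ c)//; apply: limr_le; first exact: (cvgP _ c).
  by apply: nearW => k; exact: fh.
have fi : (\int[mu]_(x in D) (g x)%:E)%E \is a fin_num by exact: integrable_fin_num.
by rewrite -(fineK fi) => /fine_cvg.
Qed.
End integration.

Lemma shift_continuous {R : numFieldType} {W : normedModType R} (c : W) :
  continuous (fun x : W => x + c).
Proof. by move=> x; apply: cvgD; [exact: cvg_id|exact: cvg_cst]. Qed.

Section translation.
Context {R : realType} {n : nat}.
Local Notation V := ('rV[R]_n).
Local Notation lam := (cmeasure (@leb_outer R n)).
Local Notation U := (caratheodory_type (@leb_outer R n)).

Definition shiftset (X : set V) (v : V) : set V := (fun x => x - v) @^-1` X.

Lemma leb_outer_shift (X : set V) v : leb_outer (shiftset X v) = leb_outer X.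
Proof. exact: (leb_outer_translate X (- v)). Qed.

Lemma measurable_shift (X : set U) (v : V) : measurable X -> measurable (shiftset X v : set U).
Proof.
move=> mX; suff : (@leb_outer R n).-caratheodory (shiftset X v) by [].
move=> E; have := (mX : (@leb_outer R n).-caratheodory X) (shiftset E (- v)); rewrite -(leb_outer_shift E (- v)).
have shiftK (Y : set V) : shiftset (shiftset Y (- v)) v = Y.
  by apply/seteqP; split => x; rewrite /shiftset/= opprK subrK.
rewrite -(leb_outer_shift _ v) => ->; rewrite -(leb_outer_shift (_ `&` X) v).
rewrite -(leb_outer_shift (_ `&` ~` X) v).
have E1 Y : shiftset (shiftset E (- v) `&` Y) v = E `&` shiftset Y v.
  by rewrite -[in RHS](shiftK E).
by rewrite !E1.
Qed.

Lemma leb_shift_measurable (v : V) :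
  measurable_fun [set: U] ((fun x : V => x + v) : U -> U).
Proof.
move=> _ Y mY; rewrite setTI.
rewrite (_ : _ @^-1` Y = shiftset Y (- v)); first exact: measurable_shift.
by apply/seteqP; split => x; rewrite /shiftset/= opprK.
Qed.

Lemma leb_integral_shift (X : set U) (f : U -> R) (v : V) : measurable X ->
  measurable_fun [set: U] f -> (forall x, 0 <= f x) ->
  \int[lam]_(x in shiftset X v) f x = \int[lam]_(x in X) f (x + v).
Proof.
move=> mX mf f0; congr fine.
have := ge0_integral_pushforward (leb_shift_measurable v) lam (measurable_shift v mX)
  (f := EFin \o f) _ _.
rewrite (_ : (fun x : V => x + v) @^-1` shiftset X v = X); last first.
  by apply/seteqP; split => x; rewrite /shiftset/= addrK.
move=> <-.
- apply: eq_measure_integral => [|? Y mY _]; first exact: leb_shift_measurable.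
  by apply/esym; exact: leb_outer_translate.
- by apply/measurable_EFinP; exact: measurable_funTS.
- by move=> x _; rewrite lee_fin.
Qed.

Lemma leb_measurable_continuous (f : V -> R) (D : set U) : measurable D ->
  continuous f -> measurable_fun D (f : U -> R).
Proof. by apply: continuous_cara_measurable => i t; exact: leb_outer_halfspace. Qed.

(** The closed counterpart of [cube]: it is compact, and derivatives of cut-offs vanish off it. *)
Definition cbox (N : R) : set V := box (const_mx (- N)) (const_mx N).

Lemma cboxP (N : R) (x : V) : cbox N x <-> forall i, `|x 0 i| <= N.
Proof. by split => h i; have := h i; rewrite !mxE ler_norml. Qed.

Lemma cube_cbox (N : R) : cube N `<=` cbox N.
Proof. by move=> x h i; have := h i; rewrite !mxE => /andP[/ltW -> /ltW ->]. Qed.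

Lemma cbox_closed (N : R) : closed (cbox N).
Proof.
rewrite (_ : cbox N = \bigcap_(i in [set: 'I_n]) [set x : V | `|x 0 i| <= N]).
  apply: closed_bigI => i _.
  apply: (preimage_closed (f := fun x : V => `|x 0 i|) _ (@closed_le _ N)) => x _.
  by apply: (cont_comp (@norm_continuous _ R^o)); exact: coord_continuous.
apply/seteqP; split => x h; first by move=> i _; exact: (proj1 (cboxP N x) h).
by apply/(proj2 (cboxP N x)) => i; exact: h.
Qed.

Lemma cbox_measurable (N : R) : measurable (cbox N : set U).
Proof.
by apply: closed_cara_measurable (@cbox_closed N) => i t; exact: leb_outer_halfspace.
Qed.

Lemma cbox_finite (N : R) (X : set U) : (lam (cbox N `&` X) < +oo)%E.
Proof.
apply: (le_lt_trans _ (leb_outer_box_lty (const_mx (- N)) (const_mx N))).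
by apply: le_outer_measure => x [].
Qed.

Lemma leb_integrable (N C : R) (X : set U) (f : V -> R) : measurable X ->
  measurable_fun X (f : U -> R) -> 0 <= C -> (forall x, `|f x| <= C) ->
  (forall x, ~ cbox N x -> f x = 0) -> lam.-integrable X (EFin \o f).
Proof.
move=> mX mf C0 fC fN.
apply: (integrable_bounded_support mX (cbox_measurable N) (cbox_finite N X) mf C0).
  by move=> x _; exact: fC.
by move=> x _; exact: fN.
Qed.

Lemma cutoff_leb_integrable (N : R) (X : set U) psi : measurable X -> cutoff N psi ->
  lam.-integrable X (EFin \o psi).
Proof.
move=> mX [C i v]; apply: (@leb_integrable N 1) => //.
- by apply: leb_measurable_continuous => //; exact: C1_continuous.
- by move=> x; rewrite ger0_norm; have := i x; lra.
- by move=> x nx; apply: v => /(@cube_cbox N).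
Qed.

Lemma derive_leb_integrable (N : R) (X : set U) psi (q : V) : 0 < N -> measurable X ->
  cutoff N psi -> lam.-integrable X (EFin \o 'D_q psi).
Proof.
move=> N0 mX [C i v]; have [L L0 DL] := derive_bounded q N0 C v.
apply: (@leb_integrable N L X _ mX _ L0 DL).
- by apply: leb_measurable_continuous => //; case: C.
- move=> x /cboxP nx; exact: (cutoff_derive_out q N0 C v nx).
Qed.

(** Were the estimate false for arbitrarily small [r], it would fail along a sequence tending to
    [0], against dominated convergence. The quotients are bounded by the Lipschitz constant [L] and
    vanish off a fixed cube. *)
Lemma difference_quotient (N : R) (X : set U) psi (q : V) (e : R) : 0 < N ->
  measurable X -> cutoff N psi -> 0 < e ->
  exists2 d, 0 < d & forall r, 0 < r < d ->
    `|r^-1 * (\int[lam]_(x in X) psi (x + r *: q) - \int[lam]_(x in X) psi x)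
      - \int[lam]_(x in X) 'D_q psi x| <= e.
Proof.
move=> N0 mX cpsi e0; have [C i v] := cpsi; have [L L0 DL] := derive_bounded q N0 C v.
apply: contrapT => nd.
have /choice[r Hr] k : exists r : R, [/\ 0 < r, r <= k.+1%:R^-1 & ~
    `|r^-1 * (\int[lam]_(x in X) psi (x + r *: q) - \int[lam]_(x in X) psi x)
      - \int[lam]_(x in X) 'D_q psi x| <= e].
  apply: contrapT => h; apply: nd; exists k.+1%:R^-1; first by rewrite invr_gt0.
  move=> r /andP[r0 rk]; apply: contrapT => h'; apply: h; exists r; split => //.
  exact: ltW.
have r0 k : 0 < r k by case: (Hr k).
have r1 k : r k <= 1.
  by have [_ h _] := Hr k; rewrite (le_trans h)// invf_le1// ler1n.
have rcvg : r k @[k --> \oo] --> (0 : R).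
  apply: (@squeeze_cvgr _ _ _ _ (fun _ => 0) (fun k : nat => k.+1%:R^-1)).
  - by apply: nearW => k; have [h1 h2 _] := Hr k; rewrite ltW.
  - exact: cvg_cst.
  - exact: cvg_harmonic.
pose f k x := (r k)^-1 * (psi (x + r k *: q) - psi x).
(* Large enough for [psi] and all its translates by [r k *: q] to vanish off the cube, as
   [r k <= 1]. *)
pose M := N + \sum_i `|q 0 i|.
have q_le j : `|q 0 j| <= \sum_i `|q 0 i| by rewrite (bigD1 j)//= lerDl sumr_ge0.
have fM k x : ~ cbox M x -> f k x = 0.
  move=> /cboxP/existsNP[j /negP]; rewrite -ltNge => Mx; rewrite /f !v ?subrr ?mulr0//.
    move=> /(_ j); rewrite -ltr_norml => h.
    have q0 : 0 <= \sum_i `|q 0 i| by exact: sumr_ge0.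
    by move: Mx; rewrite /M; lra.
  move=> /(_ j); rewrite -ltr_norml !mxE => h.
  have := ler_normB (x 0 j + r k * q 0 j) (r k * q 0 j); rewrite addrK => h2.
  have h3 : `|r k * q 0 j| <= \sum_i `|q 0 i|.
    by rewrite normrM gtr0_norm// (le_trans _ (q_le j))// ler_piMl.
  by move: Mx; rewrite /M; lra.
have fL k x : `|f k x| <= L.
  rewrite /f normrM gtr0_norm ?invr_gt0// ler_pdivrMl// .
  exact: C1_lipschitz.
have Cpsi := C1_continuous C.
have cshift k : continuous (fun x : V => psi (x + r k *: q)).
  move=> x; apply: (@continuous_comp _ _ _ (fun x : V => x + r k *: q) psi); last exact: Cpsi.
  exact: shift_continuous.
have mf k : measurable_fun X (f k : U -> R).
  apply: leb_measurable_continuous => //; apply: cont_mul; first exact: cont_cst.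
  by apply: cont_add; [exact: cshift|apply: cont_comp Cpsi; exact: opp_continuous].
have flim x : f k x @[k --> \oo] --> 'D_q psi x.
  have := @diff_derivable _ _ _ psi x q (C.1 x); rewrite /derivable => /cvg_ex[l hl].
  have -> : 'D_q psi x = l by apply: cvg_lim.
  have rdn : r k @[k --> \oo] --> 0^'.
    move=> A /rcvg; rewrite /= !near_simpl; apply: filterS => k /=.
    by apply; rewrite gt_eqF.
  have := cvg_comp _ _ rdn hl; apply: cvg_trans; apply: near_eq_cvg.
  apply: nearW => k /=; rewrite /f -[RHS]/(_ * _); congr (_ * (psi _ - _)).
  by rewrite addrC.
have ih : lam.-integrable X (EFin \o (fun x => L * \1_(cbox M) x)).
  apply: (@leb_integrable M L X _ mX _ L0).
  - apply: measurable_funM; first exact: measurable_cst.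
    by apply: measurable_indic; exact: cbox_measurable.
  - move=> x; rewrite normrM ger0_norm// indicE ger0_norm// ler_piMr//.
    by rewrite lern1 leq_b1.
  - by move=> x nx; rewrite indicE memNset// mulr0.
have fh k x : X x -> `|f k x| <= L * \1_(cbox M) x.
  move=> _; have [Mx|nMx] := pselect (cbox M x).
    by rewrite indicE mem_set// mulr1.
  by rewrite fM// normr0 indicE memNset// mulr0.
have := Rintegral_dominated_cvg mX mf (fun x _ => flim x) ih fh.
move=> /cvgrPdist_le/(_ e e0)[k _ /(_ k (leqnn k))] /=; rewrite distrC => h.
have [_ _] := Hr k; apply; apply: le_trans h.
rewrite le_eqVlt; apply/orP; left; apply/eqP; congr (`|_ - _|).
have i1 : lam.-integrable X (EFin \o (fun x => psi (x + r k *: q))).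
  apply: (@leb_integrable M 1 X _ mX _ ler01).
  - exact: leb_measurable_continuous.
  - by move=> x; rewrite ger0_norm; have := i (x + r k *: q); lra.
  - move=> x nx; have p0 : psi x = 0.
      apply: v => /(@cube_cbox N)/cboxP h1; apply: nx; apply/cboxP => j.
      by rewrite (le_trans (h1 j))// /M lerDl sumr_ge0.
    have := fM k x nx; rewrite /f p0 subr0 => /eqP; rewrite mulf_eq0 invr_eq0.
    by rewrite gt_eqF//= => /eqP.
have i2 := cutoff_leb_integrable mX cpsi.
rewrite -RintegralB// RintegralZl//.
have := integrableB mX i1 i2; apply: eq_integrable => // x _.
Qed.
End translation.

Section gauss_green.
Context {R : realType} {n : nat} (mu : {outer_measure set 'rV[R]_n -> \bar R}).
Local Notation V := ('rV[R]_n).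
Local Notation lam := (cmeasure (@leb_outer R n)).
Local Notation Ul := (caratheodory_type (@leb_outer R n)).
Let U := caratheodory_type mu.
Hypothesis halfspace : forall (i : 'I_n) t, mu.-caratheodory [set x : V | x 0 i <= t].
Variables (A : set Ul) (S : set U) (nu : V -> V).
Hypotheses (n0 : (0 < n)%N) (mA : measurable A).
Hypothesis nu1 : forall a, S a -> eucl (nu a) = 1.
Hypothesis mnu : forall i t, mu.-caratheodory (S `&` [set a | t < nu a 0 i]).
Hypothesis GG : forall phi, Cc1 phi -> @s_int R V (@leb_outer R n) A (divg phi) =
  @s_int R V mu S (fun a => dotv (phi a) (nu a)).

Lemma normal_le1 a i : S a -> `|nu a 0 i| <= 1.
Proof. by move=> Sa; rewrite -(nu1 Sa); exact: ler_coord_eucl. Qed.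

Lemma normal_sq a : S a -> dotv (nu a) (nu a) = 1.
Proof.
move=> Sa; rewrite -[LHS](@sqr_sqrtr _ (dotv (nu a) (nu a))) ?dotvv_ge0//.
by have := nu1 Sa; rewrite /eucl => ->; rewrite expr1n.
Qed.

Lemma support_measurable : measurable S.
Proof.
pose i := Ordinal n0.
(* Any threshold below [-1] would do: coordinates of a unit vector exceed it, so the superlevel set
   is all of [S]. *)
rewrite (_ : S = S `&` [set a | -2 < nu a 0 i]); first exact: mnu.
apply/esym/setIidPl => a /(normal_le1 i); rewrite ler_norml /= => /andP[+ _].
by apply: lt_le_trans; lra.
Qed.

Lemma normal_measurable i : measurable_fun S (fun a : U => nu a 0 i).
Proof. by apply: measurable_fun_rays => t; exact: mnu. Qed.

Lemma dot_normal_measurable q : measurable_fun S (fun a : U => dotv q (nu a)).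
Proof.
rewrite /dotv; elim: (index_enum _) => [|i s ih].
  by under eq_fun do rewrite big_nil; exact: measurable_cst.
under eq_fun do rewrite big_cons; apply: measurable_funD ih.
by apply: measurable_funM; [exact: measurable_cst|exact: normal_measurable].
Qed.

Lemma dot_normal_le q a : S a -> `|dotv q (nu a)| <= \sum_i `|q 0 i|.
Proof.
move=> Sa; apply: le_trans (ler_norm_sum _ _ _) _; apply: ler_sum => i _.
by rewrite normrM ler_piMr// normal_le1.
Qed.

Section scalar_fields.
Variables (N : R) (psi : V -> R).
Hypotheses (N0 : 0 < N) (cpsi : cutoff N psi).

Let comp_scale q i : Defs.comp (fun x => psi x *: q) i = fun y => psi y * q 0 i.
Proof. by apply/funext => y; rewrite /Defs.comp mxE. Qed.

Lemma Cc1_scale q : Cc1 (fun x => psi x *: q).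
Proof.
have [C _ v] := cpsi; have Cq i := C1M C (C1_cst (q 0 i)).
split; [|split].
- by move=> i x; rewrite comp_scale; apply: diff_derivable; case: (Cq i).
- by move=> i; rewrite comp_scale; have [_ h] := Cq i; exact: h.
- exists (Num.sqrt (n%:R * N ^+ 2)) => x Mx; rewrite v ?scale0r// => /cube_eucl.
  by rewrite leNgt Mx.
Qed.

Lemma divg_scale q : divg (fun x => psi x *: q) = 'D_q psi.
Proof.
have [[dp _] _ _] := cpsi; apply/funext => x; rewrite /divg.
rewrite [in RHS](row_sum_delta q) deriveE// linear_sum; apply: eq_bigr => i _.
rewrite linearZ/= -deriveE// comp_scale.
have := @deriveM _ _ psi (cst (q 0 i)) x (evec R i) (diff_derivable (dp x)) (derivable_cst _ _ _).
by rewrite derive_cst scaler0 add0r.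
Qed.

(** The volume side is finite because ['D_q psi] is bounded and vanishes off a bounded set. The
    surface side is therefore finite, which gives integrability over [S] before anything is known
    about the measure of [S]. *)
Lemma gauss_green q :
  (cmeasure mu).-integrable S (EFin \o (fun a => psi a * dotv q (nu a))) /\
  \int[lam]_(x in A) 'D_q psi x = \int[cmeasure mu]_(a in S) (psi a * dotv q (nu a)).
Proof.
have [C _ v] := cpsi.
have mS := support_measurable.
have E : (fun a => dotv (psi a *: q) (nu a)) = (fun a => psi a * dotv q (nu a)).
  apply/funext => a; rewrite /dotv mulr_sumr; apply: eq_bigr => i _.
  by rewrite mxE mulrA.
have mf : measurable_fun S (fun a : U => psi a * dotv q (nu a)).
  apply: measurable_funM; last exact: dot_normal_measurable.
  by apply: continuous_cara_measurable => //; exact: C1_continuous.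
have := GG (Cc1_scale q); rewrite divg_scale E s_intE//; last first.
  by apply: leb_measurable_continuous => //; case: C.
rewrite (@s_intE _ _ mu)// => EI.
have fin : (\int[lam]_(x in A) ('D_q psi x)%:E)%E \is a fin_num.
  exact: integrable_fin_num (derive_leb_integrable q N0 mA cpsi).
split; last by rewrite /Rintegral EI.
by apply: fin_num_integrable => //; [exact/measurable_EFinP|rewrite -EI].
Qed.

(* The translation is moved onto [psi], whose difference quotients converge. *)
Lemma translation_flux q e : 0 < e -> exists2 d, 0 < d & forall r, 0 < r < d ->
  `|r^-1 * (\int[lam]_(x in shiftset A (r *: q)) psi x - \int[lam]_(x in A) psi x)
    - \int[cmeasure mu]_(a in S) (psi a * dotv q (nu a))| <= e.
Proof.
move=> e0; have [d d0 hd] := difference_quotient q N0 mA cpsi e0.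
exists d => // r rd; have := hd r rd.
rewrite -leb_integral_shift//.
- by rewrite (proj2 (gauss_green q)).
- by apply: leb_measurable_continuous => //; case: cpsi => C _ _; exact: C1_continuous.
- by move=> x; case: cpsi => _ /(_ x)/andP[].
Qed.
End scalar_fields.

(* Gauss-Green makes each [psi nu_i] integrable over [S], and [|nu| = 1]. *)
Lemma support_locally_finite N : 0 < N -> (mu (S `&` cube N) < +oo)%E.
Proof.
move=> N0; have mS := support_measurable.
(* A bump of a larger cube is positive on the closed cube of half-width [N], hence bounded below
   there by some [c > 0]. *)
pose psi : V -> R := box_bump (const_mx (- (N + 1))) (const_mx (N + 1)) 1.
have cpsi : cutoff (N + 1) psi by exact: cutoff_bump.
have N1 : 0 < N + 1 by lra.
have [C i v] := cpsi.
have [c c0 hc] : exists2 c, 0 < c & forall x, cbox N x -> c <= psi x.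
  have cK : compact (cbox N : set V).
    rewrite (_ : (cbox N : set V) = [set x : V | forall i, `[- N, N]%classic (x ord0 i)]).
      by apply: (@rV_compact R n (fun=> `[- N, N]%classic)) => j; exact: segment_compact.
    apply/seteqP; split => x h j; have := h j; rewrite /= ?in_itv/= ?mxE//.
  have K0 : (cbox N : set V) !=set0.
    by exists 0; apply/(proj2 (cboxP N 0)) => j; rewrite mxE normr0 ltW.
  have [c Kc cmin] := EVT_min_rV K0 cK (continuous_subspaceT (C1_continuous C)).
  exists (psi c); last by move=> x Kx; apply: cmin; rewrite inE.
  rewrite /psi; apply: box_bump_gt0; rewrite -cubeE => j.
  by move: Kc; rewrite inE => /cboxP/(_ j); rewrite ler_norml; lra.
have mcube : measurable (cube N : set U) by rewrite cubeE; exact: open_box_measurable.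
have mD : measurable (S `&` cube N : set U) by exact: measurableI.
have mf : measurable_fun S (fun a : U => psi a).
  by apply: continuous_cara_measurable => //; exact: C1_continuous.
have mg j : measurable_fun S (fun a : U => (`|psi a * nu a 0 j|)%:E).
  apply/measurable_EFinP; apply: measurableT_comp => //.
  by apply: measurable_funM => //; exact: normal_measurable.
have dote j a : dotv (evec R j) (nu a) = nu a 0 j.
  rewrite /dotv (bigD1 j)//= !mxE !eqxx mul1r big1 ?addr0// => l lj.
  by rewrite !mxE (negbTE lj) mul0r.
have fin j : (\int[cmeasure mu]_(a in S) (`|psi a * nu a 0 j|)%:E < +oo)%E.
  have [/integrableP[_ h] _] := gauss_green N1 cpsi (evec R j).
  by move: h; under eq_integral do rewrite /= dote.
have cfin : (c%:E * mu (S `&` cube N) < +oo)%E.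
  rewrite -(integral_cst (cmeasure mu) mD c%:E).
  apply: (@le_lt_trans _ _ (\int[cmeasure mu]_(a in S)
     (\sum_(j <- enum 'I_n) (`|psi a * nu a 0 j|)%:E))%E); last first.
    rewrite ge0_integral_sum//.
    by elim: (enum _) => [|j s ih]; rewrite ?big_nil ?ltry// big_cons lte_add_pinfty.
  apply: (@le_trans _ _ (\int[cmeasure mu]_(a in S `&` cube N)
     (\sum_(j <- enum 'I_n) (`|psi a * nu a 0 j|)%:E))%E); last first.
    apply: ge0_subset_integral => //.
    - by apply: emeasurable_sum => j; exact: mg.
    - by move=> a _; apply: sume_ge0.
  apply: ge0_le_integral => //.
  - by move=> a _; rewrite lee_fin ltW.
  - apply: emeasurable_sum => j; apply: (measurable_funS mS) (mg j).
    exact: subIsetl.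
  - move=> a [Sa Na]; rewrite sumEFin lee_fin /=.
    have pa : 0 <= psi a by have /andP[] := i a.
    apply: (le_trans (hc a (cube_cbox Na))).
    under eq_bigr do rewrite normrM ger0_norm//.
    rewrite -mulr_sumr -[leLHS]mulr1 ler_wpM2l// big_enum/=.
    (* The number [1] is the sum of the squared coordinates of [nu a], and each square is at most
       the absolute value of the coordinate. *)
    rewrite -(normal_sq Sa) /dotv; apply: ler_sum => j _.
    by rewrite -expr2 -real_normK ?num_real// expr2 ler_piMr// normal_le1.
rewrite ltey; apply/eqP => h; move: cfin; rewrite h gt0_muley ?lte_fin//.
Qed.
End gauss_green.

(** * Lower bounds localised by cut-off functions *)

(** Explicit form of a right neighbourhood of [0], convenient for the rescaling of [r] in
    [near0_scale]. *)
Definition near0 {R : realType} (P : R -> Prop) :=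
  exists2 d : R, 0 < d & forall r, 0 < r < d -> P r.

Lemma near0_and {R : realType} (P Q : R -> Prop) :
  near0 P -> near0 Q -> near0 (fun r => P r /\ Q r).
Proof.
move=> [d d0 dP] [d' d'0 dQ]; exists (Num.min d d'); first by rewrite lt_min d0.
by move=> r; rewrite lt_min => /and3P[r0 rd rd']; split; [apply: dP|apply: dQ]; rewrite r0.
Qed.

Lemma near0_imp {R : realType} (P Q : R -> Prop) :
  (forall r, 0 < r -> P r -> Q r) -> near0 P -> near0 Q.
Proof. by move=> PQ [d d0 dP]; exists d => // r /[dup] /andP[r0 _] /dP; exact: PQ. Qed.

Lemma near0_scale {R : realType} (c : R) (P : R -> Prop) : 0 < c ->
  near0 P -> near0 (fun r => P (c * r)).
Proof.
move=> c0 [d d0 dP]; exists (d / c); first by rewrite divr_gt0.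
move=> r /andP[r0 rd]; apply: dP; rewrite mulr_gt0//=.
by rewrite mulrC -ltr_pdivlMr.
Qed.

Section localised_lower_bounds.
Context {R : realType} {n : nat} (mu : {outer_measure set 'rV[R]_n -> \bar R}).
Local Notation V := ('rV[R]_n).
Local Notation M := (cmeasure mu).
Let U := caratheodory_type mu.
Hypothesis halfspace : forall (i : 'I_n) t, mu.-caratheodory [set x : V | x 0 i <= t].
Hypothesis hull : forall E : set V, exists F : nat -> nat -> set V,
  [/\ forall k j, closed (F k j), E `<=` \bigcap_k \bigcup_j F k j &
      (mu (\bigcap_k \bigcup_j F k j) <= mu E)%E].
Variables (S : set U) (N : R).
Hypotheses (mS : measurable S) (Sfin : (mu (S `&` cube N) < +oo)%E).
Let D : set U := S `&` cube N.

Definition bounded_on_support (g : U -> R) := measurable_fun S g /\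
  exists2 C, 0 <= C & forall a, S a -> `|g a| <= C.

Let mcube : measurable (cube N : set U).
Proof. by rewrite cubeE; exact: open_box_measurable. Qed.

Let mD : measurable D. Proof. exact: measurableI. Qed.

Lemma C1_cara_measurable (X : set U) (w : V -> R) : measurable X -> C1 w -> measurable_fun X (w : U -> R).
Proof. by move=> mX C; apply: continuous_cara_measurable => //; exact: C1_continuous. Qed.

Lemma cutoff_integrable w g : cutoff N w -> bounded_on_support g ->
  M.-integrable S (EFin \o (fun a : U => w a * g a)).
Proof.
move=> [C i v] [mg [B B0 gB]].
apply: (integrable_bounded_support (C := B) mS mcube) => //.
- by rewrite setIC.
- by apply: measurable_funM => //; exact: C1_cara_measurable.
- move=> a Sa; rewrite normrM -[leRHS]mul1r ler_pM// ?gB//.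
  by rewrite ger0_norm; have := i a; lra.
- by move=> a _ Na; rewrite v// mul0r.
Qed.

Lemma bounded_integrable g : bounded_on_support g -> M.-integrable D (EFin \o g).
Proof.
move=> [mg [B B0 gB]]; apply: (integrable_bounded_support (C := B) mD mcube) => //.
- by apply: le_lt_trans Sfin; apply: le_outer_measure => x [].
- by apply: (measurable_funS mS) mg; exact: subIsetl.
- by move=> a [Sa _]; exact: gB.
- by move=> a [].
Qed.

Lemma cutoff_integral_local w g : cutoff N w ->
  \int[M]_(a in S) (w a * g a) = \int[M]_(a in D) (w a * g a).
Proof.
move=> [_ _ v]; rewrite /D Rintegral_mkcondr; apply: eq_Rintegral => a _.
by rewrite patchE; case: ifPn => //; rewrite notin_setE => na; rewrite v// mul0r.
Qed.

Lemma bounded_cutoff w g : cutoff N w -> bounded_on_support g ->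
  bounded_on_support (fun a => w a * g a).
Proof.
move=> [C i v] [mg [B B0 gB]]; split.
  by apply: measurable_funM => //; exact: C1_cara_measurable.
exists B => // a Sa; rewrite normrM -[leRHS]mul1r ler_pM// ?gB//.
by rewrite ger0_norm; have := i a; lra.
Qed.

Lemma bounded_sub f g : bounded_on_support f -> bounded_on_support g ->
  bounded_on_support (fun a => f a - g a).
Proof.
move=> [mf [B B0 fB]] [mg [C C0 gC]]; split; first exact: measurable_funB.
exists (B + C); first exact: addr_ge0.
by move=> a Sa; rewrite (le_trans (ler_normB _ _))// lerD ?fB ?gC.
Qed.

Lemma bounded_indic (E : set U) : measurable E -> bounded_on_support \1_E.
Proof.
move=> mE; split; first exact: measurable_indic.
exists 1 => // a _; rewrite indicE ger0_norm// lern1 leq_b1//.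
Qed.

Lemma bounded_support_cst c : bounded_on_support (cst c).
Proof. by split; [exact: measurable_cst|exists `|c|]. Qed.

Lemma cutoff_approx_Rintegral (E : set U) e : measurable E -> 0 < e ->
  exists2 w, cutoff N w & \int[M]_(a in D) `|w a - \1_E a| <= e.
Proof.
move=> mE e0.
have [w [cw]] := cutoff_approx halfspace hull mD Sfin (@subIsetr _ _ _) mE e0.
rewrite /L1dist => h; exists w => //; rewrite -lee_fin /Rintegral fineK//.
rewrite ge0_fin_numE; first by rewrite (le_lt_trans h)// ltry.
by apply: integral_ge0 => a _; rewrite lee_fin.
Qed.

Lemma Rintegral_close f g h C e : bounded_on_support f -> bounded_on_support g ->
  bounded_on_support h -> 0 <= C ->
  (forall a, D a -> `|f a - g a| <= C * h a) -> \int[M]_(a in D) h a <= e ->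
  `|\int[M]_(a in D) f a - \int[M]_(a in D) g a| <= C * e.
Proof.
move=> bf bg bh C0 fgh he.
have If := bounded_integrable bf; have Ig := bounded_integrable bg.
have Ih := bounded_integrable bh.
have Ifg : M.-integrable D (EFin \o (fun a => f a - g a)).
  by apply: bounded_integrable; exact: bounded_sub.
rewrite -RintegralB//; apply: le_trans (le_normr_Rintegral mD Ifg) _.
apply: (@le_trans _ _ (\int[M]_(a in D) (C * h a))); last first.
  by rewrite RintegralZl// ler_wpM2l.
apply: le_Rintegral => //; first exact: integrable_norm.
have [mh [B B0 hB]] := bh.
apply: bounded_integrable; split.
  by apply: measurable_funM => //; exact: measurable_cst.
by exists (C * B); [rewrite mulr_ge0|move=> a Sa; rewrite normrM ger0_norm// ler_wpM2l// hB].
Qed.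

Variable L : R -> (V -> R) -> R.
Hypothesis L_add : forall r w1 w2, 0 < r -> cutoff N w1 -> cutoff N w2 ->
  L r (fun x => w1 x + w2 x) = L r w1 + L r w2.

(** No limit of [L r] is assumed to exist. For (i), [L r w] is the normalised integral of [w] over a
    set outside [A]; (ii) also uses the opposite of such an integral. *)
Definition lower_bound (g : U -> R) := bounded_on_support g /\
  forall w e, cutoff N w -> 0 < e ->
    near0 (fun r => \int[M]_(a in S) (w a * g a) - e <= L r w).

Lemma eq_lower_bound g g' : (forall a, S a -> g a = g' a) ->
  lower_bound g -> lower_bound g'.
Proof.
move=> gg' [[mg [B B0 gB]] lg]; split.
  split; last by exists B => // a Sa; rewrite -gg'// gB.
  by apply: eq_measurable_fun mg => a; rewrite inE; exact: gg'.
move=> w e cw e0; have := lg w e cw e0; apply: near0_imp => r _.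
rewrite (_ : \int[M]_(a in S) (w a * g a) = \int[M]_(a in S) (w a * g' a))//.
by apply: eq_Rintegral => a; rewrite inE => Sa; rewrite gg'.
Qed.

(* Splitting [w] as [w chi + w (1 - chi)] with [chi] close to the indicator of
   [E] selects the first bound on [E] and the second one off [E]. *)
Lemma lower_bound_select g1 g2 (E : set U) : measurable E ->
  lower_bound g1 -> lower_bound g2 ->
  lower_bound (fun a => \1_E a * g1 a + (1 - \1_E a) * g2 a).
Proof.
move=> mE [b1 l1] [b2 l2].
have [m1 [C1' C10 g1C]] := b1; have [m2 [C2 C20 g2C]] := b2.
pose C := C1' + C2.
have C0 : 0 <= C by exact: addr_ge0.
have I01 a : 0 <= (\1_E a : R) <= 1 by rewrite indicE ler0n lern1 leq_b1.
pose g a := \1_E a * g1 a + (1 - \1_E a) * g2 a.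
have bg : bounded_on_support g.
  have [mi _] := bounded_indic mE.
  split; first apply: measurable_funD; try apply: measurable_funM => //.
    by apply: measurable_funB => //; exact: measurable_cst.
  exists C => // a Sa; have := I01 a; have := g1C a Sa; have := g2C a Sa.
  rewrite !ler_norml /g /C; move: (\1_E a : R) (g1 a) (g2 a) => t x y; nra.
split => // w e cw e0.
have e4 : 0 < e / 4 by rewrite divr_gt0.
(* The budget is [e / 4] for each of the two bounds and at most [e / 2] for replacing [\1_E] by
   [chi], which costs [C] times the [L^1] error. The summand [1] guards against [C = 0]. *)
have ec : 0 < e / (2 * (C + 1)) by rewrite divr_gt0// mulr_gt0// ltr_wpDl.
have [chi cchi hchi] := cutoff_approx_Rintegral mE ec.
have [Cchi ichi _] := cchi; have [C1m i1m] := cutoff_onem cchi.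
have cw1 : cutoff N (fun x => w x * chi x) by exact: cutoffM.
have cw2 : cutoff N (fun x => w x * (1 - chi x)) by exact: cutoffM.
have := near0_and (l1 _ _ cw1 e4) (l2 _ _ cw2 e4); apply: near0_imp => r r0 [h1 h2].
have wE : (fun x => w x * chi x + w x * (1 - chi x)) = w by apply/funext => x; ring.
rewrite -{2}wE L_add//; apply: le_trans (lerD h1 h2).
rewrite !cutoff_integral_local//.
set I1 := \int[M]_(a in D) (w a * chi a * g1 a).
set I2 := \int[M]_(a in D) (w a * (1 - chi a) * g2 a).
have -> : \int[M]_(a in D) (w a * g a) = \int[M]_(a in D) (w a * g a) by [].
have bw1 := bounded_cutoff cw1 b1; have bw2 := bounded_cutoff cw2 b2.
have I12 : I1 + I2 = \int[M]_(a in D) (w a * chi a * g1 a + w a * (1 - chi a) * g2 a).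
  by rewrite RintegralD//; exact: bounded_integrable.
have bsum : bounded_on_support (fun a => w a * chi a * g1 a + w a * (1 - chi a) * g2 a).
  have := bounded_sub bw1 (bounded_sub (bounded_support_cst 0) bw2).
  by under eq_fun do rewrite /cst/= sub0r opprK.
have bh : bounded_on_support (fun a => `|chi a - \1_E a|).
  split.
    apply: measurableT_comp => //; apply: measurable_funB; first exact: C1_cara_measurable.
    exact: measurable_indic.
  exists 1 => // a Sa; rewrite normr_id ler_norml.
  by have := I01 a; have := ichi a; lra.
have close : `|\int[M]_(a in D) (w a * g a) -
     \int[M]_(a in D) (w a * chi a * g1 a + w a * (1 - chi a) * g2 a)| <=
     C * (e / (2 * (C + 1))).
  apply: (Rintegral_close _ bsum bh C0 _ hchi); first exact: bounded_cutoff.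
  move=> a [Sa _].
  rewrite (_ : _ - _ = w a * ((\1_E a - chi a) * (g1 a - g2 a))); last by rewrite /g; ring.
  have [_ iw _] := cw; have /andP[w0 w1] := iw a.
  rewrite normrM (ger0_norm w0) normrM distrC mulrC [leRHS]mulrC -mulrA ler_wpM2l//.
  have h3 : `|g1 a - g2 a| <= C.
    by rewrite (le_trans (ler_normB _ _))// lerD ?g1C ?g2C.
  by rewrite -[leRHS]mulr1 ler_pM.
have Ce : C * (e / (2 * (C + 1))) <= e / 2.
  rewrite (_ : C * _ = (e / 2) * (C / (C + 1))); last first.
    by field; rewrite gt_eqF// ltr_wpDl.
  rewrite ler_piMr ?divr_ge0// ?(ltW e0)// ler_pdivrMr ?ltr_wpDl// mul1r lerDl//.
move: close; rewrite -I12 ler_norml => /andP[_ c1]; clear I12; move: c1 Ce.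
by move: (\int[M]_(a in D) (w a * g a)) I1 I2 (C * _) => x y z t; lra.
Qed.

Lemma lower_bound_max g1 g2 : lower_bound g1 -> lower_bound g2 ->
  lower_bound (fun a => Num.max (g1 a) (g2 a)).
Proof.
move=> l1 l2; have [[m1 _] _] := l1; have [[m2 _] _] := l2.
pose E : set U := S `&` [set a | 0 < g1 a - g2 a].
have mE : measurable E by apply: measurable_ray => //; exact: measurable_funB.
apply: eq_lower_bound (lower_bound_select mE l1 l2) => a Sa.
rewrite indicE; have [h|h] := ltP (g2 a) (g1 a).
  rewrite mem_set; last by split => //=; rewrite subr_gt0.
  by rewrite mul1r subrr mul0r addr0.
rewrite memNset; last by move=> [_ /=]; rewrite subr_gt0 ltNge h.
by rewrite mul0r add0r subr0 mul1r.
Qed.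

Lemma lower_bound_bigmax (I : eqType) (s : seq I) (g0 : U -> R) (g : I -> U -> R) :
  lower_bound g0 -> (forall i, i \in s -> lower_bound (g i)) ->
  lower_bound (fun a => \big[Num.max/g0 a]_(i <- s) g i a).
Proof.
move=> l0; elim: s => [|i s ih] ls.
  by apply: eq_lower_bound l0 => a _; rewrite big_nil.
apply: (@eq_lower_bound (fun a => Num.max (g i a) (\big[Num.max/g0 a]_(j <- s) g j a))).
  by move=> a _; rewrite big_cons.
apply: lower_bound_max; first by apply: ls; rewrite mem_head.
by apply: ih => j js; apply: ls; rewrite inE js orbT.
Qed.

(* Testing with a single [w] close to [1] on the cube. *)
Lemma lower_bound_total g e : lower_bound g -> 0 < e ->
  exists2 w, cutoff N w & near0 (fun r => \int[M]_(a in D) g a - e <= L r w).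
Proof.
move=> [bg lg] e0; have [mg [C C0 gC]] := bg.
have e2 : 0 < e / 2 by rewrite divr_gt0.
have ec : 0 < e / (2 * (C + 1)) by rewrite divr_gt0// mulr_gt0// ltr_wpDl.
have [w cw hw] := cutoff_approx_Rintegral measurableT ec.
exists w => //; have := lg w _ cw e2; apply: near0_imp => r r0; apply: le_trans.
rewrite cutoff_integral_local//.
have bh : bounded_on_support (fun a => `|w a - \1_[set: U] a|).
  have [Cw iw _] := cw.
  split.
    apply: measurableT_comp => //; apply: measurable_funB; first exact: C1_cara_measurable.
    exact: measurable_indic.
  exists 1 => // a Sa; rewrite normr_id ler_norml indicE in_setT.
  by have := iw a; rewrite /=; lra.
have close : `|\int[M]_(a in D) g a - \int[M]_(a in D) (w a * g a)| <=
     C * (e / (2 * (C + 1))).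
  apply: (Rintegral_close bg _ bh C0 _ hw); first exact: bounded_cutoff.
  move=> a [Sa _]; rewrite indicE in_setT.
  rewrite (_ : _ - _ = (1 - w a) * g a); last by ring.
  by rewrite normrM distrC mulrC ler_wpM2r// gC.
have Ce : C * (e / (2 * (C + 1))) <= e / 2.
  rewrite (_ : C * _ = (e / 2) * (C / (C + 1))); last first.
    by field; rewrite gt_eqF// ltr_wpDl.
  rewrite ler_piMr ?divr_ge0// ?(ltW e0)// ler_pdivrMr ?ltr_wpDl// mul1r lerDl//.
move: close; rewrite ler_norml.
by move: (\int[M]_(a in D) (w a * g a)) (\int[M]_(a in D) g a) (C * _) Ce => *; lra.
Qed.
End localised_lower_bounds.

(** * Support functions, nets and circumscribed balls *)

Section support.
Context {R : realType} {n : nat}.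
Local Notation V := ('rV[R]_n).
Implicit Types x y z u v q : V.

Lemma dotvDl x y z : dotv (x + y) z = dotv x z + dotv y z.
Proof. by rewrite /dotv -big_split; apply: eq_bigr => i _; rewrite mxE mulrDl. Qed.

Lemma dotvBl x y z : dotv (x - y) z = dotv x z - dotv y z.
Proof. by rewrite /dotv -sumrB; apply: eq_bigr => i _; rewrite !mxE mulrBl. Qed.

Lemma dotvZl r x z : dotv (r *: x) z = r * dotv x z.
Proof. by rewrite /dotv mulr_sumr; apply: eq_bigr => i _; rewrite mxE mulrA. Qed.

Lemma dotvC x y : dotv x y = dotv y x.
Proof. by apply: eq_bigr => i _; rewrite mulrC. Qed.

Lemma dotv0l x : dotv 0 x = 0.
Proof. by rewrite /dotv big1// => i _; rewrite mxE mul0r. Qed.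

Lemma eucl_sqr x : eucl x ^+ 2 = dotv x x.
Proof. by rewrite /eucl sqr_sqrtr// dotvv_ge0. Qed.

Lemma euclZ r x : eucl (r *: x) = `|r| * eucl x.
Proof.
by rewrite /eucl dotvZl dotvC dotvZl mulrA -expr2 sqrtrM ?sqr_ge0// sqrtr_sqr.
Qed.

Lemma eucl_lt x (r : R) : 0 < r -> dotv x x < r ^+ 2 -> eucl x < r.
Proof. by move=> r0; rewrite -eucl_sqr ltr_pXn2r// ?nnegrE ?eucl_ge0// ltW. Qed.

Lemma dotv_le_coord x y (d B : R) :
  (forall i, `|x 0 i| <= d) -> (forall i, `|y 0 i| <= B) -> `|dotv x y| <= n%:R * (d * B).
Proof.
move=> xd yB; apply: le_trans (ler_norm_sum _ _ _) _.
apply: (@le_trans _ _ (\sum_(i < n) d * B)); last by rewrite sumr_const card_ord mulr_natl.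
by apply: ler_sum => i _; rewrite normrM ler_pM.
Qed.

Lemma compact_net (K : set V) (d : R) : compact K -> 0 < d -> exists s : seq V,
  (forall q, q \in s -> K q) /\
  forall x, K x -> exists2 q, q \in s & forall i, `|x 0 i - q 0 i| <= d.
Proof.
move=> cK d0; have : cover_compact K by rewrite -compact_cover.
move=> /(_ V K (fun q => (ball q d)^°)) [q Kq||D DK KD].
- exact: open_interior.
- by move=> x Kx; exists x => //; exact: nbhsx_ballx.
exists (finmap.enum_fset D); split.
  by move=> q qD; have := DK q qD; rewrite inE.
move=> x /KD[q /= qD /interior_subset[_ xq]]; exists q => // i.
by rewrite distrC; apply: ltW; exact: xq.
Qed.

Lemma eucl_continuous : continuous (@eucl R n).
Proof.
move=> x; have := @dist_continuous R n 0 x; rewrite (_ : (fun y => _) = @eucl R n)//.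
by apply/funext => y; rewrite subr0.
Qed.

Lemma compact_eucl_bound (K : set V) : compact K ->
  exists2 c, 0 < c & forall x, K x -> eucl x <= c.
Proof.
move=> cK; have [->|/set0P K0] := eqVneq K set0; first by exists 1.
have [c Kc cmax] := EVT_max_rV K0 cK (continuous_subspaceT eucl_continuous).
exists (eucl c + 1); first by rewrite ltr_wpDl// eucl_ge0.
by move=> x Kx; rewrite (le_trans (cmax x _)) ?inE// lerDl.
Qed.

Lemma sphere_compact : compact [set u : V | eucl u = 1].
Proof.
have cl : closed [set u : V | eucl u = 1].
  rewrite (_ : [set _ | _] = @eucl R n @^-1` [set 1])//.
  by apply: preimage_closed => [x _|]; [exact: eucl_continuous|exact: closed_eq].
apply: (subclosed_compact cl (B := cbox 1)).
  rewrite (_ : (cbox 1 : set V) = [set x : V | forall i, `[- 1, 1]%classic (x ord0 i)]).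
    by apply: (@rV_compact R n (fun=> `[- 1, 1]%classic)) => j; exact: segment_compact.
  by apply/seteqP; split => x h j; have := h j; rewrite /= ?in_itv/= ?mxE.
by move=> u /= u1; apply/cboxP => i; rewrite -u1; exact: ler_coord_eucl.
Qed.

Lemma dotv_close u v d : eucl v = 1 -> (forall i, `|v 0 i - u 0 i| <= d) ->
  1 - n%:R * d <= dotv u v.
Proof.
move=> v1 uv; have vv : dotv v v = 1 by rewrite -eucl_sqr v1 expr1n.
have -> : dotv u v = 1 - dotv (v - u) v.
  by rewrite dotvBl vv; ring.
rewrite lerD2l lerN2 (le_trans (ler_norm _))// -[d]mulr1.
apply: dotv_le_coord => i; first by rewrite !mxE; exact: uv.
by rewrite -v1 ler_coord_eucl.
Qed.

Section support_function.
Variables (K : set V) (c : R).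
Hypotheses (K0 : K 0) (c0 : 0 < c) (Kc : forall x, K x -> eucl x <= c).

Definition hsupp v : R := fine (supp_fun K v).

Let coord_le x : K x -> forall i, `|x 0 i| <= c.
Proof. by move=> Kx i; exact: le_trans (ler_coord_eucl _ _) (Kc Kx). Qed.

Lemma supp_funE v : supp_fun K v = (hsupp v)%:E.
Proof.
rewrite /hsupp fineK// fin_numElt; apply/andP; split.
  apply: (@lt_le_trans _ _ (dotv 0 v)%:E); first exact: ltNyr.
  by apply: ereal_sup_ubound; exists 0.
apply: (@le_lt_trans _ _ (n%:R * (c * \sum_i `|v 0 i|))%:E); last exact: ltry.
apply: ge_ereal_sup => _ [x Kx <-]; rewrite lee_fin (le_trans (ler_norm _))//.
apply: dotv_le_coord; first exact: coord_le.
by move=> i; rewrite (bigD1 i)//= lerDl sumr_ge0.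
Qed.

Lemma hsupp_ge x v : K x -> dotv x v <= hsupp v.
Proof.
by move=> Kx; rewrite -lee_fin -supp_funE; apply: ereal_sup_ubound; exists x.
Qed.

Lemma hsupp_le v t : (forall x, K x -> dotv x v <= t) -> hsupp v <= t.
Proof.
move=> h; rewrite -lee_fin -supp_funE; apply: ge_ereal_sup => _ [x Kx <-].
by rewrite lee_fin h.
Qed.

Lemma hsupp_ge0 v : 0 <= hsupp v.
Proof. by rewrite -(dotv0l v); exact: hsupp_ge. Qed.

Lemma hsupp_bound v : eucl v = 1 -> hsupp v <= n%:R * c.
Proof.
move=> v1; apply: hsupp_le => x Kx; rewrite (le_trans (ler_norm _))//.
rewrite -[c]mulr1; apply: dotv_le_coord; first exact: coord_le.
by move=> i; rewrite -v1 ler_coord_eucl.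
Qed.

(* The large ball of centre [- k u] lies in the half-space [<., u> <= h + e], so
   its support function at [u] exceeds that of [K] by only [e]. *)
Lemma circumscribed_ball u e : eucl u = 1 -> 0 < e ->
  let k := c ^+ 2 / e in
  forall x, K x -> eucl (x + k *: u) < hsupp u + e + k.
Proof.
move=> u1 e0 k x Kx; have k0 : 0 < k by rewrite divr_gt0// exprn_gt0.
have h0 := hsupp_ge0 u; apply: eucl_lt; first by lra.
have uu : dotv u u = 1 by rewrite -eucl_sqr u1 expr1n.
have -> : dotv (x + k *: u) (x + k *: u) = dotv x x + 2 * k * dotv x u + k ^+ 2.
  by rewrite !dotvDl !dotvZl !(dotvC _ (x + k *: u)) !dotvDl !dotvZl uu (dotvC u x); ring.
have xx : dotv x x <= c ^+ 2.
  by rewrite -eucl_sqr ler_pXn2r// ?nnegrE ?eucl_ge0 ?Kc// ltW.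
(* This is the origin of [k]. The squared norm is at most [c^2 + 2 k h + k^2], while [(h + e + k)^2]
   is at least [k^2 + 2 k h + 2 k e], and [2 k e = 2 c^2] exceeds [c^2]. *)
have ke : k * e = c ^+ 2 by rewrite /k divfK// gt_eqF.
have c2 : 0 < c ^+ 2 by rewrite exprn_gt0.
have := hsupp_ge u Kx; move: (hsupp u) (dotv x u) (dotv x x) h0 xx => h d xx' h0 xx dh.
have : k * d <= k * h by rewrite ler_wpM2l// ltW.
by move: ke c2; rewrite !expr2; nra.
Qed.

Lemma hsupp_close u v d : (forall i, `|v 0 i - u 0 i| <= d) ->
  hsupp u <= hsupp v + n%:R * (c * d).
Proof.
move=> uv; apply: hsupp_le => x Kx.
have -> : dotv x u = dotv x v - dotv x (v - u).
  by rewrite !(dotvC x) dotvBl; ring.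
apply: lerD; first exact: hsupp_ge.
rewrite (le_trans (ler_norm _))// normrN.
by apply: dotv_le_coord => [|i]; [exact: coord_le|rewrite !mxE; exact: uv].
Qed.

Lemma circumscribed_balls e : 0 < e -> exists s : seq (V * R),
  (forall b, b \in s -> 0 < b.2 /\ forall x, K x -> eucl (x - b.1) < b.2) /\
  forall v, eucl v = 1 -> exists2 b, b \in s & b.2 + dotv b.1 v <= hsupp v + 2 * e.
Proof.
move=> e0; pose k := c ^+ 2 / e; have k0 : 0 < k by rewrite divr_gt0// exprn_gt0.
(* Passing from [v] to a net point [u] costs [n c d] in the support function and [n k d] in the term
   [k <u, v>]; this [d] keeps the sum below [e]. *)
pose d := e / (n%:R * (c + k) + 1).
have m0 : 0 < n%:R * (c + k) + 1 by rewrite ltr_wpDl// mulr_ge0// ltW// addr_gt0.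
have d0 : 0 < d by rewrite divr_gt0.
have [s [sK sn]] := compact_net sphere_compact d0.
exists [seq (- (k *: u), hsupp u + e + k) | u <- s]; split.
  move=> _ /mapP[u /sK/= u1 ->] /=; split; first by have := hsupp_ge0 u; lra.
  by move=> x Kx; rewrite opprK; exact: circumscribed_ball.
move=> v v1; have [u us uv] := sn v v1; have u1 := sK u us.
exists (- (k *: u), hsupp u + e + k); first by apply/mapP; exists u.
rewrite /= -scaleNr dotvZl.
have h1 := dotv_close v1 uv; have h2 := hsupp_close uv.
have h3 : n%:R * (c + k) * d <= e.
  by rewrite /d mulrA ler_pdivrMr// mulrC ler_pM2l// lerDl.
have h4 : k * (1 - n%:R * d) <= k * dotv u v by rewrite ler_wpM2l// ltW.
by move: (hsupp u) (hsupp v) (dotv u v) h1 h2 h3 h4 => *; nra.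
Qed.

End support_function.

(** The net of the sphere is shrunk by the factor [1 - d] because [shell] is made of open balls,
    which reach only vectors of norm strictly below their radius. *)
Lemma direction_net e : 0 < e -> exists s : seq V,
  (forall q, q \in s -> eucl q < 1) /\
  forall v, eucl v = 1 -> exists2 q, q \in s & 1 - e <= dotv q v.
Proof.
move=> e0; pose d := Num.min (1 / 2) (e / (n%:R + 1)).
have n1 : 0 < n%:R + 1 :> R by rewrite ltr_wpDl.
have d0 : 0 < d by rewrite lt_min; apply/andP; split; [lra|rewrite divr_gt0].
have d1 : d <= 1 / 2 by rewrite ge_min lexx.
have de : (n%:R + 1) * d <= e.
  by rewrite mulrC -ler_pdivlMr// ge_min lexx orbT.
have [s [sK sn]] := compact_net sphere_compact d0.
exists [seq (1 - d) *: u | u <- s]; split.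
  by move=> _ /mapP[u /sK/= u1 ->]; rewrite euclZ u1 mulr1 ger0_norm; lra.
move=> v v1; have [u us uv] := sn v v1.
exists ((1 - d) *: u); first by apply/mapP; exists u.
rewrite dotvZl; have h1 := dotv_close v1 uv.
have n0 : 0 <= n%:R :> R by [].
have : (1 - d) * (1 - n%:R * d) <= (1 - d) * dotv u v by rewrite ler_wpM2l//; lra.
by move: (dotv u v) h1 => t h1; nra.
Qed.
End support.

(** * The lower bound *)

Section lower.
Context {R : realType} {n : nat} (mu : {outer_measure set 'rV[R]_n -> \bar R}).
Local Notation V := ('rV[R]_n).
Local Notation M := (cmeasure mu).
Local Notation lam := (cmeasure (@leb_outer R n)).
Local Notation Ul := (caratheodory_type (@leb_outer R n)).
Let U := caratheodory_type mu.
Hypothesis halfspace : forall (i : 'I_n) t, mu.-caratheodory [set x : V | x 0 i <= t].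
Hypothesis hull : forall E : set V, exists F : nat -> nat -> set V,
  [/\ forall k j, closed (F k j), E `<=` \bigcap_k \bigcup_j F k j &
      (mu (\bigcap_k \bigcup_j F k j) <= mu E)%E].
Variables (A : set V) (S : set U) (nu : V -> V).
Hypotheses (n0 : (0 < n)%N) (mA : measurable (A : set Ul)).
Hypothesis nu1 : forall a, S a -> eucl (nu a) = 1.
Hypothesis mnu : forall i t, mu.-caratheodory (S `&` [set a | t < nu a 0 i]).
Hypothesis GG : forall phi, Cc1 phi -> @s_int R V (@leb_outer R n) A (divg phi) =
  @s_int R V mu S (fun a => dotv (phi a) (nu a)).

Let mS : measurable S := support_measurable n0 nu1 mnu.
Let Sfin N : 0 < N -> (mu (S `&` cube N) < +oo)%E.
Proof. exact: (support_locally_finite halfspace n0 mA nu1 mnu GG). Qed.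

Let mcube N : measurable (cube N : set U).
Proof. by rewrite cubeE; exact: open_box_measurable. Qed.

Definition mean (W : R -> set V) (r : R) (w : V -> R) : R :=
  r^-1 * \int[lam]_(x in W r) w x.

Lemma mean_add N W r w1 w2 : 0 < r -> measurable (W r : set Ul) ->
  cutoff N w1 -> cutoff N w2 ->
  mean W r (fun x => w1 x + w2 x) = mean W r w1 + mean W r w2.
Proof.
move=> r0 mW c1 c2; rewrite /mean RintegralD ?mulrDr//;
  by [exact: (cutoff_leb_integrable mW c1)|exact: (cutoff_leb_integrable mW c2)].
Qed.

Lemma leb_integral_subset N (X Y : set Ul) w : measurable X -> measurable Y ->
  X `<=` Y -> cutoff N w -> \int[lam]_(x in X) w x <= \int[lam]_(x in Y) w x.
Proof.
move=> mX mY XY cw; have iX := cutoff_leb_integrable mX cw.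
have iY := cutoff_leb_integrable mY cw.
apply: fine_le; [exact: integrable_fin_num iX|exact: integrable_fin_num iY|].
have [C i _] := cw; apply: ge0_subset_integral => //.
- by apply/measurable_EFinP; apply: leb_measurable_continuous => //; exact: C1_continuous.
- by move=> x _; rewrite lee_fin; have /andP[] := i x.
Qed.

Lemma leb_integral_setU N (X Y : set Ul) w : measurable X -> measurable Y ->
  [disjoint X & Y] -> cutoff N w ->
  \int[lam]_(x in X `|` Y) w x = \int[lam]_(x in X) w x + \int[lam]_(x in Y) w x.
Proof.
move=> mX mY XY cw; rewrite Rintegral_setU//.
by apply: cutoff_leb_integrable cw; exact: measurableU.
Qed.

Lemma leb_integral_ge0 N (X : set Ul) w : cutoff N w -> 0 <= \int[lam]_(x in X) w x.
Proof. by move=> [_ i _]; apply: Rintegral_ge0 => x _; have /andP[] := i x. Qed.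

Lemma leb_integral_le_measure N (X : set Ul) w : measurable X -> cutoff N w ->
  ((\int[lam]_(x in X) w x)%:E <= lam X)%E.
Proof.
move=> mX cw; have iX := cutoff_leb_integrable mX cw.
rewrite /Rintegral fineK; last exact: integrable_fin_num iX.
rewrite -[leRHS]mul1e -integral_cst//.
have [C i _] := cw; apply: ge0_le_integral => //.
- by move=> x _; rewrite lee_fin; have /andP[] := i x.
- by case/integrableP : iX.
- by move=> x _; rewrite lee_fin; have /andP[] := i x.
Qed.

Lemma dot_normal_bounded q : @bounded_on_support R n mu S (fun a => dotv q (nu a)).
Proof.
split; first exact: dot_normal_measurable.
by exists (\sum_i `|q 0 i|); [exact: sumr_ge0|move=> a; exact: dot_normal_le].
Qed.

Lemma lower_bound_translate N W q : 0 < N ->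
  (forall r, 0 < r -> measurable (W r : set Ul)) ->
  (forall r, 0 < r -> [disjoint A & W r]) ->
  (forall r, 0 < r -> shiftset A (r *: q) `<=` A `|` W r) ->
  @lower_bound R n mu S N (mean W) (fun a => dotv q (nu a)).
Proof.
move=> N0 mW AW sub; split; first exact: dot_normal_bounded.
move=> w e cw e0.
have := translation_flux halfspace n0 mA nu1 mnu GG N0 cw q e0.
apply: near0_imp => r r0; rewrite ler_norml => /andP[h _].
have hW : r^-1 * (\int[lam]_(x in shiftset A (r *: q)) w x - \int[lam]_(x in A) w x) <=
    mean W r w.
  rewrite /mean ler_pM2l ?invr_gt0// lerBlDl.
  rewrite -(leb_integral_setU mA (mW r r0) (AW r r0) cw).
  apply: (leb_integral_subset _ _ (sub r r0) cw).
    exact: measurable_shift.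
  by apply: measurableU => //; exact: mW.
move: h hW; move: (r^-1 * _) (\int[M]_(a in S) _) (mean _ _ _) => x y z; lra.
Qed.

(** This accounts for the point [0] adjoined to [Q]: cut-offs have nonnegative integrals. *)
Lemma lower_bound_0 N W : @lower_bound R n mu S N (mean W) (cst 0).
Proof.
split.
  by split; [exact: measurable_cst|exists 0 => // a _; rewrite normr0].
move=> w e cw e0; exists 1 => // r /andP[r0 _].
rewrite (_ : \int[M]_(a in S) _ = 0); last first.
  rewrite /Rintegral integral0_eq// => a _; by rewrite /cst mulr0.
apply: (@le_trans _ _ 0); first lra.
by rewrite /mean mulr_ge0 ?invr_ge0 ?(ltW r0)//; exact: leb_integral_ge0 cw.
Qed.

Definition max_dot (s : seq V) (a : V) : R := \big[Num.max/0]_(q <- s) dotv q (nu a).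

Lemma lower_bound_max_dot N W s : 0 < N ->
  (forall r, 0 < r -> measurable (W r : set Ul)) ->
  (forall r, 0 < r -> [disjoint A & W r]) ->
  (forall r q, 0 < r -> q \in s -> shiftset A (r *: q) `<=` A `|` W r) ->
  @lower_bound R n mu S N (mean W) (max_dot s).
Proof.
move=> N0 mW AW sub.
apply: (lower_bound_bigmax halfspace hull mS (Sfin N0)).
- by move=> r w1 w2 r0; apply: mean_add => //; exact: mW.
- exact: lower_bound_0.
- by move=> q qs; apply: lower_bound_translate => // r r0; exact: sub.
Qed.

Lemma max_dot_ge s a q : q \in s -> dotv q (nu a) <= max_dot s a.
Proof.
rewrite /max_dot; elim: s => // q' s ih; rewrite inE big_cons le_max => /predU1P[->|/ih ->].
  by rewrite lexx.
by rewrite orbT.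
Qed.

Lemma max_dot_le s a t : 0 <= t -> (forall q, q \in s -> dotv q (nu a) <= t) ->
  max_dot s a <= t.
Proof.
move=> t0; rewrite /max_dot; elim: s => [|q s ih] h; first by rewrite big_nil.
rewrite big_cons ge_max h ?mem_head//= ih// => q' q's.
by apply: h; rewrite inE q's orbT.
Qed.

Lemma max_dot_measurable s : measurable_fun S (max_dot s : U -> R).
Proof.
rewrite /max_dot; elim: s => [|q s ih].
  by under eq_fun do rewrite big_nil; exact: measurable_cst.
under eq_fun do rewrite big_cons.
by apply: measurable_maxr => //; exact: dot_normal_measurable.
Qed.

Variable Q : set V.
Hypothesis cQ : compact Q.
Local Notation K := (Q `|` [set 0]).

Let K0 : K 0. Proof. by right. Qed.
Let cK : compact K. Proof. by apply: compactU => //; exact: compact_set1. Qed.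

Definition normal_supp (a : V) : R := hsupp K (nu a).

Let Kbound : exists c, 0 < c /\ forall x, K x -> eucl x <= c.
Proof. by have [c c0 h] := compact_eucl_bound cK; exists c. Qed.

Lemma normal_suppE a : supp_fun K (nu a) = (normal_supp a)%:E.
Proof. by have [c [c0 Kc]] := Kbound; exact: (supp_funE K0 Kc). Qed.

Lemma normal_supp_ge0 a : 0 <= normal_supp a.
Proof. by have [c [c0 Kc]] := Kbound; exact: (hsupp_ge0 K0 Kc). Qed.

Lemma normal_supp_net e : 0 < e -> exists s : seq V, (forall q, q \in s -> K q) /\
  forall a, S a -> max_dot s a <= normal_supp a <= max_dot s a + e.
Proof.
move=> e0; have [c [c0 Kc]] := Kbound.
have d0 : 0 < e / (n%:R + 1) by rewrite divr_gt0// ltr_wpDl.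
have [s [sK sn]] := compact_net cK d0; exists s; split => // a Sa; apply/andP; split.
  apply: max_dot_le; first exact: normal_supp_ge0.
  by move=> q /sK Kq; exact: (hsupp_ge K0 Kc).
apply: (hsupp_le K0 Kc) => x /sn[q qs xq].
rewrite -[x](subrK q) dotvDl addrC lerD ?max_dot_ge//.
rewrite (le_trans (ler_norm _))//.
apply: (@le_trans _ _ (n%:R * (e / (n%:R + 1) * 1))).
  apply: dotv_le_coord => i; first by rewrite !mxE; exact: xq.
  exact: (normal_le1 nu1 i Sa).
rewrite mulr1 mulrA ler_pdivrMr ?ltr_wpDl// mulrC ler_pM2l// lerDl//.
Qed.

Let invr_gt0_nat (k : nat) : 0 < k.+1%:R^-1 :> R.
Proof. by rewrite invr_gt0. Qed.

(** On [S] it is the pointwise limit of the maxima [max_dot] over finer and finer nets. *)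
Lemma normal_supp_measurable : measurable_fun S (normal_supp : U -> R).
Proof.
have /choice[s Hs] k := normal_supp_net (invr_gt0_nat k).
apply: (measurable_fun_cvg (fun k => max_dot_measurable (s k))) => a Sa.
apply: (@squeeze_cvgr _ _ _ _ (fun k : nat => normal_supp a - k.+1%:R^-1) (fun _ => normal_supp a)).
- by apply: nearW => k; have [_ /(_ a Sa)/andP[h1 h2]] := Hs k; rewrite h1 lerBlDr h2.
- rewrite -[X in _ --> X]subr0; apply: cvgB; [exact: cvg_cst|exact: cvg_harmonic].
- exact: cvg_cst.
Qed.

Lemma normal_supp_bounded : @bounded_on_support R n mu S normal_supp.
Proof.
have [c [c0 Kc]] := Kbound.
split; first exact: normal_supp_measurable.
exists (n%:R * c); first by rewrite mulr_ge0// ltW.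
move=> a Sa; rewrite ger0_norm ?normal_supp_ge0//.
by apply: (hsupp_bound K0 Kc); exact: nu1.
Qed.

Lemma aniso_integral :
  @lc_int R V mu S (fun a => supp_fun K (nu a)) = (\int[M]_(a in S) (normal_supp a)%:E)%E.
Proof.
under [X in lc_int _ _ X]eq_fun do rewrite normal_suppE.
apply: (@lc_intE _ _ mu) => //; first exact: normal_supp_measurable.
by move=> a _; exact: normal_supp_ge0.
Qed.

(** Infinite volume is a separate case because [fine] sends [+oo] to [0]. *)
Lemma lower_minkowski_local N e : 0 < N -> 0 < e ->
  near0 (fun r => (\int[M]_(a in S `&` cube N) (normal_supp a)) - e <=
    r^-1 * fine (leb_outer (Defs.msum A (dil r Q) `\` A)) \/
    leb_outer (Defs.msum A (dil r Q) `\` A) = +oo%E).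
Proof.
move=> N0 e0.
have fin : mu (S `&` cube N) \is a fin_num.
  by rewrite ge0_fin_numE ?outer_measure_ge0//; exact: Sfin.
pose m := fine (mu (S `&` cube N)).
have m0 : 0 <= m by rewrite fine_ge0// outer_measure_ge0.
have e2 : 0 < e / 2 by rewrite divr_gt0.
(* Integrated over a set of measure [m], this net error stays below [e / 2]; the other half is spent
   in [lower_bound_total]. *)
have d0 : 0 < e / (2 * (m + 1)) by rewrite divr_gt0// mulr_gt0// ltr_wpDl.
have [s [sK sn]] := normal_supp_net d0.
(* Measurability of [A + r Q] is not at hand, so a finite union of translates stands in for it. *)
pose W r : set V := (\big[setU/set0]_(q <- s) shiftset A (r *: q)) `\` A.
have mW r : measurable (W r : set Ul).
  apply: measurableD => //; apply: bigsetU_measurable => q _.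
  exact: measurable_shift.
have mD : measurable (S `&` cube N : set U) by exact: measurableI.
have lb : @lower_bound R n mu S N (mean W) (max_dot s).
  apply: lower_bound_max_dot => //.
  - by move=> r r0; rewrite /W; apply/disj_setPS => x [Ax [_]].
  - move=> r q r0 qs x sx; have [Ax|nAx] := pselect (A x); [by left|right].
    split => //; rewrite -bigcup_seq; exists q => //.
have bm : @bounded_on_support R n mu S (max_dot s) by case: lb.
have [w cw] := lower_bound_total halfspace hull mS (Sfin N0) lb e2.
apply: near0_imp => r r0 h.
have [->|Xoo] := eqVneq (leb_outer (Defs.msum A (dil r Q) `\` A)) +oo%E; [by right|left].
have Xfin : leb_outer (Defs.msum A (dil r Q) `\` A) \is a fin_num.
  by rewrite ge0_fin_numE ?leb_outer_ge0// ltey.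
have WX : (lam (W r) <= leb_outer (Defs.msum A (dil r Q) `\` A))%E.
  apply: le_leb_outer => x [+ nAx]; rewrite -bigcup_seq => -[q /= /sK Kq Aq].
  split => //; case: Kq => [Qq|q0].
    by exists (x - r *: q) => //; exists (r *: q); [exists q|rewrite subrK].
  by move: Aq; rewrite /shiftset/= q0 scaler0 subr0.
have wX : \int[lam]_(x in W r) w x <= fine (leb_outer (Defs.msum A (dil r Q) `\` A)).
  rewrite -lee_fin [X in (_ <= X)%E]fineK//.
  exact: (le_trans (leb_integral_le_measure (mW r) cw) WX).
have h1 : mean W r w <= r^-1 * fine (leb_outer (Defs.msum A (dil r Q) `\` A)).
  by rewrite /mean ler_pM2l ?invr_gt0.
apply: le_trans h1; apply: le_trans h.
have : \int[M]_(a in S `&` cube N) (normal_supp a) <=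
    \int[M]_(a in S `&` cube N) (max_dot s a + e / (2 * (m + 1))).
  apply: le_Rintegral => //.
  - by apply: (bounded_integrable halfspace mS (Sfin N0)); exact: normal_supp_bounded.
  - apply: (bounded_integrable halfspace mS (Sfin N0)).
    have := bounded_sub bm (@bounded_support_cst R n mu S (- (e / (2 * (m + 1))))).
    by under eq_fun do rewrite /cst/= opprK.
  - by move=> a [Sa _]; have /andP[] := sn a Sa.
rewrite RintegralD//; last 2 first.
- exact: (bounded_integrable halfspace mS (Sfin N0)).
- by apply: (bounded_integrable halfspace mS (Sfin N0)); exact: (@bounded_support_cst R n mu S _).
rewrite Rintegral_cst//= -/m.
have : e / (2 * (m + 1)) * m <= e / 2.
  rewrite (_ : _ * m = e / 2 * (m / (m + 1))); last by field; rewrite gt_eqF// ltr_wpDl.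
  by rewrite ler_piMr ?(ltW e2)// ler_pdivrMr ?ltr_wpDl// mul1r lerDl.
by move: (\int[M]_(a in _) _) (\int[M]_(a in _) _) (_ * m) => x y z; lra.
Qed.

(** Finiteness of the surface integral is so far known only on cubes, so the bound is proved on each
    cube and passed to the limit by monotone exhaustion. *)
Lemma lower_minkowski :
  (@lc_int R V mu S (fun a => supp_fun K (nu a)) <= liminf0 (mink_quot Q A))%E.
Proof.
rewrite aniso_integral.
have L : (\int[M]_(a in S `&` cube k.+1%:R) (normal_supp a)%:E)%E @[k --> \oo] -->
    (\int[M]_(a in \bigcup_k (S `&` cube k.+1%:R)) (normal_supp a)%:E)%E.
  apply: ge0_nondecreasing_set_cvg_integral.
  - move=> k l kl; apply/subsetPset; apply: setIS; apply: cube_sub.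
    by rewrite ler_nat ltnS.
  - by move=> k; exact: measurableI.
  - by move=> k; apply/measurable_EFinP; apply: (measurable_funS mS) normal_supp_measurable; exact: subIsetl.
  - by move=> k a _; rewrite lee_fin normal_supp_ge0.
have -> : S = \bigcup_k (S `&` cube k.+1%:R) :> set V.
  apply/seteqP; split => [a Sa|a [k _ []//]].
  have [k ak] := cubeP a; exists k => //; split => //; apply: cube_sub ak.
  by rewrite ler_nat.
rewrite -(cvg_lim (@ereal_hausdorff R) L); apply: lime_le; first exact: (cvgP _ L).
apply: nearW => k; have N0 : 0 < k.+1%:R :> R by [].
have intfin : M.-integrable (S `&` cube k.+1%:R) (EFin \o normal_supp).
  by apply: (bounded_integrable halfspace mS (Sfin N0)); exact: normal_supp_bounded.
have If : (\int[M]_(a in S `&` cube k.+1%:R) (normal_supp a)%:E)%E \is a fin_num.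
  by apply: integrable_fin_num intfin; exact: measurableI.
rewrite -(fineK If); apply/lee_addgt0Pr => e e0; rewrite -leeBlDr// -EFinB.
have [d d0 hd] := lower_minkowski_local N0 e0.
apply: (@le_trans _ _ (ereal_inf [set mink_quot Q A r | r in `]0, d[%classic])); last first.
  by apply: ereal_sup_ubound; exists d => //=; rewrite in_itv/= d0.
apply: le_ereal_inf_tmp => _ [r /= rd <-]; rewrite in_itv/= in rd.
have r0 : 0 < r by case/andP : rd.
rewrite /mink_quot; have [h|->] := hd r rd; last first.
  by rewrite gt0_mulye ?leey// lte_fin invr_gt0.
have [->|Xoo] := eqVneq (leb_outer (Defs.msum A (dil r Q) `\` A)) +oo%E.
  by rewrite gt0_mulye ?leey// lte_fin invr_gt0.
rewrite -[X in (_ <= X * _)%E]fineK; last by rewrite ge0_fin_numE ?leb_outer_ge0// ltey.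
by rewrite -EFinM lee_fin mulrC.
Qed.

(** * The upper bound *)

Section upper.
Variable l : R.
Hypotheses (contentB : outer_mink_content (@unit_ball R n) A l) (lS : l%:E = mu S).

Lemma eucl0 : eucl (0 : V) = 0.
Proof. by rewrite /eucl dotv0l sqrtr0. Qed.

(** Open balls make the neighbourhood open, hence measurable, while it stays inside the sum with
    closed balls that enters the isotropic content. *)
Definition oball_sum (r : R) : set V := \bigcup_(y in A) [set x | eucl (x - y) < r].
Definition shell (r : R) : set V := oball_sum r `\` A.

Lemma oball_sum_measurable r : measurable (oball_sum r : set Ul).
Proof.
apply: open_cara_measurable => [i t|]; first exact: leb_outer_halfspace.
apply: bigcup_open => y _.
rewrite (_ : [set _ | _] = (fun x => eucl (x - y)) @^-1` [set t | t < r])//.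
by apply: open_comp => [x _|]; [exact: dist_continuous|exact: open_lt].
Qed.

Lemma shell_measurable r : measurable (shell r : set Ul).
Proof. by apply: measurableD => //; exact: oball_sum_measurable. Qed.

Lemma subset_oball_sum r : 0 < r -> A `<=` oball_sum r.
Proof. by move=> r0 x Ax; exists x => //=; rewrite subrr eucl0. Qed.

Lemma shell_disjoint r : [disjoint A & shell r].
Proof. by apply/disj_setPS => x [Ax [_]]. Qed.

Lemma near0_at_right (P : R -> Prop) : (\forall r \near 0^'+, P r) <-> near0 P.
Proof.
split.
  rewrite near_withinE => /nbhs_ballP[d /= d0 h]; exists d => // r /andP[r0 rd].
  by apply: h => //=; rewrite /ball/= sub0r normrN gtr0_norm.
move=> [d d0 h]; rewrite near_withinE; apply/nbhs_ballP; exists d => // r /=.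
by rewrite /ball/= sub0r normrN => rd r0; apply: h; rewrite r0 -(gtr0_norm r0).
Qed.

Lemma shell_measure e : 0 < e -> near0 (fun r => (lam (shell r) <= (r * (l + e))%:E)%E).
Proof.
move=> e0; have /fine_cvgP[fin /cvgrPdist_le/(_ e e0) cl] := contentB.
have /near0_at_right : \forall r \near 0^'+, mink_quot (@unit_ball R n) A r \is a fin_num /\
    `|l - fine (mink_quot (@unit_ball R n) A r)| <= e by exact: (filterI fin cl).
apply: near0_imp => r r0 [f h].
have {h} : (mink_quot (@unit_ball R n) A r <= (l + e)%:E)%E.
  by rewrite -(fineK f) lee_fin; move: h; rewrite ler_norml; lra.
rewrite /mink_quot lee_pdivrMr// -EFinM mulrC; apply: le_trans.
apply: le_leb_outer => x [[y Ay /= xy] nAx]; split => //.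
exists y => //; exists (x - y); last by rewrite addrC subrK.
exists (r^-1 *: (x - y)); last by rewrite scalerA mulfV ?gt_eqF// scale1r.
by rewrite /unit_ball /eball/= subr0 euclZ gtr0_norm ?invr_gt0// ler_pdivrMl// mulr1 ltW.
Qed.

Let l0 : 0 <= l.
Proof. by rewrite -lee_fin lS outer_measure_ge0. Qed.

Lemma support_cst_integrable (c : R) : M.-integrable S (EFin \o cst c).
Proof.
apply: (integrable_bounded_support (C := `|c|) mS mS) => //.
by rewrite setIid/= -[X in (X < _)%E]/(mu S) -lS ltry.
Qed.

Lemma support_Rintegral_cst (c : R) : \int[M]_(a in S) c = c * l.
Proof. by rewrite Rintegral_cst//= -[X in fine X]/(mu S) -lS. Qed.

Lemma bounded_support_integrable g : @bounded_on_support R n mu S g ->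
  M.-integrable S (EFin \o g).
Proof.
move=> [mg [C C0 gC]].
apply: (integrable_bounded_support (C := C) mS mS) => //.
by rewrite setIid/= -[X in (X < _)%E]/(mu S) -lS ltry.
Qed.

Lemma cutoff_bounded N w : cutoff N w -> @bounded_on_support R n mu S w.
Proof.
move=> [C i _]; split; first exact: C1_cara_measurable.
by exists 1 => // a _; rewrite ger0_norm; have := i a; lra.
Qed.

Lemma cutoff_support_integrable N w : cutoff N w -> M.-integrable S (EFin \o w).
Proof. by move=> cw; apply: bounded_support_integrable; exact: cutoff_bounded cw. Qed.

Lemma cutoff_support_le N w : cutoff N w -> \int[M]_(a in S) w a <= l.
Proof.
move=> cw; rewrite -[leRHS]mul1r -support_Rintegral_cst.
apply: le_Rintegral => //; [exact: cutoff_support_integrable cw|exact: support_cst_integrable|].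
by move=> a _; case: cw => _ /(_ a)/andP[].
Qed.

Lemma weighted_affine_integral w g (c : R) N : cutoff N w ->
  @bounded_on_support R n mu S g ->
  \int[M]_(a in S) (w a * - (c + g a)) =
  - (c * \int[M]_(a in S) w a + \int[M]_(a in S) (w a * g a)).
Proof.
move=> cw bg; have iw := cutoff_support_integrable cw.
have iwg : M.-integrable S (EFin \o (fun a => w a * g a)).
  have [mw [B B0 wB]] := cutoff_bounded cw; have [mg [C C0 gC]] := bg.
  apply: bounded_support_integrable; split; first exact: measurable_funM.
  exists (B * C); first exact: mulr_ge0.
  by move=> a Sa; rewrite normrM ler_pM// ?wB ?gC.
rewrite (_ : (fun a => _) = fun a => (- c) * w a - w a * g a); last first.
  by apply/funext => a; ring.
rewrite RintegralB ?RintegralZl//; first by ring.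
by have := integrableZl mS (- c) iw; apply: eq_integrable.
Qed.

(** As [|nu| = 1], the maximum of [<q, nu>] over a fine net of directions is nearly [1]; the deficit
    is charged to the total mass [l]. *)
Lemma iso_lower N w e : 0 < N -> cutoff N w -> 0 < e ->
  near0 (fun r => \int[M]_(a in S) w a - e <= mean shell r w).
Proof.
move=> N0 cw e0; have l1 : 0 < l + 1 by rewrite ltr_wpDl.
have d0 : 0 < e / (2 * (l + 1)) by rewrite divr_gt0// mulr_gt0.
have e2 : 0 < e / 2 by rewrite divr_gt0.
have [s [s1 sn]] := @direction_net R n _ d0.
have [bm lm] : @lower_bound R n mu S N (mean shell) (max_dot s).
  apply: lower_bound_max_dot => //.
  - by move=> r _; exact: shell_measurable.
  - by move=> r _; exact: shell_disjoint.
  - move=> r q r0 qs x sx; have [Ax|nAx] := pselect (A x); [by left|right; split => //].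
    exists (x - r *: q) => //=; rewrite opprB addrCA subrr addr0 euclZ gtr0_norm//.
    by rewrite gtr_pMr// s1.
have := lm w _ cw e2; apply: near0_imp => r r0; apply: le_trans.
(* The constant [1 - e / (2 (l + 1))] is written in the shape expected by
   [weighted_affine_integral]. *)
have : \int[M]_(a in S) (w a * - (- (1 - e / (2 * (l + 1))) + 0)) <=
    \int[M]_(a in S) (w a * max_dot s a).
  have [Cw iw vw] := cw; have bw := cutoff_bounded cw.
  apply: le_Rintegral => //.
  - apply: (cutoff_integrable halfspace mS (Sfin N0) cw (g := fun=> - (- (1 - e / (2 * (l + 1))) + 0))).
    exact: bounded_support_cst.
  - exact: (cutoff_integrable halfspace mS (Sfin N0) cw bm).
  - move=> a Sa; have /andP[w0 _] := iw a; rewrite ler_wpM2l// addr0 opprK.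
    have [q qs h] := sn _ (nu1 Sa); exact: le_trans h (max_dot_ge a qs).
rewrite (weighted_affine_integral _ cw (@bounded_support_cst R n mu S 0)).
rewrite (_ : \int[M]_(a in S) (w a * cst 0 a) = 0); last first.
  by rewrite /Rintegral integral0_eq// => a _; rewrite /cst mulr0.
have := cutoff_support_le cw.
have : 0 <= \int[M]_(a in S) w a.
  by apply: Rintegral_ge0 => a _; case: cw => _ /(_ a)/andP[].
move: (\int[M]_(a in S) w a) (\int[M]_(a in S) (w a * max_dot s a)) => x y x0 xl.
have : e / (2 * (l + 1)) * x <= e / 2.
  rewrite (_ : _ * x = e / 2 * (x / (l + 1))); last by field; rewrite gt_eqF.
  rewrite ler_piMr ?(ltW e2)// ler_pdivrMr// mul1r; lra.
by move: (e / (2 * (l + 1))) => t; lra.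
Qed.

(** As [mu S] is finite, a large cube misses at most [e / 2] of its mass; a cut-off close to [1] on
    that cube loses another [e / 2]. *)
Lemma cutoff_exhaust N e : 0 < e -> exists N' w,
  [/\ N <= N', 0 < N', cutoff N' w & l - e <= \int[M]_(a in S) w a].
Proof.
move=> e0; have e2 : 0 < e / 2 by rewrite divr_gt0.
have mD k : measurable (S `&` cube k : set U) by exact: measurableI.
have US : \bigcup_k (S `&` cube k.+1%:R) = S.
  apply/seteqP; split => [a [k _ []//]|a Sa].
  have [k ak] := cubeP a; exists k => //; split => //; apply: cube_sub ak.
  by rewrite ler_nat.
have : M (S `&` cube k.+1%:R) @[k --> \oo] --> M (\bigcup_k (S `&` cube k.+1%:R)).
  apply: nondecreasing_cvg_mu => //; first by rewrite US.
  move=> k j kj; apply/subsetPset; apply: setIS; apply: cube_sub.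
  by rewrite ler_nat ltnS.
rewrite US -[X in _ --> X]/(mu S) -lS => /fine_cvgP[fin /cvgrPdist_le/(_ _ e2) cl].
have [k _ /(_ k (leqnn k))] := filterI (filterI fin cl) (nbhs_infty_ger N).
move=> [[/= fk hk] Nk]; have N'0 : 0 < k.+1%:R :> R by [].
have [w cw hw] := cutoff_approx_Rintegral halfspace hull mS (Sfin N'0) measurableT e2.
exists k.+1%:R, w; split => //.
  by rewrite (le_trans Nk)// ler_nat.
have -> : \int[M]_(a in S) w a = \int[M]_(a in S `&` cube k.+1%:R) w a.
  have := cutoff_integral_local S (cst 1) cw (mu := mu).
  by under eq_Rintegral do rewrite /cst mulr1; under [RHS]eq_Rintegral do rewrite /cst mulr1.
have bw := cutoff_bounded cw.
have b1 : @bounded_on_support R n mu S (fun a => `|w a - \1_[set: U] a|).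
  have [mw [B B0 wB]] := bw.
  split; first by apply: measurableT_comp => //; apply: measurable_funB => //; exact: measurable_indic.
  exists (B + 1); first exact: addr_ge0.
  move=> a Sa; rewrite normr_id (le_trans (ler_normB _ _))// lerD ?wB//.
  by rewrite indicE in_setT normr1.
have Db g (bg : @bounded_on_support R n mu S g) := bounded_integrable halfspace mS (Sfin N'0) bg.
have : \int[M]_(a in S `&` cube k.+1%:R) (cst 1 a - `|w a - \1_[set: U] a|) <=
    \int[M]_(a in S `&` cube k.+1%:R) w a.
  apply: le_Rintegral => //; [|exact: Db|].
    by apply: Db; apply: bounded_sub => //; exact: bounded_support_cst.
  move=> a _; rewrite /cst indicE in_setT/= lerBlDr -lerBlDl.
  by rewrite distrC ler_norm.
rewrite RintegralB//; [|by apply: Db; exact: bounded_support_cst|exact: Db].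
rewrite Rintegral_cst//= mul1r.
by move: hw hk; rewrite ler_norml /=; move: (fine _) (\int[M]_(a in _) _) (\int[M]_(a in _) _) => x y z; lra.
Qed.

(* Since the total mass of the shell tends to [l = mu S], the lower bound for the
   complementary cut-off [chi (1 - w)] is an upper bound for [w]. *)
Lemma iso_upper N w e : 0 < N -> cutoff N w -> 0 < e ->
  near0 (fun r => mean shell r w <= \int[M]_(a in S) w a + e).
Proof.
move=> N0 cw e0; have e4 : 0 < e / 4 by rewrite divr_gt0.
have [N' [chi [NN' N'0 cchi hchi]]] := cutoff_exhaust N e4.
have cw' := cutoff_le NN' cw; have [C1m i1m] := cutoff_onem cw'.
have cv := cutoffM cchi C1m i1m.
have [Cw iw vw] := cw'; have [Cchi ichi vchi] := cchi; have [Cv iv vv] := cv.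
(* The sum lies between [chi] and [1]: its integral over the shell is at most the volume of the
   shell, and over [S] it is at least [l - e / 4]. *)
have csum : cutoff N' (fun x => chi x * (1 - w x) + w x).
  split; first exact: C1D.
    by move=> x; have := iw x; have := ichi x; nra.
  by move=> x nx; rewrite vv// vw// addr0.
have := near0_and (iso_lower N'0 cv e4) (shell_measure e4).
apply: near0_imp => r r0 [h1 h2].
have h3 : mean shell r (fun x => chi x * (1 - w x) + w x) <= l + e / 4.
  rewrite /mean ler_pdivrMl// -lee_fin.
  exact: (le_trans (leb_integral_le_measure (shell_measurable r) csum) h2).
have h4 : \int[M]_(a in S) chi a <= \int[M]_(a in S) (chi a * (1 - w a) + w a).
  apply: le_Rintegral => //; [exact: cutoff_support_integrable cchi|exact: cutoff_support_integrable csum|].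
  by move=> a _; have := iw a; have := ichi a; nra.
rewrite (mean_add r0 (shell_measurable r) cv cw') in h3.
rewrite RintegralD// in h4; [|exact: cutoff_support_integrable cv|exact: cutoff_support_integrable cw'].
move: h1 h3 h4 hchi.
move: (\int[M]_(a in S) w a) (\int[M]_(a in S) chi a) (\int[M]_(a in S) _) (mean shell r w) (mean shell r _).
by move=> x1 x2 x3 x4 x5; lra.
Qed.

(** For [b = (z, rho)] this is the sum of [A] and the open ball of centre [r z] and radius
    [rho r]. *)
Definition ball_hull (b : V * R) (r : R) : set V :=
  shiftset (oball_sum (b.2 * r)) (r *: b.1).

Lemma ball_hull_measurable b r : measurable (ball_hull b r : set Ul).
Proof. by apply: measurable_shift; exact: oball_sum_measurable. Qed.

Lemma subset_ball_hull b r : 0 < r -> eucl b.1 < b.2 -> A `<=` ball_hull b r.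
Proof.
move=> r0 b12 x Ax; exists x => //=; rewrite addrAC subrr add0r euclN.
by rewrite euclZ gtr0_norm// mulrC ltr_pM2r.
Qed.

(* Translating back by [r z] turns the [rho r]-neighbourhood of [A] shifted by
   [r z] into the translate of [A] together with the translate of a shell. *)
Lemma ball_hull_upper N w b e : 0 < N -> cutoff N w -> 0 < e -> 0 < b.2 ->
  eucl b.1 < b.2 ->
  near0 (fun r => mean (fun r => ball_hull b r `\` A) r w <=
    b.2 * \int[M]_(a in S) w a + \int[M]_(a in S) (w a * dotv b.1 (nu a)) + e).
Proof.
move=> N0 cw e0 b20 b12; have [Cw iw vw] := cw.
have [L L0 DL] := derive_bounded b.1 N0 Cw vw.
have e4 : 0 < e / 4 by rewrite divr_gt0.
have e4b : 0 < e / 4 / b.2 by rewrite divr_gt0.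
have flux := translation_flux halfspace n0 mA nu1 mnu GG N0 cw b.1 e4.
have up := near0_scale b20 (iso_upper N0 cw e4b).
(* Translating the shell by [r z] changes the integral of [w] by at most [r L] per unit of volume. A
   crude bound of order [r] for the volume makes this negligible after division by [r], so the
   tolerance [1] suffices. *)
have vol := near0_scale b20 (shell_measure (@ltr01 R)).
have small : near0 (fun r : R => L * (b.2 * r * (l + 1)) <= e / 4).
  exists (e / 4 / (L * b.2 * (l + 1) + 1)).
    by rewrite divr_gt0// ltr_wpDl// !mulr_ge0 ?addr_ge0 ?(ltW b20).
  move=> r /andP[r0]; rewrite ltr_pdivlMr; last first.
    by rewrite ltr_wpDl// !mulr_ge0 ?addr_ge0 ?(ltW b20).
  have : 0 <= L * b.2 * (l + 1) by rewrite !mulr_ge0 ?addr_ge0 ?(ltW b20).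
  by move=> _ h; rewrite (_ : L * _ = r * (L * b.2 * (l + 1))); [lra|ring].
have := near0_and (near0_and flux up) (near0_and vol small).
apply: near0_imp => r r0 [[/ler_normlP[_ h1] h2] [h3 h4]].
have br0 : 0 < b.2 * r by rewrite mulr_gt0.
have mA' := measurable_shift (r *: b.1) mA.
have msh := shell_measurable (b.2 * r).
have mSh := measurable_shift (r *: b.1) msh.
have E1 : \int[lam]_(x in ball_hull b r) w x =
    \int[lam]_(x in A) w x + \int[lam]_(x in ball_hull b r `\` A) w x.
  rewrite -(leb_integral_setU _ _ _ cw)//.
  - congr (Rintegral _ _ _); apply/esym/setDUK; exact: subset_ball_hull.
  - by apply: measurableD => //; exact: ball_hull_measurable.
  - by apply/disj_setPS => x [Ax [_]].
have E2 : \int[lam]_(x in ball_hull b r) w x =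
    \int[lam]_(x in shiftset A (r *: b.1)) w x +
    \int[lam]_(x in shiftset (shell (b.2 * r)) (r *: b.1)) w x.
  rewrite -(leb_integral_setU mA' mSh _ cw).
  - congr (Rintegral _ _ _); rewrite /ball_hull -[in LHS](setDUK (subset_oball_sum br0)).
    by apply/seteqP; split.
  - by apply/disj_setPS => x [Ax [_]].
have E3 : \int[lam]_(x in shiftset (shell (b.2 * r)) (r *: b.1)) w x <=
    \int[lam]_(x in shell (b.2 * r)) w x + r * L * fine (lam (shell (b.2 * r))).
  have fsh : (lam (shell (b.2 * r)) < +oo)%E by apply: le_lt_trans h3 _; rewrite ltry.
  have cwW : continuous w by exact: C1_continuous.
  rewrite leb_integral_shift//; last 2 first.
  - exact: leb_measurable_continuous.
  - by move=> x; have /andP[] := iw x.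
  have i1 : lam.-integrable (shell (b.2 * r)) (EFin \o (fun x => w (x + r *: b.1))).
    apply: (integrable_bounded_support (C := 1) msh msh) => //.
    - by rewrite setIid.
    - apply: leb_measurable_continuous => // x.
      apply: (@continuous_comp _ _ _ (fun x : V => x + r *: b.1) w); last exact: cwW.
      exact: shift_continuous.
    - by move=> x _; rewrite ger0_norm; have := iw (x + r *: b.1); lra.
  have i2 := cutoff_leb_integrable msh cw.
  have i3 : lam.-integrable (shell (b.2 * r)) (EFin \o cst (r * L)).
    apply: (integrable_bounded_support (C := `|r * L|) msh msh) => //.
    by rewrite setIid.
  rewrite -Rintegral_cst// -RintegralD//; apply: le_Rintegral => //.
    by have := integrableD msh i2 i3; apply: eq_integrable.
  move=> x _; rewrite -lerBlDl (le_trans (ler_norm _))//.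
  exact: (C1_lipschitz x Cw DL r0).
have h3' : fine (lam (shell (b.2 * r))) <= b.2 * r * (l + 1).
  rewrite -lee_fin fineK// ge0_fin_numE ?outer_measure_ge0//.
  by apply: le_lt_trans h3 _; rewrite ltry.
have h5 : r^-1 * (r * L * fine (lam (shell (b.2 * r)))) <= e / 4.
  rewrite !mulrA mulVf ?gt_eqF// mul1r; apply: le_trans h4.
  by rewrite ler_wpM2l.
have h6 : r^-1 * \int[lam]_(x in shell (b.2 * r)) w x <= b.2 * \int[M]_(a in S) w a + e / 4.
  have := ler_wpM2l (ltW b20) h2; rewrite /mean mulrDr.
  rewrite [b.2 * (e / 4 / b.2)]mulrC divfK ?gt_eqF//.
  by rewrite mulrA invfM mulrA mulfV ?gt_eqF// mul1r.
rewrite /mean.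
have -> : \int[lam]_(x in ball_hull b r `\` A) w x =
    (\int[lam]_(x in shiftset A (r *: b.1)) w x - \int[lam]_(x in A) w x) +
    \int[lam]_(x in shiftset (shell (b.2 * r)) (r *: b.1)) w x.
  by rewrite addrAC -E2 E1 addrAC subrr add0r.
have h7 : r^-1 * \int[lam]_(x in shiftset (shell (b.2 * r)) (r *: b.1)) w x <=
  r^-1 * \int[lam]_(x in shell (b.2 * r)) w x + r^-1 * (r * L * fine (lam (shell (b.2 * r)))).
  by rewrite -mulrDr ler_wpM2l// invr_ge0 ltW.
have arith (x1 x2 x3 x4 x5 x6 : R) : x1 - x5 <= e / 4 -> x2 <= e / 4 ->
  x3 <= x6 + e / 4 -> x4 <= x3 + x2 -> x1 + x4 <= x6 + x5 + e by lra.
rewrite mulrDr; exact: arith h1 h5 h6 h7.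
Qed.

Definition hull_gap (s : seq (V * R)) (r : R) : set V :=
  (\big[setI/setT]_(b <- s) ball_hull b r) `\` A.

Lemma hull_gap_measurable s r : measurable (hull_gap s r : set Ul).
Proof.
apply: measurableD => //; elim: s => [|b s ih]; first by rewrite big_nil.
by rewrite big_cons; apply: measurableI => //; exact: ball_hull_measurable.
Qed.

Lemma hull_gap_subset s r b : b \in s -> hull_gap s r `<=` ball_hull b r `\` A.
Proof.
move=> bs x [h nAx]; split => //; elim: s bs h => // b' s ih.
by rewrite big_cons inE => /predU1P[->[]//|bs [_]]; exact: ih.
Qed.

Lemma dilate_subset_hull_gap s r : 0 < r ->
  (forall b, b \in s -> forall x, Q x -> eucl (x - b.1) < b.2) ->
  Defs.msum A (dil r Q) `\` A `<=` hull_gap s r.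
Proof.
move=> r0 sQ x [[y Ay [_ [q Qq <-] <-]] nA]; split => //.
elim: s sQ => [|b s ih] sQ; first by rewrite big_nil.
rewrite big_cons; split; last by apply: ih => b' b's; apply: sQ; rewrite inE b's orbT.
exists y => //=.
rewrite (_ : _ - y = r *: (q - b.1)); last by rewrite scalerBr -[y + _ - _]addrA [y + _]addrC addrK.
by rewrite euclZ gtr0_norm// mulrC ltr_pM2r// sQ// mem_head.
Qed.

(** The function [1 - w] is nonnegative, so its integral over [X] is at most that over [Y]; it is
    expressed through measures to keep to integrals of the cut-off [w]. *)
Lemma leb_measure_subset N (X Y : set Ul) w : measurable X -> measurable Y ->
  X `<=` Y -> (lam Y < +oo)%E -> cutoff N w ->
  fine (lam X) <= \int[lam]_(x in X) w x + (fine (lam Y) - \int[lam]_(x in Y) w x).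
Proof.
move=> mX mY XY fY cw; have mD : measurable (Y `\` X) by exact: measurableD.
have dXY : [disjoint X & Y `\` X] by apply/disj_setPS => x [Xx []].
have fX : (lam X < +oo)%E by apply: le_lt_trans fY; apply: le_measure; rewrite ?inE.
have fD : (lam (Y `\` X) < +oo)%E.
  by apply: le_lt_trans fY; apply: le_measure; rewrite ?inE//; exact: subDsetl.
have finX : lam X \is a fin_num by rewrite ge0_fin_numE.
have finD : lam (Y `\` X) \is a fin_num by rewrite ge0_fin_numE.
rewrite -{1 2}(setDUK XY) (leb_integral_setU mX mD dXY cw).
rewrite measureU//; last by rewrite setDE setICA setICr setI0.
rewrite fineD//; have := leb_integral_le_measure mD cw.
rewrite -[X in (_ <= X)%E]fineK// lee_fin.
by move: (fine _) (fine _) (\int[lam]_(x in X) _) (\int[lam]_(x in _) _) => x1 x2 x3 x4; lra.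
Qed.

(** The gap lies in every ball hull, and the opposite sign turns the upper bound for the hull into a
    lower bound, the form that [lower_bound_bigmax] combines over [b]. *)
Lemma hull_gap_lower_bound N s b : 0 < N -> b \in s -> 0 < b.2 -> eucl b.1 < b.2 ->
  @lower_bound R n mu S N (fun r w => - mean (hull_gap s) r w)
    (fun a => - (b.2 + dotv b.1 (nu a))).
Proof.
move=> N0 bs b20 b12; split.
  have := bounded_sub (@bounded_support_cst R n mu S (- b.2)) (dot_normal_bounded b.1).
  by under eq_fun do rewrite /cst -opprD.
move=> w e cw e0; have := ball_hull_upper N0 cw e0 b20 b12.
apply: near0_imp => r r0.
rewrite (weighted_affine_integral _ cw (dot_normal_bounded b.1)).
have : mean (hull_gap s) r w <= mean (fun r => ball_hull b r `\` A) r w.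
  rewrite /mean ler_pM2l ?invr_gt0//; apply: (leb_integral_subset _ _ _ cw).
  - exact: hull_gap_measurable.
  - by apply: measurableD => //; exact: ball_hull_measurable.
  - exact: hull_gap_subset.
have arith (x1 x2 x3 : R) : x1 <= x2 -> x2 <= x3 + e -> - x3 - e <= - x1 by lra.
exact: arith.
Qed.

Lemma normal_supp_integrable : M.-integrable S (EFin \o normal_supp).
Proof. exact: bounded_support_integrable normal_supp_bounded. Qed.

(* The measure of the gap is its integral against a cutoff [w] with almost full
   mass on [S], controlled by the ball hulls, plus its integral against [1 - w],
   controlled by a shell. *)
Lemma dilate_upper e : 0 < e ->
  near0 (fun r => (leb_outer (Defs.msum A (dil r Q) `\` A) <=
    (r * (\int[M]_(a in S) normal_supp a + e))%:E)%E).
Proof.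
move=> e0; have [c [c0 Kc]] := Kbound.
have l1 : 0 < l + 1 by rewrite ltr_wpDl.
have c1 : 0 < c + 1 by rewrite addr_gt0.
(* At the end [e / 4] is spent on the circumscribed balls, [e / 8] on the lower bound, and [3 e / 8]
   on the shell: its volume, its integral of [w] and the mass missed by [w] each cost
   [e / (8 (c + 1))], multiplied by the relative width [c + 1]. *)
have e1 : 0 < e / (8 * (l + 1)) by rewrite divr_gt0// mulr_gt0.
have e2 : 0 < e / (8 * (c + 1)) by rewrite divr_gt0// mulr_gt0.
have e8 : 0 < e / 8 by rewrite divr_gt0.
have [s' [s'K s'n]] := circumscribed_balls K0 c0 Kc e1.
(* The centred ball [b0] confines the gap to the shell of width [(c + 1) r], where the isotropic
   estimates apply, and also provides the default value of the maximum. *)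
pose b0 : V * R := (0, c + 1); pose s := b0 :: s'.
have sK b : b \in s -> 0 < b.2 /\ forall x, K x -> eucl (x - b.1) < b.2.
  rewrite inE => /predU1P[->/=|/s'K//]; split => // x Kx.
  by rewrite subr0 (le_lt_trans (Kc _ Kx))// ltrDl.
have [N [w [_ N0 cw hw]]] := cutoff_exhaust 0 e2.
pose g (b : V * R) a := - (b.2 + dotv b.1 (nu a)).
have lg b : b \in s -> @lower_bound R n mu S N (fun r w => - mean (hull_gap s) r w) (g b).
  move=> bs; have [b2 bK] := sK _ bs; apply: hull_gap_lower_bound => //.
  by have := bK 0 K0; rewrite sub0r euclN.
have Ladd r w1 w2 : 0 < r -> cutoff N w1 -> cutoff N w2 ->
    - mean (hull_gap s) r (fun x => w1 x + w2 x) =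
    - mean (hull_gap s) r w1 - mean (hull_gap s) r w2.
  by move=> r0 cw1 cw2; rewrite (mean_add r0 (hull_gap_measurable s r) cw1 cw2) opprD.
have [bG lG] := lower_bound_bigmax halfspace hull mS (Sfin N0) Ladd (lg b0 (mem_head _ _)) lg.
have GE a : S a -> - (2 * (e / (8 * (l + 1))) + normal_supp a) <=
    \big[Num.max/g b0 a]_(b <- s) g b a.
  move=> Sa; have [b bs' hb] := s'n _ (nu1 Sa).
  apply: (@le_trans _ _ (g b a)); first by rewrite /g lerN2 [leRHS]addrC; exact: hb.
  have : b \in s by rewrite inE bs' orbT.
  elim: s {lg Ladd bG lG sK} => // b' s ih; rewrite inE big_cons le_max.
  by move=> /predU1P[->|/ih ->]; rewrite ?lexx ?orbT.
have iG : - (2 * (e / (8 * (l + 1))) * \int[M]_(a in S) w a +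
      \int[M]_(a in S) (w a * normal_supp a)) <=
    \int[M]_(a in S) (w a * \big[Num.max/g b0 a]_(b <- s) g b a).
  rewrite -(weighted_affine_integral _ cw normal_supp_bounded).
  have [_ iw _] := cw; apply: le_Rintegral => //.
  - apply: (cutoff_integrable halfspace mS (Sfin N0) cw
      (g := fun a => - (2 * (e / (8 * (l + 1))) + normal_supp a))).
    have := bounded_sub (@bounded_support_cst R n mu S (- (2 * (e / (8 * (l + 1)))))) normal_supp_bounded.
    by under eq_fun do rewrite /cst -opprD.
  - exact: (cutoff_integrable halfspace mS (Sfin N0) cw bG).
  - by move=> a Sa; have /andP[w0 _] := iw a; rewrite ler_wpM2l// GE.
have wI : \int[M]_(a in S) (w a * normal_supp a) <= \int[M]_(a in S) normal_supp a.
  apply: le_Rintegral => //; [|exact: normal_supp_integrable|].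
    exact: (cutoff_integrable halfspace mS (Sfin N0) cw normal_supp_bounded).
  move=> a _; have [_ /(_ a)/andP[w0 w1] _] := cw.
  by rewrite -[leRHS]mul1r ler_wpM2r// normal_supp_ge0.
have := near0_and (lG w _ cw e8) (near0_and
  (near0_scale c1 (iso_lower N0 cw e2)) (near0_scale c1 (shell_measure e2))).
apply: near0_imp => r r0 [h1 [h2 h3]]; have cr0 : 0 < (c + 1) * r by rewrite mulr_gt0.
have fsh : (lam (shell ((c + 1) * r)) < +oo)%E by apply: le_lt_trans h3 _; rewrite ltry.
have Ysh : hull_gap s r `<=` shell ((c + 1) * r).
  apply: subset_trans (hull_gap_subset (mem_head _ _)) _ => x [+ nAx].
  by rewrite /ball_hull/shiftset/= scaler0 subr0.
have fY : lam (hull_gap s r) \is a fin_num.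
  rewrite ge0_fin_numE ?outer_measure_ge0//; apply: le_lt_trans fsh.
  exact: le_leb_outer.
have QY : (leb_outer (Defs.msum A (dil r Q) `\` A) <= lam (hull_gap s r))%E.
  apply/le_leb_outer/dilate_subset_hull_gap => // b bs x Qx.
  by have [_] := sK b bs; apply; left.
apply: (le_trans QY); rewrite -(fineK fY) lee_fin -ler_pdivrMl//.
have {h3} : fine (lam (shell ((c + 1) * r))) <= (c + 1) * r * (l + e / (8 * (c + 1))).
  by rewrite -lee_fin fineK// ge0_fin_numE.
move: h2; rewrite {1}/mean -ler_pdivrMl ?invr_gt0// invrK => h2 h3.
have := leb_measure_subset (hull_gap_measurable s r) (shell_measurable _) Ysh fsh cw.
have ri : 0 < r^-1 by rewrite invr_gt0.
rewrite -(ler_pM2l ri) mulrDr -/(mean (hull_gap s) r w) => h4; apply: (le_trans h4).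
have h5 : r^-1 * (fine (lam (shell ((c + 1) * r))) - \int[lam]_(x in shell ((c + 1) * r)) w x)
    <= e * (3 / 8).
  rewrite ler_pdivrMl//; apply: (le_trans (lerB h3 h2)); rewrite -mulrBr.
  rewrite [leRHS](_ : _ = (c + 1) * r * (3 * (e / (8 * (c + 1))))); last first.
    by field; rewrite gt_eqF.
  by rewrite ler_pM2l//; move: hw; move: (e / _) (\int[M]_(a in S) _) => x y; lra.
have h6 : 2 * (e / (8 * (l + 1))) * \int[M]_(a in S) w a <= e / 4.
  have wl := cutoff_support_le cw.
  apply: (@le_trans _ _ (2 * (e / (8 * (l + 1))) * (l + 1))).
    by rewrite ler_pM2l ?(le_trans wl) ?lerDl// mulr_gt0.
  by rewrite le_eqVlt; apply/orP; left; apply/eqP; field; rewrite gt_eqF.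
have arith (x1 x2 x3 x4 x5 x6 : R) : x3 - e / 8 <= - x4 -> - (x6 + x2) <= x3 ->
  x2 <= x1 -> x5 <= e * (3 / 8) -> x6 <= e / 4 -> x4 + x5 <= x1 + e by lra.
exact: arith h1 iG wI h5 h6.
Qed.

Lemma mink_content_integral :
  outer_mink_content Q A (\int[M]_(a in S) normal_supp a).
Proof.
have IE : (\int[M]_(a in S) (normal_supp a)%:E)%E = (\int[M]_(a in S) normal_supp a)%:E.
  by rewrite /Rintegral fineK//; exact: (integrable_fin_num mS normal_supp_integrable).
have up e : 0 < e -> near0 (fun r => (mink_quot Q A r <=
    (\int[M]_(a in S) normal_supp a + e)%:E)%E).
  move=> e0; apply: near0_imp (dilate_upper e0) => r r0.
  by rewrite /mink_quot lee_pdivrMr// -EFinM mulrC.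
have fin : near0 (fun r => mink_quot Q A r \is a fin_num).
  apply: near0_imp (up 1 ltr01) => r r0 h.
  rewrite ge0_fin_numE; first by apply: le_lt_trans h _; rewrite ltry.
  by rewrite /mink_quot mule_ge0 ?leb_outer_ge0// lee_fin invr_ge0 ltW.
have lo e : 0 < e -> near0 (fun r => ((\int[M]_(a in S) normal_supp a - e)%:E <= mink_quot Q A r)%E).
  move=> e0; have := lower_minkowski; rewrite aniso_integral IE => h.
  have : ((\int[M]_(a in S) normal_supp a - e)%:E < liminf0 (mink_quot Q A))%E.
    by apply: lt_le_trans h; rewrite lte_fin gtrBl.
  move=> /ereal_sup_gt[_ [d /= d0 <-]] hd; rewrite in_itv/= andbT in d0.
  exists d => // r rd; apply: (le_trans (ltW hd)); apply: ereal_inf_lbound.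
  by exists r => //=; rewrite in_itv.
apply/fine_cvgP; split; first exact/near0_at_right.
apply/cvgrPdist_le => e e0; apply/near0_at_right.
apply: near0_imp (near0_and fin (near0_and (lo e e0) (up e e0))) => r r0 [f [h1 h2]] /=.
by move: h1 h2; rewrite -(fineK f) !lee_fin ler_norml; lra.
Qed.

Lemma aniso_mink_content :
  exists l', outer_mink_content Q A l' /\
    l'%:E = @lc_int R V mu S (fun a => supp_fun K (nu a)).
Proof.
exists (\int[M]_(a in S) normal_supp a); split; first exact: mink_content_integral.
rewrite aniso_integral /Rintegral fineK//.
exact: (integrable_fin_num mS normal_supp_integrable).
Qed.

End upper.
End lower.

(** * Specialisation to Hausdorff measure on the essential boundary *)

Lemma cara_measE {R : realType} {T : Type} (mu : {outer_measure set T -> \bar R}) (A : set T) :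
  Defs.cara_meas mu A -> mu.-caratheodory A.
Proof. by move=> mA E; rewrite -setDE; exact: mA. Qed.

Theorem theorem4p1 (R : realType) (n : nat) (A Q : set 'rV[R]_n)
    (nu : 'rV[R]_n -> 'rV[R]_n) :
  (0 < n)%N ->
  finite_perimeter A ->
  compact Q -> Q !=set0 ->
  outer_normal A nu ->
  (liminf0 (mink_quot Q A) >= aniso_perimeter Q A nu)%E /\
  ((exists l : R, outer_mink_content (@unit_ball R n) A l /\ l%:E = perimeter A) ->
   exists l : R, outer_mink_content Q A l /\ l%:E = aniso_perimeter Q A nu).
Proof.
move=> n0 [mA _] cQ _ [nu1 [mnu GG]].
have half := @hausdorff_halfspace R n n.-1.
have hull := @hausdorff_hull R n n.-1.
have mA' : (@leb_outer R n).-caratheodory A by exact: cara_measE.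
have mnu' i t : (@hausdorff R n n.-1).-caratheodory (ess_bd A `&` [set a | t < nu a 0 i]).
  by apply: cara_measE; exact: mnu.
split; first exact: (lower_minkowski half hull n0 mA' nu1 mnu' GG cQ).
move=> [l [contentB lP]].
exact: (aniso_mink_content half hull n0 mA' nu1 mnu' GG cQ contentB lP).
Qed.
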